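(* Suppose that $\mathcal L$ is star-shaped about $\lambda_{\mathrm{or}}$, that $\mathcal B$ is star-shaped about $b_{\mathrm{or}}$, that the $\xi_i$ are independent and each $\xi_i$ is $K\sigma_i$-sub-Gaussian, and that all $\sigma_i\in[\sqrt2,\sigma_{\max}]$. Moreover suppose that, for some $M>0$, $|\mu_i|\le M$, $|2\lambda_{\mathrm{or}}(X_i)\mu_i-b_{\mathrm{or}}(X_i)|\le M$ and $|\lambda_{\mathrm{or}}(X_i)|\le M$ for all $i$. Then there exist constants $C,c$ that depend on $K$, $\sigma_{\max}$ and $M$ such that for every $\delta\in(0,1/2]$, with probability at least $1-\delta$, $$\frac1n\sum_{i=1}^n\Big\{(\hat\lambda(X_i)-\lambda_{\mathrm{or}}(X_i))Z_i-(\hat b(X_i)-b_{\mathrm{or}}(X_i))\Big\}^2\le t_*^2$$ and $$\sqrt{\frac1n\sum_{i=1}^n\Big\{\mu_i-\big(\hat b(X_i)+(1-\hat\lambda(X_i))Z_i\big)\Big\}^2}\le\sqrt{\frac1n\sum_{i=1}^n\Big\{\mu_i-\big(b_{\mathrm{or}}(X_i)+(1-\lambda_{\mathrm{or}}(X_i))Z_i\big)\Big\}^2}+t_*,$$ where $$t_*=\inf\Big\{t\ge0:\ \frac{t^2}{C}\ge\sqrt{\log(n/\delta)}\,\mathscr G_n(ct;\mathcal B_{\mathrm{or}})+\log(n/\delta)\,\mathscr G_n(ct;\mathcal L_{\mathrm{or}})+t|\log\delta|\sqrt{\frac{\log n}{n}}+|\log\delta|^2\frac{\log n}{n}\Bi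g\}.$$
   Context: Setting: $X_1,\dots,X_n\in\mathcal X$ (a generic covariate space) and $\mu_1,\dots,\mu_n\in\mathbb R$ are fixed (non-random); the noise variances $\sigma_i^2$ are known and regarded as part of $X_i$. One observes $Z_i=\mu_i+\xi_i$ where $\mathbb E[\xi_i]=0$, $\mathrm{Var}(\xi_i)=\sigma_i^2$, and, for a constant $K>0$, $\xi_i$ is $K\sigma_i$-sub-Gaussian in the sense that $\mathbb E[\exp(t\xi_i)]\le\exp(K^2\sigma_i^2t^2/2)$ for all $t\in\mathbb R$. $\mathcal L$ and $\mathcal B$ are classes of functions $\mathcal X\to\mathbb R$, with $\lambda(x)\in[0,1]$ for all $x$ and all $\lambda\in\mathcal L$. Define $$\mathrm{SURE}(\lambda,b)=\frac1n\sum_{i=1}^n\sigma_i^2+\frac1n\sum_{i=1}^n\{\lambda(X_i)Z_i-b(X_i)\}^2-\frac2n\sum_{i=1}^n\sigma_i^2\lambda(X_i),$$ $(\hat\lambda,\hat b)\in\arg\min\{\mathrm{SURE}(\lambda,b):\lambda\in\mathcal L,\ b\in\mathcal B\}$, and the oracle pair $$(\lambda_{\mathrm{or}},b_{\mathrm{or}})\in\arg\min_{\lambda\in\mathcal L,\,b\in\mathcal B}\frac1n\sum_{i=1}^n\mathbb E\Big[\big\{\mu_i-(b(X_i)+(1-\lambda(X_i))Z_i)\big\}^2\Big],$$ the expectation being over the $\xi_i$ only. A class $\mathcal H$ is star-shaped about $h_0$ if $\eta h+(1-\eta)h_0\in\mathcal H$ for all $h\in\mathcal H$, $\eta\in[0,1]$.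 Write $\mathcal B_{\mathrm{or}}=\mathcal B-b_{\mathrm{or}}=\{b-b_{\mathrm{or}}:b\in\mathcal B\}$ and $\mathcal L_{\mathrm{or}}=\mathcal L-\lambda_{\mathrm{or}}$. For a class $\mathcal H$ of functions $\mathcal X\to\mathbb R$ and $t>0$, the local Gaussian complexity is $$\mathscr G_n(t;\mathcal H)=\mathbb E\Big[\sup\Big\{\frac1n\sum_{i=1}^nh(X_i)\zeta_i:\ h\in\mathcal H,\ \frac1n\sum_{i=1}^nh^2(X_i)\le t^2\Big\}\Big],$$ with expectation over $\zeta_1,\dots,\zeta_n$ i.i.d. $\mathrm N(0,1)$.
   Formalization: The infimum defining t_* is taken over t > 0 instead of t ≥ 0, since the local Gaussian complexity is defined only for positive radius; this changes nothing for n ≥ 2, while for n = 1 admitting t = 0 would make t_* = 0 and the claim false. *)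

(* Defs.v *)
From HB Require Import structures.
From mathcomp Require Import all_boot all_order all_algebra.
From mathcomp Require Import all_classical all_reals all_analysis.

Set Implicit Arguments.
Unset Strict Implicit.
Unset Printing Implicit Defensive.

Import Order.TTheory GRing.Theory Num.Theory.
Import numFieldNormedType.Exports.

Local Open Scope classical_set_scope.
Local Open Scope ring_scope.

Definition argmin_on (T : Type) (d : Order.disp_t) (O : porderType d)
    (D : set T) (f : T -> O) : set T :=
  [set x | D x /\ forall y, D y -> (f x <= f y)%O].

Definition star_shaped (R : realType) (XX : Type) (H : set (XX -> R))
    (h0 : XX -> R) : Prop :=
  forall h, H h -> forall eta : R, 0 <= eta <= 1 ->
    H (fun x => eta * h x + (1 - eta) * h0 x).

Definition class_shift (R : realType) (XX : Type) (H : set (XX -> R))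
    (h0 : XX -> R) : set (XX -> R) :=
  [set (fun x => h x - h0 x) | h in H].

Definition avg (R : realType) (n : nat) (u : 'I_n -> R) : R :=
  n%:R^-1 * \sum_(i < n) u i.

Definition mutually_independent (R : realType) (d : measure_display)
    (Omega : measurableType d) (P : probability Omega R) (n : nat)
    (xi : 'I_n -> {RV P >-> R}) : Prop :=
  forall (J : {set 'I_n}) (A : 'I_n -> set R), (forall i, measurable (A i)) ->
    P (\bigcap_(i in [set` J]) (xi i @^-1` A i)) =
    (\prod_(i in J) P (xi i @^-1` A i))%E.

(* The law of [zeta i] is compared with N(0,1) on Borel sets only: off the
   sigma-algebra the values of both set functions are junk. *)
Definition iid_std_normal (R : realType) (d : measure_display)
    (Omega : measurableType d) (P : probability Omega R) (n : nat)
    (zeta : 'I_n -> {RV P >-> R}) : Prop :=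
  mutually_independent zeta /\
  forall (i : 'I_n) (A : set R), measurable A ->
    distribution P (zeta i) A = normal_prob 0 1 A.

Definition subgaussian (R : realType) (d : measure_display)
    (Omega : measurableType d) (P : probability Omega R)
    (xi : {RV P >-> R}) (s : R) : Prop :=
  forall t : R,
    ('E_P[fun w => expR (t * xi w)%R] <= (expR (s ^+ 2 * t ^+ 2 / 2))%:E)%E.

Definition SURE (R : realType) (XX : Type) (n : nat) (X : 'I_n -> XX)
    (sigma Z : 'I_n -> R) (lam b : XX -> R) : R :=
  avg (fun i => sigma i ^+ 2)
  + avg (fun i => (lam (X i) * Z i - b (X i)) ^+ 2)
  - 2 * avg (fun i => sigma i ^+ 2 * lam (X i)).

Definition risk (R : realType) (d : measure_display)
    (Omega : measurableType d) (P : probability Omega R) (XX : Type) (n : nat)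
    (X : 'I_n -> XX) (mu : 'I_n -> R) (Z : 'I_n -> Omega -> R)
    (lam b : XX -> R) : \bar R :=
  ((n%:R^-1)%:E * \sum_(i < n)
     'E_P[fun w => ((mu i - (b (X i) + (1 - lam (X i)) * Z i w)) ^+ 2)%R])%E.

(* Written for an arbitrary family [zeta]; it is the local Gaussian complexity
   when [zeta] satisfies [iid_std_normal], and then depends only on the law of
   [zeta], not on the choice of [Omega], [P]. *)
Definition gauss_complexity (R : realType) (d : measure_display)
    (Omega : measurableType d) (P : probability Omega R) (n : nat)
    (zeta : 'I_n -> {RV P >-> R}) (XX : Type) (X : 'I_n -> XX)
    (H : set (XX -> R)) (t : R) : \bar R :=
  (\int[P]_w ereal_sup
     [set (avg (fun i => h (X i) * zeta i w)%R)%:E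
       | h in [set h | H h /\ (avg (fun i => h (X i) ^+ 2) <= t ^+ 2)%R]])%E.

(* [GB] and [GL] stand for the local Gaussian complexities of the two centered
   classes. They are only meaningful at positive radii, so the infimum is over
   t > 0. For n >= 2 the point t = 0 never satisfies the inequality (the last
   term is positive), so nothing changes; for n = 1 admitting t = 0 would make
   the infimum identically 0. *)
Definition t_star (R : realType) (n : nat) (GB GL : R -> \bar R)
    (C c delta : R) : R :=
  inf [set t : R | 0 < t /\
    ((Num.sqrt (ln (n%:R / delta)))%:E * GB (c * t)%R
     + (ln (n%:R / delta))%:E * GL (c * t)%R
     + (t * `|ln delta| * Num.sqrt (ln n%:R / n%:R))%:E
     + (`|ln delta| ^+ 2 * (ln n%:R / n%:R))%:E
     <= (t ^+ 2 / C)%:E)%E].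

(* Main.v *)
Require Import Defs.
From HB Require Import structures.
From mathcomp Require Import all_boot all_order all_algebra.
From mathcomp Require Import all_classical all_reals all_analysis.
From mathcomp Require Import measurable_realfun.
From mathcomp Require Import ring lra zify.

Set Implicit Arguments.
Unset Strict Implicit.
Unset Printing Implicit Defensive.

Import Order.TTheory GRing.Theory Num.Theory.
Import numFieldNormedType.Exports.

Local Open Scope classical_set_scope.
Local Open Scope ring_scope.

(** Write [a] and [b] for the differences between the estimated and the oracle
    coefficients. SURE is quadratic in the coefficients and the classes are
    star-shaped, so that the first-order condition at the estimator, compared
    with the one of the risk at the oracle pair, yields the basic inequality
    ([basic_inequality]): the mean squared residual [avg ((a * Z - b) ^ 2)] is at
    most an average [W (a, b)] that is linear in the pair, in the noise and in
    its centered square. Moreover ([lower_isometry]) the residual controls the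
    norms of [a] and [b] up to another average of the same kind: variances of
    at least 2 separate [a] from [a * mu - b], and cutting [a * mu - b] at the
    size of the noise keeps all coefficients Lipschitz in the pair. Since [W]
    is linear and the residual quadratic along rays, it suffices to bound the
    two averages on a ball of radius [c * t] by [t ^ 2 / 2] ([localization]).

    The bound on the ball ([noise_event]) has to hold with high probability,
    with logarithmic factors only, and the supremum over an arbitrary class
    need not be measurable. Both points are settled by replacing the noise with
    random walks. The noise is truncated and rounded to finitely many values
    ([quantizer]). A centered law with exponential tails is dominated, for
    convex test functions, by a walk of [N] fair steps, [N] being of the order
    of [ln (n / delta)] ([walk_dominates], [cell_dominated]); the step length
    is constant for the centered square, but of order [1 / sqrt N] for the
    sub-Gaussian noise ([walk_reach_far], [walk_reach_near]), which is why the
    two complexities come with different powers of the logarithm. Convex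
    domination passes to product laws ([pexp_dominate]), and the exponential
    moment of the maximum for the walks is at most the [N]-th power of the one
    for a single family of signs. The latter is controlled by the Rademacher
    average itself ([smax_exp_moment], from the Efron-Stein inequality applied
    to [expR (s * smax / 2)]). Markov's inequality then bounds the failure
    probability by [expR (- N)] ([finite_tail], [noise_tail]).

    The contraction principle ([cexp_contraction]) reduces the Rademacher
    averages of the four processes involved to those of the two centered
    classes, and these are at most a constant times the local Gaussian
    complexities ([gauss_complexity_rademacher]). The definition of the
    critical radius finally makes the total at most [t ^ 2 / 2]
    ([noise_level_le], [t_star_spec]); if the radius is 0, both classes vanish
    on the sample ([vanishing_class]). The second conclusion is the triangle
    inequality ([avg_minkowski]). *)

(** * Finite product laws *)

Lemma le_of_eq (R : realType) (x y : R) : x = y -> x <= y.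
Proof. by move=> ->. Qed.

Definition updf (I : finType) (A : Type) (k : {ffun I -> A}) (i : I) (a : A) :
  {ffun I -> A} := [ffun j => if j == i then a else k j].

Definition upd (I : eqType) (A : Type) (x : I -> A) (i : I) (a : A) : I -> A :=
  fun j => if j == i then a else x j.

(** Expectation of [F] when the coordinates are independent, the [i]-th one with
    law [p i]. *)
Definition pexp (R : realType) (I A : finType) (p : I -> A -> R)
    (F : {ffun I -> A} -> R) : R :=
  \sum_(k : {ffun I -> A}) (\prod_i p i (k i)) * F k.

Definition fin_law (R : realType) (A : finType) (p : A -> R) : Prop :=
  (forall a, 0 <= p a) /\ \sum_a p a = 1.

Lemma pexp_cst (R : realType) (I A : finType) (p : I -> A -> R) (c : R) :
  (forall i, fin_law (p i)) -> pexp p (fun=> c) = c.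
Proof.
move=> lp; rewrite /pexp -big_distrl /= -(bigA_distr_bigA p).
by rewrite big1 ?mul1r// => i _; have [_ ->] := lp i.
Qed.

Lemma ler_pexp (R : realType) (I A : finType) (p : I -> A -> R)
    (F G : {ffun I -> A} -> R) :
  (forall i, fin_law (p i)) -> (forall k, F k <= G k) -> pexp p F <= pexp p G.
Proof.
move=> lp FG; apply: ler_sum => k _; apply: ler_wpM2l => //.
by apply: prodr_ge0 => i _; have [+ _] := lp i; exact.
Qed.

Lemma pexpD (R : realType) (I A : finType) (p : I -> A -> R)
    (F G : {ffun I -> A} -> R) :
  pexp p (fun k => F k + G k) = pexp p F + pexp p G.
Proof.
by rewrite /pexp -big_split /=; apply: eq_bigr => k _; rewrite mulrDr.
Qed.

Lemma pexpZ (R : realType) (I A : finType) (p : I -> A -> R) (c : R)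
    (F : {ffun I -> A} -> R) :
  pexp p (fun k => c * F k) = c * pexp p F.
Proof. by rewrite /pexp big_distrr /=; apply: eq_bigr => k _; rewrite mulrCA. Qed.

Lemma pexp_sum (R : realType) (I A J : finType) (p : I -> A -> R)
    (F : J -> {ffun I -> A} -> R) :
  pexp p (fun k => \sum_j F j k) = \sum_j pexp p (F j).
Proof.
rewrite /pexp exchange_big /=; apply: eq_bigr => k _.
by rewrite big_distrr.
Qed.

Lemma eq_pexp (R : realType) (I A : finType) (p : I -> A -> R)
    (F G : {ffun I -> A} -> R) : F =1 G -> pexp p F = pexp p G.
Proof. by move=> FG; apply: eq_bigr => k _; rewrite FG. Qed.

(** Exchanging the coordinate [k i] with an independent copy [a] is a
    weight-preserving involution of the pairs [(k, a)]. *)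
Lemma pexp_resample (R : realType) (I A : finType) (p : I -> A -> R) (i : I)
    (F : {ffun I -> A} -> R) :
  (forall i, fin_law (p i)) ->
  pexp p F = pexp p (fun k => \sum_a p i a * F (updf k i a)).
Proof.
move=> lp; have [_ pi1] := lp i.
pose w (k : {ffun I -> A}) : R := \prod_j p j (k j).
have -> : pexp p F = \sum_(u : {ffun I -> A} * A) w u.1 * p i u.2 * F u.1.
  rewrite -(pair_bigA _ (fun k a => w k * p i a * F k)) /=.
  apply: eq_bigr => k _; rewrite -big_distrl -big_distrr /= pi1 mulr1//.
pose h (u : {ffun I -> A} * A) := (updf u.1 i u.2, u.1 i).
have hK : involutive h.
  move=> [k a]; rewrite /h /=; congr pair; last by rewrite ffunE eqxx.
  by apply/ffunP => j; rewrite !ffunE; case: eqP => // ->.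
have hw u : w (h u).1 * p i (h u).2 = w u.1 * p i u.2.
  rewrite /w [in LHS](bigD1 i)//= [in RHS](bigD1 i)//= ffunE eqxx.
  rewrite (eq_bigr (fun j => p j (u.1 j))); first by ring.
  by move=> j /negbTE ji; rewrite ffunE ji.
rewrite (reindex_inj (inv_inj hK)) /=.
rewrite (eq_bigr (fun u : {ffun I -> A} * A =>
   w u.1 * p i u.2 * F (updf u.1 i u.2))); last first.
  by move=> u _; rewrite -hw.
rewrite -(pair_bigA _ (fun k a => w k * p i a * F (updf k i a))) /=.
by apply: eq_bigr => k _; rewrite big_distrr /=; apply: eq_bigr => a _;
  rewrite mulrA.
Qed.

Lemma pexp_pair (R : realType) (I A B : finType) (p : I -> A -> R)
    (q : I -> B -> R) (F : {ffun I -> A} -> {ffun I -> B} -> R) :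
  pexp (fun i (u : A * B) => p i u.1 * q i u.2)
    (fun k => F [ffun i => (k i).1] [ffun i => (k i).2]) =
  pexp p (fun k1 => pexp q (F k1)).
Proof.
pose h (u : {ffun I -> A} * {ffun I -> B}) : {ffun I -> A * B} :=
  [ffun i => (u.1 i, u.2 i)].
pose h' (k : {ffun I -> A * B}) := ([ffun i => (k i).1], [ffun i => (k i).2]).
have hK : cancel h h'.
  by move=> [k1 k2]; congr pair; apply/ffunP => i; rewrite !ffunE.
have hK' : cancel h' h.
  by move=> k; apply/ffunP => i; rewrite !ffunE; case: (k i).
rewrite /pexp (reindex h) /=; last by exists h' => u _; [exact: hK|exact: hK'].
rewrite -(pair_bigA _ (fun k1 k2 => (\prod_i (p i ((h (k1,k2) i).1) *
   q i ((h (k1,k2) i).2))) * F [ffun i => (h (k1,k2) i).1]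
    [ffun i => (h (k1,k2) i).2])) /=.
apply: eq_bigr => k1 _; rewrite big_distrr /=; apply: eq_bigr => k2 _.
rewrite mulrA -big_split /=; congr (_ * _).
  by apply: eq_bigr => i _; rewrite ffunE.
by congr F; apply/ffunP => i; rewrite !ffunE.
Qed.

(** * Random walks and convex test functions *)

Definition convexf (R : realType) (f : R -> R) : Prop :=
  forall x y t : R, 0 <= t <= 1 -> f (t * x + (1 - t) * y) <= t * f x + (1 - t) * f y.

Definition step (R : realType) (V : zmodType) (s : V) (f : V -> R) : V -> R :=
  fun x => (f (x + s) + f (x - s)) / 2.

(** [walk l f x] is the expectation of [f] at the random walk started at [x]
    whose successive steps are the entries of [l] with fair random signs. *)
Definition walk (R : realType) (V : zmodType) (l : seq V) (f : V -> R) : V -> R :=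
  foldr (@step R V) f l.

Lemma convex_step (R : realType) (s : R) (f : R -> R) :
  convexf f -> convexf (step s f).
Proof.
move=> cf x y t t01; rewrite /step.
have -> : t * x + (1 - t) * y + s = t * (x + s) + (1 - t) * (y + s) by ring.
have -> : t * x + (1 - t) * y - s = t * (x - s) + (1 - t) * (y - s) by ring.
have := cf (x + s) (y + s) t t01; have := cf (x - s) (y - s) t t01; lra.
Qed.

Lemma convex_walk (R : realType) (l : seq R) (f : R -> R) :
  convexf f -> convexf (walk l f).
Proof. by move=> cf; elim: l => //= s l; exact: convex_step. Qed.

Lemma step_ge (R : realType) (s : R) (f : R -> R) x :
  convexf f -> f x <= step s f x.
Proof.
move=> cf; have h : 0 <= (2^-1 : R) <= 1 by apply/andP; split; lra.
have := cf (x + s) (x - s) _ h.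
have -> : 2^-1 * (x + s) + (1 - 2^-1) * (x - s) = x by field.
by rewrite /step; lra.
Qed.

Lemma walk_ge (R : realType) (l : seq R) (f : R -> R) x :
  convexf f -> f x <= walk l f x.
Proof.
move=> cf; elim: l x => //= s l IH x.
by apply: le_trans (IH x) _; apply: step_ge; exact: convex_walk.
Qed.

Lemma walk_cat (R : realType) (l1 l2 : seq R) (f : R -> R) :
  walk (l1 ++ l2) f = walk l1 (walk l2 f).
Proof. exact: foldr_cat. Qed.

Lemma ler_walk (R : realType) (l : seq R) (f g : R -> R) x :
  (forall y, f y <= g y) -> walk l f x <= walk l g x.
Proof.
move=> fg; elim: l x => //= s l IH x; rewrite /step.
have := IH (x + s); have := IH (x - s); lra.
Qed.

Lemma walk_ge0 (R : realType) (l : seq R) (f : R -> R) x :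
  (forall y, 0 <= f y) -> 0 <= walk l f x.
Proof.
move=> f0; elim: l x => //= s l IH x.
by rewrite /step divr_ge0// addr_ge0.
Qed.

Lemma walkD (R : realType) (l : seq R) (f g : R -> R) x :
  walk l (fun y => f y + g y) x = walk l f x + walk l g x.
Proof. by elim: l x => //= s l IH x; rewrite /step !IH; field. Qed.

Lemma walkZ (R : realType) (l : seq R) (c : R) (f : R -> R) x :
  walk l (fun y => c * f y) x = c * walk l f x.
Proof. by elim: l x => //= s l IH x; rewrite /step !IH; field. Qed.

Lemma walk_cst (R : realType) (l : seq R) (c : R) x :
  walk l (fun=> c) x = c.
Proof. by elim: l x => //= s l IH x; rewrite /step !IH; field. Qed.

Lemma walk_shift (R : realType) (l : seq R) (f : R -> R) x y :
  walk l (fun z => f (x + z)) y = walk l f (x + y).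
Proof. by elim: l y => //= s l IH y; rewrite /step !IH !addrA. Qed.

Lemma walkN (R : realType) (l : seq R) (f : R -> R) x :
  walk l (fun y => f (- y)) x = walk l f (- x).
Proof.
elim: l x => //= s l IH x; rewrite /step !IH.
have -> : - (x + s) = - x - s by ring.
have -> : - (x - s) = - x + s by ring.
by rewrite addrC.
Qed.

Lemma walk_sqr (R : realType) (l : seq R) (x : R) :
  walk l (fun y => y ^+ 2) x = x ^+ 2 + \sum_(s <- l) s ^+ 2.
Proof.
elim: l x => [|s l IH] x /=; first by rewrite big_nil addr0.
by rewrite /step !IH big_cons; field.
Qed.

Lemma walk_quart (R : realType) (l : seq R) (x : R) :
  walk l (fun y => y ^+ 4) x <=
  x ^+ 4 + 6 * x ^+ 2 * (\sum_(s <- l) s ^+ 2) + 3 * (\sum_(s <- l) s ^+ 2) ^+ 2.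
Proof.
elim: l x => [|s l IH] x /=; first by rewrite big_nil expr0n /= !mulr0 !addr0.
rewrite /step big_cons; set S := \sum_(_ <- _) _ in IH *.
have s4 : 0 <= s ^+ 4 by rewrite -[4%N]/(2 * 2)%N exprM sqr_ge0.
have := IH (x + s); have := IH (x - s).
set u := walk _ _ _; set v := walk _ _ _.
rewrite -subr_ge0 => hu; rewrite -subr_ge0 => hv; rewrite -subr_ge0.
have -> : x ^+ 4 + 6 * x ^+ 2 * (s ^+ 2 + S) + 3 * (s ^+ 2 + S) ^+ 2 - (v + u) / 2
 = ((x + s) ^+ 4 + 6 * (x + s) ^+ 2 * S + 3 * S ^+ 2 - v) / 2 +
   ((x - s) ^+ 4 + 6 * (x - s) ^+ 2 * S + 3 * S ^+ 2 - u) / 2 + 2 * s ^+ 4.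
  by field.
by lra.
Qed.

(** Khintchine: the second and fourth moments of the walk bound its first
    moment from below, since y >= y^2 - y^4 / 4 for y >= 0. *)
Lemma walk_abs (R : realType) (l : seq R) (q : R) :
  0 <= q -> \sum_(s <- l) s ^+ 2 = q ^+ 2 ->
  q / 4 <= walk l (fun y => `|y|) 0.
Proof.
rewrite le_eqVlt => /predU1P[<- _|q0 hq].
  by rewrite mul0r; apply: walk_ge0.
have pw y : q^-1 * y ^+ 2 + (- (4 * q ^+ 3)^-1) * y ^+ 4 <= `|y|.
  pose z := `|y| / q.
  have z0 : 0 <= z by rewrite divr_ge0// ltW.
  have yz : `|y| = q * z by rewrite /z; field; rewrite gt_eqF.
  have y2 : y ^+ 2 = q ^+ 2 * z ^+ 2 by rewrite -exprMn -yz real_normK ?num_real.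
  have y4 : y ^+ 4 = q ^+ 4 * z ^+ 4.
    by rewrite -[4%N]/(2 * 2)%N !exprM y2 exprMn.
  rewrite y2 y4 yz.
  have -> : q^-1 * (q ^+ 2 * z ^+ 2) + - (4 * q ^+ 3)^-1 * (q ^+ 4 * z ^+ 4) =
     q * (z ^+ 2 - z ^+ 4 / 4) by field; rewrite gt_eqF.
  rewrite ler_pM2l//.
  have h : 0 <= (z - 6 / 5) ^+ 2 * (z + 12 / 5).
    by rewrite mulr_ge0 ?sqr_ge0// addr_ge0// divr_ge0.
  have h2 : 0 <= 1 - z + z ^+ 3 / 4.
    have e : (z - 6 / 5) ^+ 2 * (z + 12 / 5) = z ^+ 3 - 432/100 * z + 3456/1000.
      by field.
    lra.
  by have := mulr_ge0 z0 h2; rewrite -subr_ge0; congr (0 <= _); field.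
apply: le_trans (ler_walk l 0 pw); rewrite walkD !walkZ walk_sqr hq.
have := walk_quart l 0; rewrite hq !expr0n /= !mulr0 !mul0r !add0r => h4.
have -> : q / 4 = q^-1 * q ^+ 2 + - (4 * q ^+ 3)^-1 * (3 * (q ^+ 2) ^+ 2).
  by field; rewrite gt_eqF.
rewrite lerD2l ler_wnM2l// oppr_le0 invr_ge0 mulr_ge0// exprn_ge0// ltW//.
Qed.

Definition even_convex (R : realType) (G : R -> R) : Prop :=
  [/\ convexf G, G 0 = 0 & forall x, G (- x) = G x].

(** Symmetrization of [f], normalized at 0: a symmetric walk started at 0 sees
    no more than this of [f]. *)
Definition evenpart (R : realType) (f : R -> R) : R -> R :=
  fun x => (f x + f (- x)) / 2 - f 0.

Lemma evenpart_even_convex (R : realType) (f : R -> R) :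
  convexf f -> even_convex (evenpart f).
Proof.
move=> cf; rewrite /evenpart; split => [x y t t01||x]; last first.
- by rewrite opprK [f (- x) + _]addrC.
- by rewrite oppr0; field.
have -> : - (t * x + (1 - t) * y) = t * - x + (1 - t) * - y by ring.
have := cf x y t t01; have := cf (- x) (- y) t t01; lra.
Qed.

Lemma walk_evenpart (R : realType) (l : seq R) (f : R -> R) :
  walk l (evenpart f) 0 = walk l f 0 - f 0.
Proof.
have -> : evenpart f = fun x => (2^-1 * f x + 2^-1 * f (- x)) + (- f 0).
  by apply/funext => x; rewrite /evenpart; field.
rewrite (walkD l (fun x => 2^-1 * f x + 2^-1 * f (- x))) walk_cst walkD !walkZ.
by rewrite (walkN l f) oppr0; field.
Qed.

(** Convexity on the segment from 0 to [k * x]. *)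
Lemma even_convex_scale (R : realType) (G : R -> R) (k x : R) :
  even_convex G -> 1 <= k -> k * G x <= G (k * x).
Proof.
move=> [cG G0 _] k1; have k0 : 0 < k by lra.
have h : 0 <= k^-1 <= 1 by rewrite invr_ge0 ltW//= invf_le1.
have := cG (k * x) 0 _ h; rewrite G0 !mulr0 !addr0 mulKf ?gt_eqF// => H.
by rewrite -ler_pdivlMl.
Qed.

Lemma even_convex_le (R : realType) (G : R -> R) (x y : R) :
  even_convex G -> `|x| <= `|y| -> G x <= G y.
Proof.
move=> [cG G0 eG] xy.
have [y0|y0] := eqVneq y 0.
  by move: xy; rewrite y0 normr0 normr_le0 => /eqP ->.
have xy1 : `|x / y| <= 1 by rewrite normf_div ler_pdivrMr ?normr_gt0// mul1r.
pose t := (x / y + 1) / 2.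
have t01 : 0 <= t <= 1 by move: xy1; rewrite ler_norml /t => /andP[? ?]; apply/andP; split; lra.
have := cG y (- y) t t01; rewrite eG.
have -> : t * y + (1 - t) * - y = x by rewrite /t; field.
lra.
Qed.

Lemma even_convex_ge0 (R : realType) (G : R -> R) x : even_convex G -> 0 <= G x.
Proof.
by move=> cG; have [_ <- _] := cG; apply: even_convex_le => //; rewrite normr0.
Qed.

(** All [r] steps go upwards with probability [2 ^- r]. *)
Lemma walk_nseq_top (R : realType) (G : R -> R) (r : nat) (s x : R) :
  (forall y, 0 <= G y) -> G (x + r%:R * s) <= 2 ^+ r * walk (nseq r s) G x.
Proof.
move=> G0; elim: r x => [|r IH] x /=; first by rewrite mul0r addr0 expr0 mul1r.
rewrite /step exprS; have := IH (x + s).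
have -> : x + s + r%:R * s = x + r.+1%:R * s by rewrite -natr1; ring.
move=> /le_trans -> //; set w1 := walk _ _ (x + s); set w2 := walk _ _ (x - s).
have : 0 <= 2 ^+ r * w2.
  by rewrite mulr_ge0 ?exprn_ge0// walk_ge0.
by have -> : 2 * 2 ^+ r * ((w1 + w2) / 2) = 2 ^+ r * w1 + 2 ^+ r * w2; [field|lra].
Qed.

Lemma walk_nseq_extreme (R : realType) (G : R -> R) (r : nat) (s : R) :
  even_convex G -> G (r%:R * s) <= 2 ^+ r * walk (nseq r s) G 0.
Proof.
move=> cG; rewrite -{1}[_ * s]add0r.
by apply: walk_nseq_top => y; exact: even_convex_ge0.
Qed.

Lemma walk_nseq_le (R : realType) (f : R -> R) (r N : nat) (s x : R) :
  convexf f -> (r <= N)%N -> walk (nseq r s) f x <= walk (nseq N s) f x.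
Proof.
move=> cf rN; have -> : nseq N s = nseq (N - r) s ++ nseq r s.
  by rewrite -nseqD subnK.
by rewrite walk_cat; apply: walk_ge; exact: convex_walk.
Qed.

(** A block of [m] steps dominates one step of length comparable to
    [sqrt m * s]: by symmetry only the first absolute moment of the block
    matters, and [walk_abs] bounds it. *)
Lemma walk_block (R : realType) (f : R -> R) (m : nat) (s x : R) :
  convexf f -> 0 <= s ->
  step (Num.sqrt m%:R * s / 8) f x <= walk (nseq m s) f x.
Proof.
move=> cf s0.
pose g y := f (x + y).
have cg : convexf g.
  move=> y z t t01; rewrite /g.
  have -> : x + (t * y + (1 - t) * z) = t * (x + y) + (1 - t) * (x + z) by ring.
  exact: cf.
have cG := evenpart_even_convex cg.
have -> : walk (nseq m s) f x = g 0 + walk (nseq m s) (evenpart g) 0.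
  by rewrite walk_evenpart addrC subrK /g walk_shift addr0.
set b := Num.sqrt m%:R * s / 8.
have -> : step b f x = g 0 + evenpart g b by rewrite /evenpart /g /step; field.
rewrite lerD2l.
have b0 : 0 <= b by rewrite /b !mulr_ge0// sqrtr_ge0.
move: b0; rewrite le_eqVlt => /predU1P[<-|b0].
  have [_ -> _] := cG.
  by apply: walk_ge0 => y; exact: even_convex_ge0.
have pw y : (evenpart g b / b) * `|y| + - evenpart g b <= evenpart g y.
  have [yb|yb] := leP `|y| b.
    apply: (@le_trans _ _ 0); last exact: even_convex_ge0.
    have : (evenpart g b / b) * `|y| <= (evenpart g b / b) * b.
      by rewrite ler_wpM2l// divr_ge0 ?(ltW b0)// even_convex_ge0.
    by rewrite divfK ?gt_eqF//; lra.
  have k1 : 1 <= `|y| / b by rewrite ler_pdivlMr// mul1r ltW.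
  have := even_convex_scale b cG k1; rewrite divfK ?gt_eqF//.
  have -> : evenpart g `|y| = evenpart g y.
    by have [_ _ e] := cG; case: (ger0P y) => // _; rewrite e.
  have := even_convex_ge0 b cG.
  have -> : `|y| / b * evenpart g b = evenpart g b / b * `|y| by ring.
  lra.
apply: le_trans (ler_walk (nseq m s) 0 pw).
rewrite walkD walkZ walk_cst.
have ha : 2 * b <= walk (nseq m s) (fun y => `|y|) 0.
  have -> : 2 * b = (Num.sqrt m%:R * s) / 4 by rewrite /b; field.
  apply: walk_abs; first by rewrite mulr_ge0 ?sqrtr_ge0.
  by rewrite exprMn sqr_sqrtr// big_nseq iter_addr_0 mulr_natl.
have : (evenpart g b / b) * (2 * b) <= (evenpart g b / b) * walk (nseq m s) (fun y => `|y|) 0.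
  by rewrite ler_wpM2l// divr_ge0 ?(ltW b0)// even_convex_ge0.
have -> : evenpart g b / b * (2 * b) = 2 * evenpart g b by field; rewrite gt_eqF.
lra.
Qed.

Lemma walk_blocks (R : realType) (f : R -> R) (r m : nat) (s x : R) :
  convexf f -> 0 <= s ->
  walk (nseq r (Num.sqrt m%:R * s / 8)) f x <= walk (nseq (r * m) s) f x.
Proof.
move=> cf s0; elim: r x => [|r IH] x //.
rewrite mulSn nseqD walk_cat; apply: le_trans (walk_block _ _ _ _) => //=; last exact: convex_walk.
rewrite /step; set t := _ / 8; have := IH (x + t); have := IH (x - t); lra.
Qed.

Lemma jensen_seq (R : realType) (A : eqType) (s : seq A) (p x : A -> R)
    (f : R -> R) :
  convexf f -> (forall a, 0 <= p a) -> 0 < \sum_(a <- s) p a ->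
  (\sum_(a <- s) p a) * f ((\sum_(a <- s) p a * x a) / \sum_(a <- s) p a) <=
  \sum_(a <- s) p a * f (x a).
Proof.
move=> cf p0; elim: s => [|a s IH]; first by rewrite big_nil ltxx.
rewrite !big_cons; set P := \sum_(b <- s) p b; set X := \sum_(b <- s) p b * x b.
have : 0 <= P by apply: sumr_ge0.
rewrite le_eqVlt => /predU1P[P0|P0].
  have z : all (fun b => p b == 0) s.
    move/eqP: P0; rewrite eq_sym psumr_eq0//.
  have zs (g : A -> R) : \sum_(b <- s) p b * g b = 0.
    rewrite big_seq big1// => b bs; have /allP/(_ b bs)/eqP -> := z.
    by rewrite mul0r.
  rewrite -P0 /X !zs !addr0 => pa.
  by have -> : p a * x a / p a = x a by rewrite mulrAC mulfV ?mul1r// gt_eqF.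
move=> _; have := IH P0; rewrite -/P -/X => {}IH.
have aP : 0 < p a + P by have := p0 a; lra.
pose t := p a / (p a + P).
have t01 : 0 <= t <= 1.
  by rewrite /t divr_ge0 ?(ltW aP)//= ler_pdivrMr// mul1r lerDl ltW.
have -> : (p a * x a + X) / (p a + P) = t * x a + (1 - t) * (X / P).
  by rewrite /t; field; rewrite !gt_eqF.
have := cf (x a) (X / P) t t01 => /(ler_wpM2l (ltW aP)).
have -> : (p a + P) * (t * f (x a) + (1 - t) * f (X / P)) =
   p a * f (x a) + P * f (X / P).
  by rewrite /t; field; rewrite gt_eqF.
lra.
Qed.

Lemma jensen (R : realType) (A : finType) (p x : A -> R) (f : R -> R) :
  convexf f -> fin_law p -> f (\sum_a p a * x a) <= \sum_a p a * f (x a).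
Proof.
move=> cf [p0 p1]; have := @jensen_seq _ _ (index_enum A) p x f cf p0.
by rewrite p1 ltr01 mul1r divr1; exact.
Qed.

(** After symmetrization only the even part [G] of the test function matters;
    the factor 6 leaves room for the convexity gain [3 * G y <= G (3 * y)],
    which pays for the bound 3 on the exponential moment. *)
Lemma walk_dominates (R : realType) (A : finType) (p v : A -> R) (r : A -> nat)
    (N : nat) (s : R) (f : R -> R) :
  fin_law p -> convexf f ->
  (forall G, even_convex G -> forall a,
     G (6 * v a) <= 2 ^+ r a * walk (nseq N s) G 0) ->
  \sum_a p a * 2 ^+ r a <= 3 ->
  \sum_a p a * f (v a - \sum_b p b * v b) <= walk (nseq N s) f 0.
Proof.
move=> lp cf hG mom; have [p0 p1] := lp.
set G := evenpart f; have cG : even_convex G by exact: evenpart_even_convex.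
set W := walk _ _ _; have -> : W = f 0 + walk (nseq N s) G 0.
  by rewrite walk_evenpart addrC subrK.
apply: (@le_trans _ _ (\sum_a \sum_b p a * p b * f (v a - v b))).
  apply: ler_sum => a _.
  have -> : v a - \sum_b p b * v b = \sum_b p b * (v a - v b).
    under [RHS]eq_bigr do rewrite mulrBr.
    by rewrite sumrB -mulr_suml p1 mul1r.
  have := jensen (fun b => v a - v b) cf lp => /(ler_wpM2l (p0 a)).
  move=> /le_trans; apply; rewrite mulr_sumr.
  by apply: ler_sum => b _; rewrite mulrA.
have E : \sum_a \sum_b p a * p b * f (v a - v b) =
    \sum_a \sum_b p a * p b * (f 0 + G (v a - v b)).
  have sw : \sum_a \sum_b p a * p b * f (v a - v b) =
    \sum_a \sum_b p a * p b * f (- (v a - v b)).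
    rewrite exchange_big; apply: eq_bigr => a _; apply: eq_bigr => b _.
    by rewrite opprB mulrC [p b * _]mulrC mulrC.
  have dbl : forall x y : R, x = y -> x = (x + y) / 2 by move=> x y ->; field.
  rewrite (dbl _ _ sw) -big_split mulr_suml; apply: eq_bigr => a _.
  rewrite -big_split mulr_suml.
  by apply: eq_bigr => b _; rewrite /G /evenpart /=; field.
rewrite {}E.
apply: (@le_trans _ _ (\sum_a \sum_b p a * p b * (f 0 + (G (2 * v a) + G (2 * v b)) / 2))).
  apply: ler_sum => a _; apply: ler_sum => b _; rewrite ler_wpM2l ?mulr_ge0//.
  rewrite lerD2l; have [cg _ eg] := cG.
  have h : 0 <= (2^-1 : R) <= 1 by apply/andP; split; lra.
  have := cg (2 * v a) (- (2 * v b)) _ h; rewrite eg.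
  have -> : 2^-1 * (2 * v a) + (1 - 2^-1) * - (2 * v b) = v a - v b by field.
  lra.
have -> : \sum_a \sum_b p a * p b * (f 0 + (G (2 * v a) + G (2 * v b)) / 2) =
   f 0 + \sum_a p a * G (2 * v a).
  transitivity (\sum_a (p a * (f 0 + G (2 * v a) / 2) + p a * (\sum_b p b * G (2 * v b)) / 2)).
    apply: eq_bigr => a _.
    transitivity (\sum_b (p a * (f 0 + G (2 * v a) / 2) * p b + (p a / 2) * (p b * G (2 * v b)))).
      by apply: eq_bigr => b _; field.
    by rewrite big_split /= -!mulr_sumr p1; field.
  rewrite big_split /= -!mulr_suml p1.
  under eq_bigr do rewrite mulrDr mulrA.
  by rewrite big_split /= -!mulr_suml p1; field.
rewrite lerD2l.
have w0 : 0 <= walk (nseq N s) G 0 by apply: walk_ge0 => y; exact: even_convex_ge0.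
apply: (@le_trans _ _ (\sum_a (p a * 2 ^+ r a) * (walk (nseq N s) G 0 / 3))).
  apply: ler_sum => a _; rewrite -mulrA ler_wpM2l//.
  have := even_convex_scale (2 * v a) cG (ler1n R 3).
  have -> : 3 * (2 * v a) = 6 * v a by ring.
  have := hG G cG a; lra.
rewrite -mulr_suml; have := ler_wpM2r w0 mom; lra.
Qed.

(** Reaching distance [r * s] costs [r] steps in the same direction. *)
Lemma walk_reach_far (R : realType) (G : R -> R) (r N : nat) (s y : R) :
  even_convex G -> 0 <= s -> (r <= N)%N -> `|y| <= r%:R * s ->
  G y <= 2 ^+ r * walk (nseq N s) G 0.
Proof.
move=> cG s0 rN ys; have [cg _ _] := cG.
have : G y <= G (r%:R * s).
  by apply: even_convex_le => //; rewrite [leRHS]ger0_norm// mulr_ge0.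
move=> /le_trans; apply; apply: le_trans (walk_nseq_extreme r s cG) _.
by rewrite ler_wpM2l ?exprn_ge0// walk_nseq_le.
Qed.

(** Grouping the [N] steps in [r] blocks of [N %/ r] steps, distance of order
    [sqrt (r * N) * s] only costs [r] blocks in the same direction. *)
Lemma walk_reach_near (R : realType) (G : R -> R) (r N : nat) (s y : R) :
  even_convex G -> 0 <= s -> (r <= N)%N ->
  128 * y ^+ 2 <= r%:R * N%:R * s ^+ 2 ->
  G y <= 2 ^+ r * walk (nseq N s) G 0.
Proof.
move=> cG s0 rN ys; have [cg G0 _] := cG.
have W0 : 0 <= walk (nseq N s) G 0.
  by apply: walk_ge0 => z; exact: even_convex_ge0.
case: r rN ys => [_|r rN ys].
  rewrite !mul0r => y2; have -> : y = 0.
    by apply/eqP; rewrite -sqrf_eq0 eq_le sqr_ge0 andbT; lra.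
  by rewrite G0 mulr_ge0.
set m := (N %/ r.+1)%N.
have m0 : (0 < m)%N by rewrite divn_gt0.
have mN : (r.+1 * m <= N)%N by rewrite mulnC leq_trunc_div.
have Nm : N%:R <= 2 * r.+1%:R * m%:R :> R.
  rewrite -!natrM ler_nat -mulnA [(r.+1 * m)%N]mulnC.
  have := ltn_ceil N (ltn0Sn r); rewrite -/m mulSn.
  have : (r.+1 <= m * r.+1)%N by rewrite leq_pmull.
  by lia.
set t := Num.sqrt m%:R * s / 8.
have t0 : 0 <= t by rewrite /t !mulr_ge0// sqrtr_ge0.
have : G y <= G (r.+1%:R * t).
  apply: even_convex_le => //; rewrite [leRHS]ger0_norm ?mulr_ge0//.
  rewrite -(@ler_pXn2r _ 2)// ?nnegrE ?normr_ge0 ?mulr_ge0//.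
  rewrite real_normK ?num_real// /t !exprMn sqr_sqrtr//.
  have h : 0 <= r.+1%:R * s ^+ 2 by rewrite mulr_ge0 ?sqr_ge0.
  have := ler_wpM2l h Nm; rewrite exprVn.
  have -> : r.+1%:R ^+ 2 * (m%:R * s ^+ 2 / 8 ^+ 2) =
    (r.+1%:R * s ^+ 2 * (2 * r.+1%:R * m%:R)) / 128 by field.
  lra.
move=> /le_trans; apply; apply: le_trans (walk_nseq_extreme _ _ cG) _.
rewrite ler_wpM2l ?exprn_ge0//; apply: le_trans (walk_blocks _ _ _ cg s0) _.
exact: walk_nseq_le.
Qed.

(** * Domination of product laws by walks *)

(** Hybrid argument: the coordinates are replaced one at a time, and each
    replacement is a one-dimensional comparison because [F] is convex in that
    coordinate. *)
Lemma pexp_dominate (R : realType) (I A B : finType) (p : I -> A -> R)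
    (q : I -> B -> R) (f : I -> A -> R) (h : I -> B -> R)
    (F : (I -> R) -> R) :
  (forall i, fin_law (p i)) -> (forall i, fin_law (q i)) ->
  (forall i g, convexf g ->
     \sum_a p i a * g (f i a) <= \sum_b q i b * g (h i b)) ->
  (forall x i, convexf (fun a => F (upd x i a))) ->
  pexp p (fun k => F (fun i => f i (k i))) <=
  pexp q (fun k => F (fun i => h i (k i))).
Proof.
move=> lp lq dom cF.
pose x (l : seq I) (k1 : {ffun I -> A}) (k2 : {ffun I -> B}) : I -> R :=
  fun i => if i \in l then h i (k2 i) else f i (k1 i).
pose H l := pexp p (fun k1 => pexp q (fun k2 => F (x l k1 k2))).
have -> : pexp p (fun k => F (fun i => f i (k i))) = H [::].
  by apply: eq_pexp => k1; rewrite -[LHS](pexp_cst _ lq).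
have -> : pexp q (fun k => F (fun i => h i (k i))) = H (enum I).
  rewrite -[LHS](pexp_cst _ lp); apply: eq_pexp => k1; apply: eq_pexp => k2.
  by congr F; apply/funext => i; rewrite /x mem_enum.
elim: (enum I) => // i l IH; apply: le_trans IH _.
have [il|il] := boolP (i \in l).
  apply: ler_pexp => // k1; apply: ler_pexp => // k2.
  have -> // : x l k1 k2 = x (i :: l) k1 k2.
  by apply/funext => j; rewrite /x inE; case: eqVneq => // ->; rewrite il.
have -> : H l = pexp p (fun k1 => pexp q (fun k2 =>
    \sum_a p i a * F (upd (x l k1 k2) i (f i a)))).
  rewrite /H (pexp_resample i)//; apply: eq_pexp => k1.
  rewrite pexp_sum; apply: eq_bigr => a _; rewrite pexpZ; congr (_ * _).
  apply: eq_pexp => k2; congr F; apply/funext => j.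
  by rewrite /x /upd ffunE; case: eqVneq => [->|//]; rewrite (negbTE il).
have -> : H (i :: l) = pexp p (fun k1 => pexp q (fun k2 =>
    \sum_b q i b * F (upd (x l k1 k2) i (h i b)))).
  apply: eq_pexp => k1; rewrite (pexp_resample i)//; apply: eq_pexp => k2.
  apply: eq_bigr => b _; congr (_ * F _); apply/funext => j.
  by rewrite /x /upd inE ffunE; case: eqVneq => [->|//].
apply: ler_pexp => // k1; apply: ler_pexp => // k2; exact: (dom i _ (cF _ i)).
Qed.

(** Sign sequences as nested pairs: splitting off the first step is then a
    product decomposition of the type, which lets the steps of several
    coordinates be regrouped by time. *)
Fixpoint wtype (N : nat) : finType :=
  if N is N'.+1 then (bool * wtype N')%type : finType else unit : finType.

Definition sgn (R : realType) (b : bool) : R := if b then 1 else -1.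
Arguments sgn R b : clear implicits.

Fixpoint wval (R : realType) (s : R) (N : nat) : wtype N -> R :=
  match N with
  | 0 => fun=> 0
  | N'.+1 => fun u => s * sgn R u.1 + wval s u.2
  end.

Definition wlaw (R : realType) (N : nat) (u : wtype N) : R := 2 ^- N.
Arguments wlaw R N u : clear implicits.

Lemma wlawS (R : realType) (N : nat) (u : wtype N.+1) :
  wlaw R N.+1 u = 2^-1 * wlaw R N u.2.
Proof. by rewrite /wlaw exprS invfM. Qed.

Lemma walk_wlaw (R : realType) (N : nat) (s : R) (f : R -> R) x :
  \sum_u wlaw R N u * f (x + wval s u) = walk (nseq N s) f x.
Proof.
elim: N x => [|N IH] x /=.
  rewrite (big_pred1 tt); last by case.
  by rewrite /wlaw expr0 invr1 mul1r addr0.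
rewrite /step -!IH.
rewrite -(pair_bigA _ (fun b u => wlaw R N.+1 (b, u) * f (x + (s * sgn R b + wval s u)))) /=.
rewrite big_bool /= !mulr1 mulrN1 mulrDl !mulr_suml.
by congr (_ + _); apply: eq_bigr => u _; rewrite wlawS addrA; field.
Qed.

Lemma wlaw_fin_law (R : realType) (N : nat) : fin_law (wlaw R N).
Proof.
split=> [u|]; first by rewrite invr_ge0 exprn_ge0.
by have := walk_wlaw N (0 : R) (fun=> 1) 0; rewrite walk_cst => <-;
  apply: eq_bigr => u _; rewrite mulr1.
Qed.

(** [cexp F] is the expectation of [F] under independent fair signs. *)
Definition cexp (R : realType) (I : finType) (F : {ffun I -> bool} -> R) : R :=
  pexp (fun _ _ => 2^-1) F.

Lemma fair_law (R : realType) : fin_law (fun _ : bool => 2^-1 : R).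
Proof. by split=> [b|]; rewrite ?big_bool //=; field. Qed.

(** All coordinates take their first step simultaneously: the joint first step
    is one family of signs, independent of the remaining ones, and
    submultiplicativity of [F] factors it out. *)
Lemma pexp_walk_le (R : realType) (I : finType) (N : nat) (s : R)
    (F : (I -> R) -> R) :
  (forall x, 0 <= F x) -> F (fun=> 0) = 1 ->
  (forall x y, F (fun i => x i + y i) <= F x * F y) ->
  pexp (fun _ : I => wlaw R N) (fun k => F (fun i => wval s (k i))) <=
  (cexp (fun e : {ffun I -> bool} => F (fun i => s * sgn R (e i)))) ^+ N.
Proof.
move=> F0 F1 FM; elim: N => [|N IH].
  rewrite expr0 -[leRHS]F1.
  by rewrite -[leRHS](@pexp_cst _ I _ _ _ (fun=> wlaw_fin_law R 0)).
have -> : pexp (fun _ : I => wlaw R N.+1) (fun k => F (fun i => wval s (k i))) =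
  cexp (fun e : {ffun I -> bool} => pexp (fun _ : I => wlaw R N)
    (fun k => F (fun i => s * sgn R (e i) + wval s (k i)))).
  rewrite /cexp -pexp_pair; apply: eq_bigr => k _; congr (_ * _).
    by apply: eq_bigr => i _; rewrite wlawS.
  by congr F; apply/funext => i; rewrite !ffunE.
rewrite exprSr; apply: le_trans (_ : cexp (fun e : {ffun I -> bool} => 
   pexp (fun _ : I => wlaw R N) (fun k => F (fun i => wval s (k i))) *
   F (fun i => s * sgn R (e i))) <= _).
  apply: ler_pexp => [i|e]; first exact: fair_law.
  rewrite mulrC -pexpZ; apply: ler_pexp => [i|k]; first exact: wlaw_fin_law.
  exact: FM.
rewrite /cexp pexpZ; apply: ler_wpM2r => //.
rewrite -(@pexp_cst R I _ _ 0 (fun=> fair_law R)); apply: ler_pexp => //.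
by move=> i; exact: fair_law.
Qed.

(** * Maxima of finitely many linear forms *)

Definition dotp (R : realType) (I : finType) (g x : I -> R) : R :=
  \sum_i g i * x i.

(** The base value 0 stands for the zero form and settles the case of an empty
    family. *)
Definition smax (R : realType) (I T : finType) (g : T -> I -> R) (x : I -> R) : R :=
  \big[Num.max/0]_(t : T) dotp (g t) x.

Lemma dotpD (R : realType) (I : finType) (g x y : I -> R) :
  dotp g (fun i => x i + y i) = dotp g x + dotp g y.
Proof. by rewrite /dotp -big_split; apply: eq_bigr => i _; rewrite mulrDr. Qed.

Lemma dotpZ (R : realType) (I : finType) (g x : I -> R) c :
  dotp g (fun i => c * x i) = c * dotp g x.
Proof. by rewrite /dotp mulr_sumr; apply: eq_bigr => i _; rewrite mulrCA. Qed.

Section LinearForms.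
Context (R : realType) (I T : finType) (g : T -> I -> R).

Lemma smax_ge0 x :
  0 <= smax g x.
Proof. by rewrite /smax; elim/big_rec: _ => // t y _; rewrite le_max orbC => ->. Qed.

Lemma smax_ub x t :
  dotp (g t) x <= smax g x.
Proof. by rewrite /smax (bigD1 t)//= le_max lexx. Qed.

Lemma smax_le x c :
  0 <= c -> (forall t, dotp (g t) x <= c) -> smax g x <= c.
Proof.
by move=> c0 gc; rewrite /smax; elim/big_rec: _ => // t y _ yc; rewrite ge_max gc.
Qed.

Lemma smax_attained x :
  smax g x = 0 \/ exists t, smax g x = dotp (g t) x.
Proof.
rewrite /smax; elim/big_rec: _ => [|t y _ IH]; first by left.
by rewrite /Num.max; case: ifP => _; [exact: IH|right; exists t].
Qed.

Lemma smaxD (x y : I -> R) :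
  smax g (fun i => x i + y i) <= smax g x + smax g y.
Proof.
apply: smax_le => [|t]; first by rewrite addr_ge0 ?smax_ge0.
by rewrite dotpD lerD ?smax_ub.
Qed.

Lemma smaxZ (x : I -> R) (c : R) :
  0 <= c -> smax g (fun i => c * x i) = c * smax g x.
Proof.
move=> c0; apply/eqP; rewrite eq_le; apply/andP; split.
  apply: smax_le => [|t]; first by rewrite mulr_ge0 ?smax_ge0.
  by rewrite dotpZ ler_wpM2l ?smax_ub.
case: (smax_attained x) => [->|[t ->]]; first by rewrite mulr0 smax_ge0.
by rewrite -dotpZ smax_ub.
Qed.

Lemma smax0 : smax g (fun=> 0) = 0.
Proof.
have e : smax g (fun i => 0 * (fun=> 0) i) = 0 by rewrite smaxZ// mul0r.
rewrite -[RHS]e; congr smax; apply/funext => i; rewrite mul0r//.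
Qed.

End LinearForms.

Lemma expR_convex (R : realType) : convexf (@expR R).
Proof.
move=> x y t /andP[t0 t1]; set z := t * x + (1 - t) * y.
have tan u : expR z * (1 + (u - z)) <= expR u.
  have -> : expR u = expR z * expR (u - z) by rewrite -expRD addrC subrK.
  by rewrite ler_wpM2l ?expR_ge0// expR_ge1Dx.
have := ler_wpM2l t0 (tan x).
have t10 : 0 <= 1 - t by lra.
have := ler_wpM2l t10 (tan y).
have : t * (expR z * (1 + (x - z))) + (1 - t) * (expR z * (1 + (y - z))) = expR z.
  by rewrite /z; ring.
lra.
Qed.

Lemma smax_exp_convex (R : realType) (I T : finType) (g : T -> I -> R) (c : R)
    (x : I -> R) (i : I) :
  0 <= c -> convexf (fun a => expR (c * smax g (upd x i a))).
Proof.
move=> c0 a b t t01; have [t0 t1] := andP t01.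
apply: le_trans (_ : expR (t * (c * smax g (upd x i a)) + (1 - t) * (c * smax g (upd x i b))) <= _); last exact: expR_convex.
rewrite ler_expR; have -> : forall u v, t * (c * u) + (1 - t) * (c * v) =
  c * (t * u + (1 - t) * v) :> R by move=> u v; ring.
rewrite ler_wpM2l// -!smaxZ//; last by lra.
apply: le_trans (smaxD _ _ _); apply: le_of_eq.
by congr smax; apply/funext => j; rewrite /upd; case: eqP => // _; ring.
Qed.

(** * Exponential moments of Rademacher averages *)

Definition signs (R : realType) (I : finType) (e : {ffun I -> bool}) : I -> R :=
  fun i => sgn R (e i).
Arguments signs R {I} e.

Lemma sgn_neg (R : realType) b : sgn R (~~ b) = - sgn R b.
Proof. by case: b; rewrite /sgn /= ?opprK. Qed.

Lemma cexp_resample (R : realType) (I : finType) (i : I)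
    (F : {ffun I -> bool} -> R) :
  cexp F = cexp (fun e => (F (updf e i true) + F (updf e i false)) / 2).
Proof.
rewrite /cexp (pexp_resample i)//; last by move=> ?; exact: fair_law.
by apply: eq_pexp => e; rewrite big_bool /=; field.
Qed.

Lemma ler_cexp (R : realType) (I : finType) (F G : {ffun I -> bool} -> R) :
  (forall e, F e <= G e) -> cexp F <= cexp G.
Proof. by move=> FG; apply: ler_pexp => // i; exact: fair_law. Qed.

Lemma cexp_cst (R : realType) (I : finType) (c : R) :
  cexp (fun _ : {ffun I -> bool} => c) = c.
Proof. exact: (pexp_cst _ (fun=> fair_law R)). Qed.

Lemma cexp_ge0 (R : realType) (I : finType) (F : {ffun I -> bool} -> R) :
  (forall e, 0 <= F e) -> 0 <= cexp F.
Proof. by move=> F0; rewrite -(cexp_cst I 0); exact: ler_cexp. Qed.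

(** Conditioning on the signs one after the other turns a cube average into a
    walk, for which induction on the list of steps is available. *)
Lemma cexp_walk (R : realType) (V : lmodType R) (I : finType) (g : I -> V)
    (f : V -> R) (x : V) :
  cexp (fun e : {ffun I -> bool} => f (x + \sum_i signs R e i *: g i)) =
  walk [seq g i | i <- enum I] f x.
Proof.
suff H (l : seq I) y : uniq l ->
    cexp (fun e : {ffun I -> bool} => f (y + \sum_(i <- l) signs R e i *: g i)) =
    walk [seq g i | i <- l] f y.
  by rewrite -(H _ _ (enum_uniq I)); apply: eq_pexp => e; rewrite big_enum.
elim: l y => [|i l IH] y /=.
  by move=> _; rewrite -[RHS](cexp_cst I); apply: eq_pexp => e; rewrite big_nil addr0.
move=> /andP[il ul]; rewrite /step -!IH//.
rewrite (cexp_resample i) mulrDl ![_ / 2]mulrC -!pexpZ -pexpD.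
apply: eq_pexp => e; rewrite !big_cons /signs !ffunE eqxx /= scale1r scaleN1r.
have h b : \sum_(j <- l) sgn R (updf e i b j) *: g j = \sum_(j <- l) sgn R (e j) *: g j.
  apply: eq_big_seq => j jl; rewrite ffunE; case: eqVneq => // ji.
  by rewrite -ji jl in il.
by rewrite !h !addrA; field.
Qed.

Lemma cexp_dotp (R : realType) (I : finType) (g : I -> R) (f : R -> R) :
  cexp (fun e : {ffun I -> bool} => f (dotp g (signs R e))) =
  walk [seq g i | i <- enum I] f 0.
Proof.
rewrite -(@cexp_walk R R^o); apply: eq_pexp => e; rewrite add0r; congr f.
by apply: eq_bigr => i _; rewrite mulrC.
Qed.

Lemma walk_id (R : realType) (l : seq R) (x : R) : walk l id x = x.
Proof. by elim: l x => //= s l IH x; rewrite /step !IH; field. Qed.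

(** The expected maximum dominates the expected positive part of each single
    form, which is half of its mean absolute value by symmetry; [walk_abs]
    bounds the latter from below by the Euclidean norm. *)
Lemma smax_khintchine (R : realType) (I T : finType) (g : T -> I -> R) (t : T) :
  \sum_i g t i ^+ 2 <= (8 * cexp (fun e => smax g (signs R e))) ^+ 2.
Proof.
set E := cexp _; set q := Num.sqrt (\sum_i g t i ^+ 2).
have s0 : 0 <= \sum_i g t i ^+ 2 by apply: sumr_ge0 => i _; exact: sqr_ge0.
have -> : \sum_i g t i ^+ 2 = q ^+ 2 by rewrite sqr_sqrtr.
rewrite ler_sqr ?nnegrE ?sqrtr_ge0//; last first.
  by rewrite mulr_ge0// cexp_ge0// => e; exact: smax_ge0.
have h : q / 4 <= cexp (fun e => `|dotp (g t) (signs R e)|).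
  rewrite (cexp_dotp (g t) Num.norm); apply: walk_abs; rewrite ?sqrtr_ge0//.
  by rewrite big_map big_enum sqr_sqrtr.
have h2 : cexp (fun e => dotp (g t) (signs R e)) = 0 by rewrite (cexp_dotp _ id) walk_id.
have h3 : cexp (fun e => `|dotp (g t) (signs R e)|) <= 2 * E.
  rewrite -[leLHS]addr0 -{1}h2 -pexpD -pexpZ; apply: ler_cexp => e.
  have := smax_ge0 g (signs R e); have := smax_ub g (signs R e) t.
  by case: (ger0P (dotp _ _)); lra.
by lra.
Qed.

Definition flip (I : finType) (i : I) (e : {ffun I -> bool}) : {ffun I -> bool} :=
  updf e i (~~ e i).

Lemma flipK (I : finType) (i : I) : involutive (flip i).
Proof.
move=> e; apply/ffunP => j; rewrite !ffunE.
by case: eqVneq => // ->; rewrite eqxx negbK.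
Qed.

Lemma flipC (I : finType) (i j : I) e : flip i (flip j e) = flip j (flip i e).
Proof.
have [->//|ij] := eqVneq i j; have ji : (j == i) = false by rewrite eq_sym (negbTE ij).
apply/ffunP => k; rewrite !ffunE.
case: (eqVneq k i) => [->|ki]; first by rewrite (negbTE ij).
by case: (eqVneq k j) => // _; rewrite ji.
Qed.

Lemma cexp_flip (R : realType) (I : finType) (i : I) (F : {ffun I -> bool} -> R) :
  cexp (F \o flip i) = cexp F.
Proof.
rewrite /cexp /pexp [RHS](reindex_inj (inv_inj (@flipK I i))) /=.
by apply: eq_bigr => e _; rewrite !prodr_const.
Qed.

Definition average (R : realType) (I : finType) (i : I)
    (F : {ffun I -> bool} -> R) : {ffun I -> bool} -> R :=
  fun e => (F e + F (flip i e)) / 2.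

Lemma average_updf (R : realType) (I : finType) (i : I)
    (F : {ffun I -> bool} -> R) e :
  average i F e = (F (updf e i true) + F (updf e i false)) / 2.
Proof.
rewrite /average /flip; case ei : (e i) => /=.
  congr ((F _ + _) / 2); apply/ffunP => j; rewrite ffunE.
  by case: eqVneq => // ->.
rewrite addrC; congr ((_ + F _) / 2); apply/ffunP => j; rewrite ffunE.
by case: eqVneq => // ->.
Qed.

Definition averages (R : realType) (I : finType) (l : seq I)
    (F : {ffun I -> bool} -> R) : {ffun I -> bool} -> R :=
  foldl (fun H i => average i H) F l.

Lemma averages_enum (R : realType) (I : finType) (F : {ffun I -> bool} -> R) e :
  averages (enum I) F e = cexp F.
Proof.
suff H (l : seq I) (G : {ffun I -> bool} -> R) : averages l G e =
    cexp (fun e' : {ffun I -> bool} => G [ffun j => if j \in l then e' j else e j]).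
  rewrite H; apply: eq_pexp => e'; congr F.
  by apply/ffunP => j; rewrite ffunE mem_enum.
elim: l G => [|i l IH] G /=.
  rewrite -[LHS](cexp_cst I); apply: eq_pexp => e'.
  by congr G; apply/ffunP => j; rewrite ffunE.
rewrite IH [RHS](cexp_resample i); apply: eq_pexp => e'.
by rewrite average_updf; congr ((G _ + G _) / 2); apply/ffunP => j;
  rewrite !ffunE inE; case: eqVneq.
Qed.

(** Efron-Stein on the cube: averaging the coordinates one after the other
    loses at most the flip energy of each coordinate, because averaging is a
    contraction that commutes with the flips. *)
Lemma efron_stein (R : realType) (I : finType) (F : {ffun I -> bool} -> R) :
  cexp (fun e => F e ^+ 2) <= (cexp F) ^+ 2 +
    (\sum_i cexp (fun e => (F e - F (flip i e)) ^+ 2)) / 4.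
Proof.
suff H (l : seq I) (G : {ffun I -> bool} -> R) : cexp (fun e => G e ^+ 2) <=
    cexp (fun e => averages l G e ^+ 2) +
    (\sum_(i <- l) cexp (fun e => (G e - G (flip i e)) ^+ 2)) / 4.
  have := H (enum I) F; rewrite big_enum /=.
  suff -> : cexp (fun e => averages (enum I) F e ^+ 2) = cexp F ^+ 2 by [].
  by rewrite -[RHS](cexp_cst I); apply: eq_pexp => e; rewrite averages_enum.
elim: l G => [|i l IH] G /=; first by rewrite big_nil mul0r addr0.
rewrite big_cons.
have h1 : cexp (fun e => G e ^+ 2) = cexp (fun e => average i G e ^+ 2) +
    cexp (fun e => (G e - G (flip i e)) ^+ 2) / 4.
  have -> : cexp (fun e => G e ^+ 2) =
      cexp (fun e => G e ^+ 2) / 2 + cexp (fun e => G (flip i e) ^+ 2) / 2.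
    by rewrite (cexp_flip i (fun e => G e ^+ 2)); field.
  rewrite ![_ / 2]mulrC [_ / 4]mulrC -!pexpZ -!pexpD; apply: eq_pexp => e.
  by rewrite /average; field.
have h2 : \sum_(j <- l) cexp (fun e => (average i G e - average i G (flip j e)) ^+ 2)
    <= \sum_(j <- l) cexp (fun e => (G e - G (flip j e)) ^+ 2).
  apply: ler_sum => j _; set U := fun e => (G e - G (flip j e)) ^+ 2.
  have -> : cexp U = cexp U / 2 + cexp (U \o flip i) / 2.
    by rewrite cexp_flip; field.
  rewrite ![_ / 2]mulrC -!pexpZ -!pexpD; apply: ler_cexp => e.
  rewrite /U /average /= flipC.
  set a := G e; set b := G (flip j e); set c := G (flip i e); set d := G _.
  rewrite -subr_ge0.
  have -> : 2^-1 * (a - b) ^+ 2 + 2^-1 * (c - d) ^+ 2 - ((a + c) / 2 - (b + d) / 2) ^+ 2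
    = (((a - b) - (c - d)) / 2) ^+ 2 by field.
  exact: sqr_ge0.
have := IH (average i G); rewrite h1; lra.
Qed.

(** Square root of the exponential [expR (s * smax g)]: its second moment is the
    moment generating function and its mean the one at half the argument. *)
Definition tilt (R : realType) (I T : finType) (g : T -> I -> R) (s : R)
    (e : {ffun I -> bool}) : R := expR (s / 2 * smax g (signs R e)).

(** Only upward flips count: the energy is twice the energy of the decreases,
    and at a decrease the maximizing linear form controls the increment. *)
Lemma flip_energy_exp (R : realType) (I T : finType) (g : T -> I -> R)
    (s L : R) :
  0 <= s -> (forall t, \sum_i g t i ^+ 2 <= L ^+ 2) ->
  \sum_i cexp (fun e => (tilt g s e - tilt g s (flip i e)) ^+ 2) <=
  2 * (s * L) ^+ 2 * cexp (fun e => tilt g s e ^+ 2).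
Proof.
move=> s0 hL; set F := tilt g s.
have pos i : cexp (fun e => (F e - F (flip i e)) ^+ 2) =
    2 * cexp (fun e => Num.max 0 (F e - F (flip i e)) ^+ 2).
  rewrite mulr_natl mulr2n -[X in _ = X + _](cexp_flip i) -pexpD.
  apply: eq_pexp => e /=; rewrite flipK.
  set a := F e; set b := F _; rewrite /Num.max.
  by case: (ltP 0 (a - b)) => ab; case: (ltP 0 (b - a)) => ba; rewrite ?expr0n /=; ring || nra.
under eq_bigr do rewrite pos.
rewrite -mulr_sumr -mulrA ler_wpM2l// -pexpZ.
rewrite -(pexp_sum (fun _ _ => 2^-1)); apply: ler_cexp => e.
have F0 : 0 < F e by exact: expR_gt0.
have [S0|[t St]] := smax_attained g (signs R e).
  rewrite big1 => [|i _]; first by apply: mulr_ge0; exact: sqr_ge0.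
  rewrite (_ : Num.max 0 _ = 0) ?expr0n//; apply/max_idPl.
  rewrite subr_le0 /F /tilt S0 mulr0 ler_expR mulr_ge0 ?smax_ge0//.
  by rewrite divr_ge0.
have step1 i : Num.max 0 (F e - F (flip i e)) ^+ 2 <= F e ^+ 2 * s ^+ 2 * g t i ^+ 2.
  have -> : F e ^+ 2 * s ^+ 2 * g t i ^+ 2 = (F e * (s * `|g t i|)) ^+ 2.
    by rewrite !exprMn real_normK ?num_real// mulrA.
  have nn : 0 <= F e * (s * `|g t i|) by rewrite mulr_ge0 ?(ltW F0)// mulr_ge0.
  rewrite ler_sqr ?nnegrE ?le_max ?lexx// ge_max nn /=.
  have d : smax g (signs R e) - smax g (signs R (flip i e)) <= 2 * `|g t i|.
    have := smax_ub g (signs R (flip i e)) t; rewrite St.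
    have -> : dotp (g t) (signs R e) = dotp (g t) (signs R (flip i e)) + 2 * (g t i * signs R e i).
      rewrite /dotp (bigD1 i)//= [in RHS](bigD1 i)//= {3}/signs ffunE eqxx sgn_neg.
      rewrite (eq_bigr (fun j => g t j * signs R (flip i e) j)); first by rewrite /signs; ring.
      by move=> j /negbTE ji; rewrite /signs ffunE ji.
    have : g t i * signs R e i <= `|g t i|.
      by rewrite /signs /sgn; case: ifP => _; rewrite ?mulr1 ?mulrN1 ?ler_norm// -normrN ler_norm.
    lra.
  set a := smax g (signs R e) in d *; set b := smax g (signs R (flip i e)) in d *.
  have -> : F (flip i e) = F e * expR (s / 2 * (b - a)).
    by rewrite /F /tilt -expRD; congr expR; rewrite -/a -/b; ring.
  rewrite -{1}[F e]mulr1 -mulrBr ler_wpM2l ?(ltW F0)//.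
  have h1 := expR_ge1Dx (s / 2 * (b - a)).
  have : s / 2 * (a - b) <= s / 2 * (2 * `|g t i|) by rewrite ler_wpM2l// divr_ge0.
  have -> : s / 2 * (2 * `|g t i|) = s * `|g t i| by field.
  have eba : s / 2 * (b - a) = - (s / 2 * (a - b)) by ring.
  rewrite eba in h1 *; lra.
apply: le_trans (ler_sum _ (fun i _ => step1 i)) _.
rewrite -mulr_sumr.
have -> : (s * L) ^+ 2 * F e ^+ 2 = F e ^+ 2 * s ^+ 2 * L ^+ 2 by ring.
rewrite ler_wpM2l//.
by apply: mulr_ge0; exact: sqr_ge0.
Qed.

Definition mgf (R : realType) (I T : finType) (g : T -> I -> R) (s : R) : R :=
  cexp (fun e => expR (s * smax g (signs R e))).

(** [efron_stein] for [tilt g s] compares the exponential moment at [s] with the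
    square of the one at [s / 2]; [flip_energy_exp] makes the loss proportional
    to the moment itself, so that it can be absorbed. *)
Lemma mgf_half (R : realType) (I T : finType) (g : T -> I -> R) (s L : R) :
  0 <= s -> (forall t, \sum_i g t i ^+ 2 <= L ^+ 2) -> (s * L) ^+ 2 <= 1 ->
  mgf g s <= mgf g (s / 2) ^+ 2 * expR ((s * L) ^+ 2).
Proof.
move=> s0 hL sL.
pose F := tilt g s.
have F2 : mgf g s = cexp (fun e => F e ^+ 2).
  by apply: eq_pexp => e; rewrite /F /tilt -expRM_natl; congr expR; field.
have := efron_stein F; have := flip_energy_exp s0 hL.
rewrite /= -/F -F2 -/(mgf g (s / 2)); set y := (s * L) ^+ 2 in sL *.
set m := mgf g s; set h := mgf g (s / 2) => h1 h2.
have y0 : 0 <= y by exact: sqr_ge0.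
have m0 : 0 <= m by apply: cexp_ge0 => e; exact: expR_ge0.
have {h1}h2 : m * (1 - y / 2) <= h ^+ 2.
  have h2' : m <= h ^+ 2 + (2 * y * m) / 4 by lra.
  have -> : m * (1 - y / 2) = m - (2 * y * m) / 4 by field.
  lra.
have e1 := expR_ge1Dx y.
have h3 : 1 <= (1 - y / 2) * expR y.
  have : (1 - y / 2) * (1 + y) <= (1 - y / 2) * expR y by rewrite ler_wpM2l//; lra.
  by nra.
have := ler_wpM2r (expR_ge0 y) h2; have := ler_wpM2l m0 h3; rewrite mulr1 mulrA; lra.
Qed.

(** The losses at [s], [s / 2], [s / 4] and so on form a geometric series of
    ratio less than 1 / 2. *)
Lemma mgf_iter (R : realType) (I T : finType) (g : T -> I -> R) (k : nat) (s L : R) :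
  0 <= s -> (forall t, \sum_i g t i ^+ 2 <= L ^+ 2) -> (s * L) ^+ 2 <= 1 ->
  mgf g s <= mgf g (s / 2 ^+ k) ^+ (2 ^ k) * expR (2 * (s * L) ^+ 2).
Proof.
move=> s0 hL; elim: k s s0 => [|k IH] s s0 sL.
  rewrite expr0 divr1 expn0 expr1 ler_peMr//.
    by apply: cexp_ge0 => e; exact: expR_ge0.
  by rewrite -expR0 ler_expR mulr_ge0 ?sqr_ge0.
apply: le_trans (mgf_half s0 hL sL) _.
have s20 : 0 <= s / 2 by rewrite divr_ge0.
have e4 : (s / 2 * L) ^+ 2 = (s * L) ^+ 2 / 4 by field.
have := IH (s / 2) s20; rewrite e4 => h0.
have {h0} := h0 (ltac:(have := sqr_ge0 (s * L); lra)).
have -> : s / 2 / 2 ^+ k = s / 2 ^+ k.+1 by rewrite exprS invfM mulrA.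
set u := mgf g (s / 2 ^+ k.+1); set v := mgf g (s / 2) => h.
have v0 : 0 <= v by apply: cexp_ge0 => e; exact: expR_ge0.
have h2 : v ^+ 2 <= (u ^+ (2 ^ k) * expR (2 * ((s * L) ^+ 2 / 4))) ^+ 2.
  by rewrite ler_sqr ?nnegrE// (le_trans v0).
have := ler_wpM2r (expR_ge0 ((s * L) ^+ 2)) h2 => /le_trans; apply.
rewrite exprMn -exprM -expnSr -mulrA -expRM_natl -expRD.
by apply: le_of_eq; congr (_ * expR _); field.
Qed.

(** The iteration of [mgf_half] is stopped at a scale where [expR] is linear, so
    that the exponential moment is governed by the mean. *)
Lemma mgf_bound (R : realType) (I T : finType) (g : T -> I -> R) (s L : R) :
  0 <= s -> (forall t, \sum_i g t i ^+ 2 <= L ^+ 2) -> (s * L) ^+ 2 <= 1 ->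
  mgf g s <= expR (s * cexp (fun e => smax g (signs R e)) + 2 * (s * L) ^+ 2 + 1).
Proof.
move=> s0 hL sL; set E := cexp _.
pose M := \sum_(e : {ffun I -> bool}) smax g (signs R e).
have M0 : 0 <= M by apply: sumr_ge0 => e _; exact: smax_ge0.
have SM e : smax g (signs R e) <= M.
  rewrite /M (bigD1 e)//= lerDl; apply: sumr_ge0 => e' _; exact: smax_ge0.
have [k hk] : exists k : nat, 2 * (s * M) + 2 * (s * M) ^+ 2 <= 2 ^+ k.
  exists (Num.truncn (2 * (s * M) + 2 * (s * M) ^+ 2)).+1.
  set z := _ + _; apply: le_trans (ltW (truncnS_gt z)) _.
  by rewrite -natrX ler_nat ltnW// ltn_expl.
have sM0 : 0 <= s * M by exact: mulr_ge0.
have k0 : 0 < (2 : R) ^+ k by exact: exprn_gt0.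
apply: le_trans (mgf_iter k s0 hL sL) _.
set x := s / 2 ^+ k.
have x0 : 0 <= x by rewrite divr_ge0 ?(ltW k0).
have xM : x * M <= 2^-1.
  rewrite /x mulrAC ler_pdivrMr//; have := sqr_ge0 (s * M); lra.
have hx : mgf g x <= expR (x * E + 2 * (x * M) ^+ 2).
  apply: le_trans (expR_ge1Dx _).
  have -> : 1 + (x * E + 2 * (x * M) ^+ 2) =
      cexp (fun e => (1 + 2 * (x * M) ^+ 2) + x * smax g (signs R e)).
    by rewrite [RHS]pexpD pexpZ -/(cexp _) cexp_cst -/(cexp _) -/E; ring.
  apply: ler_cexp => e.
  set y := x * smax g (signs R e).
  have y0 : 0 <= y by rewrite mulr_ge0 ?smax_ge0.
  have yM : y <= x * M by rewrite ler_wpM2l.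
  have e1 : expR y * (1 - y) <= 1.
    have := expR_ge1Dx (- y) => h.
    have ee : expR y * expR (- y) = 1 by rewrite -expRD subrr expR0.
    by rewrite -[leRHS]ee ler_wpM2l ?expR_ge0.
  have y2 : y ^+ 2 <= (x * M) ^+ 2 by rewrite ler_sqr ?nnegrE// (le_trans y0).
  have e2 : 1 <= (1 + y + 2 * y ^+ 2) * (1 - y) by nra.
  have : expR y * (1 - y) <= (1 + y + 2 * y ^+ 2) * (1 - y) by lra.
  rewrite ler_pM2r; lra.
have m0 : 0 <= mgf g x by apply: cexp_ge0 => e; exact: expR_ge0.
have := lerXn2r (2 ^ k) _ _ hx; rewrite ?nnegrE => /(_ m0 (expR_ge0 _)).
rewrite -expRM_natl => h.
apply: le_trans (ler_wpM2r (expR_ge0 _) h) _.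
rewrite -expRD ler_expR natrX mulrDr.
have -> : 2 ^+ k * (x * E) = s * E by rewrite /x; field; rewrite gt_eqF.
have -> : 2 ^+ k * (2 * (x * M) ^+ 2) = 2 * (s * M) ^+ 2 / 2 ^+ k.
  by rewrite /x; field; rewrite gt_eqF.
have : 2 * (s * M) ^+ 2 / 2 ^+ k <= 1 by rewrite ler_pdivrMr//; lra.
lra.
Qed.

(** [smax_khintchine] bounds the Euclidean norms of all forms by [8 * rho], so
    that the Rademacher average alone controls both parameters of [mgf_bound];
    the factor 16 keeps the exponent below 2. *)
Lemma smax_exp_moment (R : realType) (I T : finType) (g : T -> I -> R) (rho : R) :
  0 < rho -> cexp (fun e => smax g (signs R e)) <= rho ->
  cexp (fun e => expR ((16 * rho)^-1 * smax g (signs R e))) <= expR 2.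
Proof.
move=> rho0 hrho; set E := cexp _ in hrho.
have E0 : 0 <= E by apply: cexp_ge0 => e; exact: smax_ge0.
have s0 : 0 <= (16 * rho)^-1 by rewrite invr_ge0 mulr_ge0// ltW.
have sE : (16 * rho)^-1 * E <= 16^-1.
  by rewrite invfM -mulrA ger_pMr ?invr_gt0// mulrC ler_pdivrMr// mul1r.
have sE0 : 0 <= (16 * rho)^-1 * E by exact: mulr_ge0.
have q : ((16 * rho)^-1 * (8 * E)) ^+ 2 <= 4^-1.
  by rewrite mulrCA; nra.
apply: le_trans (mgf_bound s0 (smax_khintchine g) _) _; first by rewrite -/E; lra.
by rewrite -/E ler_expR; lra.
Qed.

(** * Contraction of Rademacher averages *)

(** Extension by 0 at [None], so that the base value 0 of [smax] becomes an
    ordinary index. *)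
Definition with0 (R : realType) (T : Type) (u : T -> R) (o : option T) : R :=
  if o is Some t then u t else 0.

Definition maxo (R : realType) (T : finType) (c : {ffun option T -> R}) : R :=
  \big[Num.max/c None]_(t : T) c (Some t).

Lemma maxo_ub (R : realType) (T : finType) (c : {ffun option T -> R}) o :
  c o <= maxo c.
Proof.
case: o => [t|]; rewrite /maxo; first by rewrite (bigD1 t)//= le_max lexx.
by elim/big_rec: _ => // t y _; rewrite le_max orbC => ->.
Qed.

Lemma maxo_attained (R : realType) (T : finType) (c : {ffun option T -> R}) :
  exists o, maxo c = c o.
Proof.
rewrite /maxo; elim/big_rec: _ => [|t y _ IH]; first by exists None.
by rewrite /Num.max; case: ifP => _; [exact: IH|exists (Some t)].
Qed.

Lemma maxo_le (R : realType) (T : finType) (c : {ffun option T -> R}) m :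
  (forall o, c o <= m) -> maxo c <= m.
Proof. by move=> h; have [j ->] := maxo_attained c. Qed.

Lemma smax_maxo (R : realType) (I T : finType) (g : T -> I -> R)
    (e : {ffun I -> bool}) :
  smax g (signs R e) =
  maxo (\sum_i signs R e i *: [ffun o => with0 (fun t => g t i) o]).
Proof.
rewrite /smax /maxo sum_ffunE big1 => [|i _]; last by rewrite !ffunE /= scaler0.
apply: eq_bigr => t _; rewrite sum_ffunE; apply: eq_bigr => i _.
by rewrite !ffunE /= /GRing.scale /= mulrC.
Qed.

Lemma cexp_smax_walk (R : realType) (I T : finType) (g : T -> I -> R) :
  cexp (fun e => smax g (signs R e)) =
  walk [seq [ffun o => with0 (fun t => g t i) o] | i <- enum I] (@maxo R T) 0.
Proof.
by rewrite -cexp_walk; apply: eq_pexp => e; rewrite add0r smax_maxo.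
Qed.

Definition step2 (R : realType) (V : zmodType) (u v : V) (f : V -> R) : V -> R :=
  step u (step v f).

(** A random sign along [u] is dominated by independent signs along [x + x] and
    [y + y] when [x] and [y] together control the differences of [u]. The
    property passes from [M] to its walks, so that coordinates can be treated
    one at a time. *)
Definition contracts (R : realType) (T : finType) (M : {ffun option T -> R} -> R) :=
  forall (u x y c : {ffun option T -> R}),
    (forall o o', `|u o - u o'| <= `|x o - x o'| + `|y o - y o'|) ->
    step u M c <= step2 (x + x) (y + y) M c.

Lemma maxo_contracts (R : realType) (T : finType) : contracts (@maxo R T).
Proof.
move=> u x y c lip; rewrite /step2 /step.
have [j ho] := maxo_attained (c + u); have [j' ho'] := maxo_attained (c - u).
rewrite ho ho'; rewrite !ffunE /=.
have := lip j j'; have := ler_norm (u j - u j').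
set M1 := maxo (c + (x + x) + (y + y)); set M2 := maxo (c + (x + x) - (y + y)).
set M3 := maxo (c - (x + x) + (y + y)); set M4 := maxo (c - (x + x) - (y + y)).
have h (w : {ffun option T -> R}) a b : w a <= maxo w /\ w b <= maxo w.
  by split; exact: maxo_ub.
have [] := h (c + (x + x) + (y + y)) j j'; have [] := h (c + (x + x) - (y + y)) j j'.
have [] := h (c - (x + x) + (y + y)) j j'; have [] := h (c - (x + x) - (y + y)) j j'.
rewrite -/M1 -/M2 -/M3 -/M4 !ffunE.
case: (ger0P (x j - x j')) => hx; case: (ger0P (y j - y j')) => hy; lra.
Qed.

Lemma stepC (R : realType) (V : zmodType) (s t : V) (f : V -> R) :
  step s (step t f) = step t (step s f).
Proof.
apply/funext => x; rewrite /step ![x + s + _]addrAC ![x - s + _]addrAC.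
by field.
Qed.

Lemma ler_step (R : realType) (V : zmodType) (s : V) (f g : V -> R) x :
  (forall y, f y <= g y) -> step s f x <= step s g x.
Proof. by move=> fg; rewrite /step; have := fg (x + s); have := fg (x - s); lra. Qed.

Lemma walk_contracts (R : realType) (T : finType)
    (l : seq {ffun option T -> R}) (M : {ffun option T -> R} -> R) :
  contracts M -> contracts (walk l M).
Proof.
move=> cM; elim: l => //= s l IH u x y c lip.
rewrite (stepC u s) /step2 (stepC (y + y) s) (stepC (x + x) s).
by apply: ler_step => d; exact: IH.
Qed.

(** Contraction principle with two coordinates controlling a third one; the
    factor 2 comes from [|x| + |y| <= |x + y| + |x - y|] at the indices that
    attain the maximum for the two signs. *)
Lemma cexp_contraction (R : realType) (I T : finType) (f a b : T -> I -> R)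
    (al be : R) :
  0 <= al -> 0 <= be ->
  (forall i t, `|f t i| <= al * `|a t i| + be * `|b t i|) ->
  (forall i t t', `|f t i - f t' i| <=
     al * `|a t i - a t' i| + be * `|b t i - b t' i|) ->
  cexp (fun e => smax f (signs R e)) <=
  2 * al * cexp (fun e => smax a (signs R e)) +
  2 * be * cexp (fun e => smax b (signs R e)).
Proof.
move=> al0 be0 lip0 lip.
pose F (g : T -> I -> R) i : {ffun option T -> R} :=
  [ffun o => with0 (fun t => g t i) o].
pose A := fun t i => 2 * al * a t i; pose B := fun t i => 2 * be * b t i.
have sc (g : T -> I -> R) k : 0 <= k -> k * cexp (fun e => smax g (signs R e)) =
    cexp (fun e => smax (fun t i => k * g t i) (signs R e)).
  move=> k0; rewrite -pexpZ; apply: eq_pexp => e; rewrite -smaxZ//.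
  rewrite /smax; apply: eq_bigr => t _; apply: eq_bigr => i _; ring.
rewrite !sc ?mulr_ge0// -/A -/B !cexp_smax_walk -!/(F _ _).
pose two l := foldr (fun i => step2 (F A i) (F B i)) (@maxo R T) l.
have ctr l : contracts (two l).
  elim: l => [|i l IH]; first exact: maxo_contracts.
  by rewrite /two /= /step2 -/(two l); apply: (@walk_contracts R T [:: F A i; F B i]).
have h1 l c : walk [seq F f i | i <- l] (@maxo R T) c <= two l c.
  elim: l c => //= i l IH c.
  apply: le_trans (ler_step _ _ IH) _.
  have := ctr l (F f i) [ffun o => al * with0 (fun t => a t i) o]
     [ffun o => be * with0 (fun t => b t i) o] c.
  have -> : [ffun o => al * with0 (fun t => a t i) o] + [ffun o => al * with0 (fun t => a t i) o] = F A i.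
    apply/ffunP => j; rewrite !ffunE /A; case: j => [t|] /=; ring.
  have -> : [ffun o => be * with0 (fun t => b t i) o] + [ffun o => be * with0 (fun t => b t i) o] = F B i.
    apply/ffunP => j; rewrite !ffunE /B; case: j => [t|] /=; ring.
  apply => j j'; rewrite !ffunE -!mulrBr !normrM (ger0_norm al0) (ger0_norm be0).
  case: j => [t|]; case: j' => [t'|] /=; rewrite ?subr0 ?sub0r ?normrN ?normr0 ?mulr0 ?addr0//.
have h2 l c d : two l (c + d) <= walk [seq F A i | i <- l] (@maxo R T) c +
    walk [seq F B i | i <- l] (@maxo R T) d.
  elim: l c d => [|i l IH] c d /=.
    by apply: maxo_le => j; rewrite ffunE lerD ?maxo_ub.
  rewrite /step2 /step -/(two l).
  have e (u v : {ffun option T -> R}) : c + d + u + v = c + u + (d + v).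
    by rewrite -addrA addrACA.
  rewrite !e.
  have := IH (c + F A i) (d + F B i); have := IH (c + F A i) (d - F B i).
  have := IH (c - F A i) (d + F B i); have := IH (c - F A i) (d - F B i).
  lra.
by apply: le_trans (h1 _ _) _; have := h2 (enum I) 0 0; rewrite addr0.
Qed.

(** * Deviations under finite laws *)

(** Finite subfamilies spare any question of measurability or attainment of the
    supremum over the class. *)
Definition rademacher_le (R : realType) (I : finType) (Th : Type) (D : set Th)
    (g : Th -> I -> R) (rho : R) : Prop :=
  forall (T : finType) (t : T -> Th), (forall j, D (t j)) ->
    cexp (fun e => smax (fun j => g (t j)) (signs R e)) <= rho.

Lemma rademacher_norm (R : realType) (I : finType) (Th : Type) (D : set Th)
    (g : Th -> I -> R) (rho : R) (th : Th) :
  rademacher_le D g rho -> D th -> \sum_i g th i ^+ 2 <= (8 * rho) ^+ 2.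
Proof.
move=> hr Dth; have h := hr unit (fun=> th) (fun=> Dth).
apply: le_trans (smax_khintchine (fun _ : unit => g th) tt) _.
have E0 := cexp_ge0 (fun e => smax_ge0 (fun _ : unit => g th) (signs R e)).
by rewrite ler_sqr ?nnegrE; nra.
Qed.

(** Chernoff bound on the maximum over witnesses, one for each bad outcome:
    these are finitely many forms. Their exponential moment is dominated,
    coordinate by coordinate, by that of an [N]-step walk, which is at most the
    [N]-th power of the exponential moment of a Rademacher average. *)
Lemma finite_tail (R : realType) (I A : finType) (Th : Type) (D : set Th)
    (g : Th -> I -> R) (p v : I -> A -> R) (N : nat) (tau rho : R) :
  (forall i, fin_law (p i)) ->
  (forall i f, convexf f -> \sum_a p i a * f (v i a - \sum_b p i b * v i b) <=
     walk (nseq N tau) f 0) ->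
  0 < tau -> 0 < rho -> rademacher_le D g rho ->
  pexp p (fun k => (`[< exists2 th, D th & 48 * N%:R * tau * rho <
      dotp (g th) (fun i => v i (k i) - \sum_b p i b * v i b) >])%:R)
    <= expR (- N%:R).
Proof.
move=> lp dom tau0 rho0 hrho.
pose x (k : {ffun I -> A}) i := v i (k i) - \sum_b p i b * v i b.
set y := 48 * N%:R * tau * rho.
pose bad (k : {ffun I -> A}) := `[< exists2 th, D th & y < dotp (g th) (x k) >].
pose T : finType := {k : {ffun I -> A} | bad k}.
have wit (j : T) : {th | D th & y < dotp (g th) (x (val j))}.
  by have /asboolP/cid2 := valP j.
pose t j := s2val (wit j).
have Dt j : D (t j) by rewrite /t; case: (wit j).
pose G j := g (t j).
have badG k : bad k -> y < smax G (x k).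
  move=> bk; pose j : T := exist _ k bk.
  have yj : y < dotp (G j) (x k) by rewrite /G /t; case: (wit j).
  exact: lt_le_trans yj (smax_ub _ _ _).
(* In units of [s] each walk step costs at most 2 and the level is [3 * N]. *)
pose s := (16 * rho * tau)^-1.
have s0 : 0 < s by rewrite invr_gt0 !mulr_gt0.
have sy : s * y = 3 * N%:R by rewrite /s /y; field; rewrite !gt_eqF.
apply: (@le_trans _ _ (expR (- (s * y)) * pexp p (fun k => expR (s * smax G (x k))))).
  rewrite -pexpZ; apply: ler_pexp => // k; rewrite -/(x k) -/(bad k) -expRD.
  case: (boolP (bad k)) => [/badG bk|_] /=; last exact: expR_ge0.
  rewrite mulr1n; have -> : 1 = expR 0 :> R by rewrite expR0.
  by rewrite ler_expR addrC -mulrBr mulr_ge0 ?ltW// subr_gt0.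
have -> : expR (- N%:R) = expR (- (s * y)) * expR (2 * N%:R) :> R.
  by rewrite -expRD sy; congr expR; ring.
rewrite ler_wpM2l ?expR_ge0//.
apply: (@le_trans _ _ (pexp (fun _ : I => wlaw R N)
    (fun k => expR (s * smax G (fun i => wval tau (k i)))))).
  apply: (pexp_dominate (f := fun i a => v i a - \sum_b p i b * v i b)
    (h := fun _ => @wval R tau N) (F := fun z => expR (s * smax G z))) => //.
  - by move=> i; exact: wlaw_fin_law.
  - move=> i f cf; apply: le_trans (dom i f cf) _.
    rewrite -walk_wlaw; apply: le_of_eq.
    by apply: eq_bigr => u _; rewrite add0r.
  - by move=> z i; apply: smax_exp_convex; exact: ltW.
apply: (le_trans (@pexp_walk_le R I N tau (fun z => expR (s * smax G z)) _ _ _)).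
- by move=> z; exact: expR_ge0.
- by rewrite smax0 mulr0 expR0.
- by move=> z z'; rewrite -expRD ler_expR -mulrDr ler_wpM2l ?smaxD// ltW.
rewrite mulrC expRM_natl; apply: lerXn2r; rewrite ?nnegrE ?expR_ge0//.
  by apply: cexp_ge0 => e; exact: expR_ge0.
apply: le_trans (smax_exp_moment rho0 (hrho _ _ Dt)).
apply: ler_cexp => e; rewrite ler_expR smaxZ ?(ltW tau0)// mulrA.
apply: le_of_eq; congr (_ * _).
by rewrite /s; field; rewrite !gt_eqF.
Qed.

(** Writing [2 ^ r] as 1 plus a sum over layers lets its expectation be read off
    from tail probabilities. *)
Lemma layer_ceil (R : realType) (N : nat) (x : R) : 0 <= x <= N%:R ->
  exists r : nat, [/\ (r <= N)%N, x <= r%:R &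
    2 ^+ r <= 1 + \sum_(j < N) 2 ^+ j * ((j%:R : R) < x)%R%:R :> R].
Proof.
elim: N => [|N IH] /andP[x0 xN].
  by exists 0%N; rewrite big_ord0 addr0 expr0.
have [xN'|Nx] := leP x N%:R.
  have [|r [rN xr h]] := IH; first by rewrite x0.
  exists r; split => //; first exact: leqW.
  apply: le_trans h _; rewrite big_ord_recr /= lerD2l lerDl mulr_ge0 ?exprn_ge0//.
exists N.+1; split => //.
rewrite (eq_bigr (fun j : 'I_N.+1 => 2 ^+ j)) => [|j _]; last first.
  rewrite (_ : (_ < x) = true) ?mulr1//; apply: le_lt_trans Nx.
  by rewrite ler_nat -ltnS.
apply: le_of_eq.
by elim: N.+1 => [|m IHm]; rewrite ?big_ord0 ?addr0 ?expr0// big_ord_recr /= addrA -IHm exprS; ring.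
Qed.

(** * Discretization of the noise *)

(** A gauge grades the size of a real number; it is [th * |y|] for the
    subexponential noise and [th * y ^ 2] for the subgaussian one. *)
Definition gauge (R : realType) (gam : R -> R) : Prop :=
  [/\ measurable_fun setT gam, gam 0 = 0,
      forall x y, `|x| <= `|y| -> gam x <= gam y &
      forall c : R, exists A : R, forall y, gam y <= c -> `|y| <= A].

Lemma gauge_ge0 (R : realType) (gam : R -> R) y : gauge gam -> 0 <= gam y.
Proof. by case=> _ <- mon _; apply: mon; rewrite normr0. Qed.

Definition trunc_gauge (R : realType) (gam : R -> R) (N : nat) (y : R) : R :=
  if gam y <= N%:R then y else 0.

Lemma measurable_truncn_level (R : realType) (h : R -> R) (k : nat) :
  measurable_fun setT h -> (forall y, 0 <= h y) ->
  measurable [set y | Num.truncn (h y) = k].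
Proof.
move=> mh h0.
have -> : [set y | Num.truncn (h y) = k] =
    (fun y => k%:R <= h y) @^-1` [set true] `&`
    (fun y => h y < k.+1%:R) @^-1` [set true].
  apply/seteqP; split => y /=.
    by move=> /eqP; rewrite truncn_eq// => /andP[-> ->].
  by move=> [h1 h2]; apply/eqP; rewrite truncn_eq// h1 h2.
apply: measurableI.
  rewrite -[_ @^-1` _]setTI.
  by apply: (measurable_fun_ler (measurable_cst _) mh) => //.
rewrite -[_ @^-1` _]setTI.
by apply: (measurable_fun_ltr mh (measurable_cst _)) => //.
Qed.

(** The noise is replaced by a variable with finitely many values, by truncation
    at gauge level [N] and rounding. Rounding is towards 0 because the
    approximation has to inherit the tail bounds. *)
Lemma quantizer (R : realType) (gam : R -> R) (N : nat) (eps : R) :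
  gauge gam -> 0 < eps ->
  exists (A : finType) (idx : R -> A) (val : A -> R),
    [/\ forall a, measurable (idx @^-1` [set a]),
        forall a, gam (val a) <= N%:R,
        forall y, `|val (idx y)| <= `|y|,
        forall y, gam y <= N%:R -> `|y - val (idx y)| <= eps &
        forall y, N%:R < gam y -> val (idx y) = 0].
Proof.
move=> gg eps0; have [mgam g0 mon bnd] := gg.
have [A0 hA0] := bnd N%:R.
pose tr := trunc_gauge gam N.
have trA y : `|tr y| <= `|A0|.
  rewrite /tr /trunc_gauge; case: ifP => [/hA0 yA|_]; last by rewrite normr0.
  by rewrite (le_trans yA)// ler_norm.
have trle y : `|tr y| <= `|y|.
  by rewrite /tr /trunc_gauge; case: ifP => // _; rewrite normr0.
have gtr y : gam (tr y) <= N%:R.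
  by rewrite /tr /trunc_gauge; case: ifP => // _; rewrite g0.
have mtr : measurable_fun setT tr.
  by apply: measurable_fun_ifT => //; exact: (measurable_fun_ler mgam).
pose m := Num.truncn (`|A0| / eps).
pose h y := `|tr y| / eps.
have h0 y : 0 <= h y by rewrite divr_ge0// ltW.
have mh : measurable_fun setT h.
  by apply: measurable_funM => //; exact: measurableT_comp.
have hm y : (Num.truncn (h y) <= m)%N.
  by apply: le_truncn; rewrite ler_pM2r ?invr_gt0.
pose A : finType := (bool * 'I_m.+1)%type.
pose idx y : A := (0 <= tr y, inord (Num.truncn (h y))).
pose val0 (a : A) : R := sgn R a.1 * (eps * a.2%:R).
pose val a := if gam (val0 a) <= N%:R then val0 a else 0.
have low y : eps * (Num.truncn (h y))%:R <= `|tr y|.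
  rewrite mulrC -ler_pdivlMr//; by have /andP[] := truncn_itv (h0 y).
have up y : `|tr y| <= eps * (Num.truncn (h y))%:R + eps.
  have -> : eps * (Num.truncn (h y))%:R + eps = (Num.truncn (h y)).+1%:R * eps.
    by rewrite -natr1; ring.
  rewrite -ler_pdivrMr// ltW//.
  by have /andP[] := truncn_itv (h0 y).
have v0 y : val0 (idx y) = sgn R (0 <= tr y) * (eps * (Num.truncn (h y))%:R).
  by rewrite /val0 /idx /= inordK// ltnS hm.
have nv0 y : `|val0 (idx y)| = eps * (Num.truncn (h y))%:R.
  rewrite v0 normrM [X in _ * X]ger0_norm ?mulr_ge0 ?(ltW eps0)//.
  by rewrite /sgn; case: ifP; rewrite ?normrN normr1 mul1r.
have vE y : val (idx y) = val0 (idx y).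
  rewrite /val ifT//; apply: le_trans (gtr y); apply: mon.
  by rewrite nv0.
exists A, idx, val; split.
- move=> [b k].
  have -> : idx @^-1` [set (b, k)] =
      (fun y => 0 <= tr y) @^-1` [set b] `&`
      \bigcup_(j in [set j | inord j = k]) [set y | Num.truncn (h y) = j].
    apply/seteqP; split => y /=.
      by case=> <- hk; split => //; exists (Num.truncn (h y)).
    by move=> [hb [j /= jk hj]]; rewrite /idx hb hj jk.
  apply: measurableI.
    rewrite -[_ @^-1` _]setTI.
    by apply: (measurable_fun_ler (measurable_cst _) mtr) => //.
  by apply: bigcup_measurable => j _; exact: measurable_truncn_level.
- by move=> a; rewrite /val; case: ifP => // _; rewrite g0.
- by move=> y; rewrite vE nv0 (le_trans (low y)).
- move=> y gy; have ty : tr y = y by rewrite /tr /trunc_gauge gy.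
  rewrite vE v0; have := low y; have := up y; rewrite ty /sgn.
  by case: (ger0P y) => y0 u l; rewrite ler_norml ?mul1r ?mulN1r; apply/andP; split; lra.
- move=> y gy; have ty : tr y = 0 by rewrite /tr /trunc_gauge leNgt gy.
  apply/eqP; rewrite -normr_eq0 vE nv0 eq_le; apply/andP; split.
    by apply: le_trans (low y) _; rewrite ty normr0.
  by rewrite mulr_ge0// ltW.
Qed.

Lemma le_measure_bigU d (Om : measurableType d) (R : realType)
    (P : probability Om R) (T : Type) (s : seq T) (F : T -> set Om) :
  (forall t, measurable (F t)) ->
  (P (\big[setU/set0]_(t <- s) F t) <= \sum_(t <- s) P (F t))%E.
Proof.
move=> mF; elim: s => [|t s IH]; first by rewrite !big_nil measure0.
rewrite !big_cons.
apply: (@le_trans _ _ (P (F t) + P (\big[setU/set0]_(j <- s) F j))%E).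
  by apply: measureU2 => //; exact: bigsetU_measurable.
exact: leeD2l.
Qed.

Lemma integral_prob_cst d (Om : measurableType d) (R : realType)
    (P : probability Om R) (c : R) : (\int[P]_(w in setT) c%:E = c%:E)%E.
Proof.
rewrite integral_cst// -[RHS]mule1; congr (_ * _)%E; exact: probability_setT.
Qed.

Section CellLaw.
Context (d : measure_display) (Om : measurableType d) (R : realType)
  (P : probability Om R) (A : finType) (idx : R -> A).

Definition cell_law (Y : Om -> R) (a : A) : R := fine (P (Y @^-1` (idx @^-1` [set a]))).

Lemma integral_cell (Y : {RV P >-> R}) (u : A -> R) :
  (forall a, measurable (idx @^-1` [set a])) ->
  P.-integrable setT (fun w => (u (idx (Y w)))%:E) /\
  (\int[P]_w (u (idx (Y w)))%:E = (\sum_a cell_law Y a * u a)%:E)%E.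
Proof.
move=> mS.
pose S a : set Om := Y @^-1` (idx @^-1` [set a]).
have mSa a : measurable (S a) by rewrite -[S a]setTI; exact: measurable_funP.
have E w : (u (idx (Y w)))%:E = (\sum_a ((u a)%:E * (\1_(S a) w)%:E))%E.
  rewrite (bigD1 (idx (Y w)))//= big1 => [|a ai].
    by rewrite indicE mem_set// mule1 adde0.
  rewrite indicE memNset ?mule0// => h; move: ai; rewrite -h eqxx//.
have int a : P.-integrable setT (fun w => ((u a)%:E * (\1_(S a) w)%:E)%E).
  by apply: integrableZl => //; apply: integrable_indic.
split.
  apply: (eq_integrable _ (fun w => (\sum_a ((u a)%:E * (\1_(S a) w)%:E))%E)) => //.
  exact: integrable_sum.
under eq_integral do rewrite E.
rewrite integral_sum// -sumEFin; apply: eq_bigr => a _.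
rewrite integralZl ?integral_indic//; last exact: integrable_indic.
by rewrite setIT muleC /cell_law -/(S a) EFinM fineK ?fin_num_measure.
Qed.

Lemma cell_law_fin (Y : {RV P >-> R}) :
  (forall a, measurable (idx @^-1` [set a])) -> fin_law (cell_law Y).
Proof.
move=> mS; split=> [a|]; first exact: fine_ge0.
have [_ h] := integral_cell Y (fun=> 1) mS.
by move: h; rewrite integral_prob_cst; under eq_bigr do rewrite mulr1; case.
Qed.

Lemma cell_law_le (Y : {RV P >-> R})
    (Q : pred A) (B : set Om) :
  (forall a, measurable (idx @^-1` [set a])) -> measurable B ->
  (forall w, Q (idx (Y w)) -> B w) ->
  ((\sum_a cell_law Y a * (Q a)%:R)%:E <= P B)%E.
Proof.
move=> mS mB QB; have [iQ <-] := integral_cell Y (fun a => (Q a)%:R) mS.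
have -> : P B = (\int[P]_w (\1_B w)%:E)%E by rewrite integral_indic// setIT.
apply: ge0_le_integral => //.
- by case/integrableP: iQ.
- by apply/measurable_EFinP; exact: measurable_indic.
move=> w _; rewrite lee_fin indicE.
by case: (boolP (Q _)) => // /QB Bw; rewrite mem_set.
Qed.

End CellLaw.

(** The distance to the centered variable [Y] is at most [eps] off [B], and on
    [B] it is [|Y|], bounded by [(k * Y ^ 2 + 1 / k) / 2]: the second moment of
    [Y] and the probability of [B] control the shift of the mean. *)
Lemma approx_mean d (Om : measurableType d) (R : realType)
    (P : probability Om R) (Y : {RV P >-> R}) (X : Om -> R) (B : set Om)
    (eps k V : R) :
  P.-integrable setT (fun w => (X w)%:E) -> measurable B ->
  0 <= eps -> 0 < k ->
  ('E_P[Y] = 0)%E -> (\int[P]_w ((Y w) ^+ 2)%:E <= V%:E)%E ->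
  (forall w, ~ B w -> `|Y w - X w| <= eps) ->
  (forall w, B w -> X w = 0) ->
  `|fine (\int[P]_w (X w)%:E)%E| <= eps + k / 2 * V + (2 * k)^-1 * fine (P B).
Proof.
move=> iX mB eps0 k0 EY0 EY2 XY XB.
have mY : measurable_fun setT Y by [].
have mY2 : measurable_fun setT (fun w => ((Y w) ^+ 2)%:E).
  by apply/measurable_EFinP; exact: measurable_funX.
have iY2 : P.-integrable setT (fun w => ((Y w) ^+ 2)%:E).
  apply/integrableP; split => //.
  under eq_integral => w _ do rewrite gee0_abs ?lee_fin ?sqr_ge0//.
  by apply: le_lt_trans EY2 _; rewrite ltry.
have ic c : P.-integrable setT (fun _ : Om => c%:E) by exact: finite_measure_integrable_cst.
have iY : P.-integrable setT (fun w => (Y w)%:E).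
  apply: (le_integrable _ _ _ (integrableD _ (ic 1) iY2)) => //.
    exact/measurable_EFinP.
  move=> w _ /=; rewrite lee_fin [leRHS]ger0_norm ?addr_ge0 ?sqr_ge0//.
  have := sqr_ge0 (`|Y w| - 2^-1); have : (Y w) ^+ 2 = `|Y w| ^+ 2 by rewrite real_normK ?num_real.
  by move=> ->; rewrite sqrrB; lra.
have iB : P.-integrable setT (fun w => (\1_B w)%:E) by exact: integrable_indic.
pose U w := (eps%:E + (k / 2)%:E * ((Y w) ^+ 2)%:E + ((2 * k)^-1)%:E * (\1_B w)%:E)%E.
have iU : P.-integrable setT U.
  by apply: integrableD => //; [apply: integrableD|]=> //; exact: integrableZl.
have intU : (\int[P]_w U w <= (eps + k / 2 * V + (2 * k)^-1 * fine (P B))%:E)%E.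
  rewrite /U integralD//; [|by apply: integrableD => //; exact: integrableZl|exact: integrableZl].
  rewrite integralD//; last exact: integrableZl.
  rewrite !integralZl// integral_prob_cst integral_indic// setIT.
  rewrite 2!EFinD [((2 * k)^-1 * fine _)%:E]EFinM fineK ?fin_num_measure//.
  rewrite leeD2r// leeD2l// [leRHS]EFinM; apply: lee_wpmul2l => //.
  by rewrite lee_fin divr_ge0// ltW.
have eqX : (\int[P]_w (X w)%:E = \int[P]_w ((X w)%:E - (Y w)%:E))%E.
  by rewrite integralB//; move: EY0; rewrite unlock => ->; rewrite sube0.
have fX : (\int[P]_w (X w)%:E)%E \is a fin_num by exact: integrable_fin_num.
rewrite -lee_fin -abse_EFin fineK// {}eqX.
apply: le_trans (le_abse_integral _ _ _) _ => //.
  by apply: emeasurable_funB; [case/integrableP: iX|case/integrableP: iY].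
apply: le_trans _ intU; apply: ge0_le_integral => //.
- by apply: measurableT_comp => //; apply: emeasurable_funB; [case/integrableP: iX|case/integrableP: iY].
- by case/integrableP: iU.
move=> w _; rewrite /U /= lee_fin indicE distrC.
have k2 : 0 <= k / 2 * Y w ^+ 2 by rewrite mulr_ge0 ?sqr_ge0// divr_ge0// ltW.
have [Bw|Bw] := pselect (B w); last first.
  rewrite memNset// mulr0 addr0; apply: le_trans (XY _ Bw) _; lra.
rewrite mem_set// mulr1 XB// subr0.
have : 0 <= (k * `|Y w| - 1) ^+ 2 / (2 * k) by rewrite divr_ge0 ?sqr_ge0// mulr_ge0// ltW.
have : (Y w) ^+ 2 = `|Y w| ^+ 2 by rewrite real_normK ?num_real.
move=> ->; have -> : (k * `|Y w| - 1) ^+ 2 / (2 * k) = k / 2 * `|Y w| ^+ 2 - `|Y w| + (2 * k)^-1.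
  by field; rewrite gt_eqF.
lra.
Qed.

Lemma measurable_gt_level d (Om : measurableType d) (R : realType)
    (f : Om -> R) (c : R) :
  measurable_fun setT f -> measurable [set w | c < f w].
Proof.
move=> mf; have -> : [set w | c < f w] = setT `&` (fun w => c < f w) @^-1` [set true].
  by rewrite setTI.
by apply: measurable_fun_ltr => //; exact: measurable_cst.
Qed.

(** * Deviations of linear forms in independent noise *)

Lemma layer_sum (R : realType) (c : nat -> R) (m : nat) :
  c 0%N <= 1 -> (forall j, (0 < j)%N -> c j <= 2 * 4^-1 ^+ j) ->
  \sum_(j < m) c j <= 2.
Proof.
move=> c0 cj; case: m => [|m]; first by rewrite big_ord0.
suff : \sum_(j < m.+1) c j <= 5 / 3 - 8 / 3 * 4^-1 ^+ m.+1.
  have : (0 : R) <= 4^-1 ^+ m.+1 by rewrite exprn_ge0.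
  lra.
elim: m => [|m IH]; first by rewrite big_ord_recl big_ord0 addr0 expr1 /=; lra.
rewrite big_ord_recr /=; have := cj m.+1 isT; rewrite [4^-1 ^+ m.+2]exprS.
set x := 4^-1 ^+ m.+1 in IH *; lra.
Qed.

(** The walk with [N] steps [tau] reaches [6 * y] at the price of one factor 2
    per unit of gauge. *)
Definition walk_reaches (R : realType) (gam : R -> R) (N : nat) (tau : R) :=
  forall (G : R -> R) (y : R) (r : nat), even_convex G -> (r <= N)%N ->
    gam y <= r%:R -> G (6 * y) <= 2 ^+ r * walk (nseq N tau) G 0.

(** The exponential moment in [walk_dominates] is summed by layers of the gauge:
    tails [2 * 8^-j] against weights [2^j] leave a convergent geometric series. *)
Lemma cell_dominated d (Om : measurableType d) (R : realType)
    (P : probability Om R) (Y : {RV P >-> R}) (gam : R -> R) (N : nat) (tau : R)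
    (A : finType) (idx : R -> A) (val : A -> R) (f : R -> R) :
  gauge gam -> walk_reaches gam N tau ->
  (forall j : nat, (0 < j)%N ->
     (P [set w | (j%:R < gam (Y w))%R] <= (2 * 8^-1 ^+ j)%:E)%E) ->
  (forall a, measurable (idx @^-1` [set a])) ->
  (forall a, gam (val a) <= N%:R) ->
  (forall y, `|val (idx y)| <= `|y|) ->
  convexf f ->
  \sum_a cell_law P idx Y a * f (val a - \sum_b cell_law P idx Y b * val b) <=
  walk (nseq N tau) f 0.
Proof.
move=> gg reach tail mS gval vle cf.
have [mgam g0 mon bnd] := gg.
have lp := cell_law_fin Y mS; have [p0 p1] := lp.
have [r hr] := choice (fun a => @layer_ceil R N (gam (val a))
  (introT andP (conj (gauge_ge0 (val a) gg) (gval a)))).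
apply: (@walk_dominates R A _ _ r) => //.
  by move=> G cG a; have [rN gr _] := hr a; exact: reach.
pose q (j : nat) : R := \sum_a cell_law P idx Y a * ((j%:R : R) < gam (val a))%R%:R.
have qE : \sum_a cell_law P idx Y a * 2 ^+ r a <= 1 + \sum_(j < N) 2 ^+ j * q j.
  apply: (@le_trans _ _ (\sum_a cell_law P idx Y a * (1 + \sum_(j < N) 2 ^+ j * ((j%:R : R) < gam (val a))%R%:R))).
    by apply: ler_sum => a _; rewrite ler_wpM2l//; case: (hr a).
  under eq_bigr do rewrite mulrDr mulr1 mulr_sumr.
  rewrite big_split /= p1 lerD2l exchange_big /=; apply: le_of_eq.
  by apply: eq_bigr => j _; rewrite /q mulr_sumr; apply: eq_bigr => a _; rewrite mulrCA.
have q1 j : q j <= 1.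
  rewrite -p1; apply: ler_sum => a _; rewrite ler_piMr//.
  by case: (_ < _).
have q8 j : (0 < j)%N -> q j <= 2 * 8^-1 ^+ j.
  move=> j0; rewrite -lee_fin; apply: le_trans (tail j j0).
  apply: cell_law_le => // [|w /= h].
    have mgY : measurable_fun setT (fun w => gam (Y w)) by exact: measurableT_comp.
    exact: measurable_gt_level.
  by apply: lt_le_trans h _; apply: mon.
suff : \sum_(j < N) 2 ^+ j * q j <= 2 by lra.
apply: (layer_sum (c := fun j => 2 ^+ j * q j)) => [|j j0].
  by rewrite expr0 mul1r.
have h : (0 : R) <= 2 ^+ j by rewrite exprn_ge0.
apply: le_trans (ler_wpM2l h (q8 j j0)) _.
rewrite mulrCA -exprMn; have -> : 2 * 8^-1 = 4^-1 :> R by field.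
by [].
Qed.

Section NoiseTail.
Context (R : realType) (d : measure_display) (Om : measurableType d)
  (P : probability Om R) (n : nat) (Y : 'I_n -> {RV P >-> R}) (gam : R -> R)
  (N : nat) (tau V : R).
Hypotheses (n0 : (0 < n)%N) (N0 : (0 < N)%N) (gg : gauge gam)
  (reach : walk_reaches gam N tau) (ind : mutually_independent Y)
  (tail : forall i (j : nat), (0 < j)%N ->
     (P [set w | (j%:R < gam (Y i w))%R] <= (2 * 8^-1 ^+ j)%:E)%E)
  (EY0 : forall i, ('E_P[Y i] = 0)%E)
  (EY2 : forall i, (\int[P]_w ((Y i w) ^+ 2)%:E <= V%:E)%E)
  (nN : n%:R <= 8 ^+ N :> R) (tau0 : 0 < tau).

(** The class is evaluated at the quantized noise, where [finite_tail] applies.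
    Truncation and rounding are repaid afterwards: they move the centered value
    of each coordinate by at most [(V + 3) / sqrt n], and [rademacher_norm]
    turns this into a multiple of [rho]. The exceptional event is a finite union
    of cells and of truncation failures, hence measurable whatever the class is. *)
Lemma noise_tail (rho : R) (Th : Type) (D : set Th) (g : Th -> 'I_n -> R) :
  0 < rho -> rademacher_le D g rho ->
  exists Bad : set Om, [/\ measurable Bad,
    (P Bad <= (expR (- N%:R) + n%:R * (2 * 8^-1 ^+ N))%:E)%E &
    forall w, ~ Bad w -> (forall i, gam (Y i w) <= N%:R) /\
      forall th, D th ->
      dotp (g th) (fun i => Y i w) <= (48 * N%:R * tau + 8 * (V + 4)) * rho].
Proof.
move=> rho0 hrho.
have [mgam g0 mon bnd] := gg.
(* Grid size: rounding errors of order [1 / sqrt n] cost as much as the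
   Euclidean norm of the form. *)
pose k : R := (Num.sqrt n%:R)^-1.
have sn0 : 0 < Num.sqrt n%:R :> R by rewrite sqrtr_gt0 ltr0n.
have k0 : 0 < k by rewrite invr_gt0.
have k2 : k ^+ 2 = n%:R^-1 by rewrite exprVn sqr_sqrtr.
have [A [idx [val [mS gval vle vnear vfar]]]] := quantizer N gg k0.
pose p i := cell_law P idx (Y i).
have lp i : fin_law (p i) by exact: cell_law_fin.
pose m i := \sum_b p i b * val b.
pose x (c : {ffun 'I_n -> A}) i := val (c i) - m i.
pose y := 48 * N%:R * tau * rho.
pose bad (c : {ffun 'I_n -> A}) := `[< exists2 th, D th & y < dotp (g th) (x c) >].
pose cell (c : {ffun 'I_n -> A}) : set Om :=
  \bigcap_(i in [set` [set: 'I_n]%SET]) (Y i @^-1` (idx @^-1` [set (c i)])).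
pose far i := [set w | N%:R < gam (Y i w)].
have mgY i : measurable_fun setT (fun w => gam (Y i w)) by exact: measurableT_comp.
have mfar i : measurable (far i).
  exact: measurable_gt_level.
have mYS i a : measurable (Y i @^-1` (idx @^-1` [set a])).
  by rewrite -[X in measurable X]setTI; exact: measurable_funP.
have mcell c : measurable (cell c).
  by apply: fin_bigcap_measurable => // i _; exact: mYS.
pose Bad1 : set Om := \big[setU/set0]_(c <- [seq c <- index_enum {ffun 'I_n -> A} | bad c]) cell c.
pose Bad2 : set Om := \big[setU/set0]_(i <- index_enum 'I_n) far i.
exists (Bad1 `|` Bad2).
have mB1 : measurable Bad1 by exact: bigsetU_measurable.
have mB2 : measurable Bad2 by exact: bigsetU_measurable.
have PB1 : (P Bad1 <= (expR (- N%:R))%:E)%E.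
  apply: le_trans (le_measure_bigU _ _ mcell) _.
  rewrite big_filter.
  have Pc c : (P (cell c) = (\prod_i p i (c i))%:E)%E.
    rewrite (@ind [set: 'I_n]%SET (fun i => idx @^-1` [set c i]))//.
    rewrite -prodEFin; apply: eq_big => [i|i _]; first by rewrite finset.in_setT.
    by rewrite /p /cell_law fineK// fin_num_measure.
  under eq_bigr do rewrite Pc.
  rewrite sumEFin lee_fin.
  have dom i f : convexf f -> \sum_a p i a * f (val a - \sum_b p i b * val b) <=
      walk (nseq N tau) f 0.
    by move=> cf; apply: (@cell_dominated _ _ _ _ _ gam) => //; exact: tail.
  apply: le_trans (finite_tail (v := fun _ => val) lp dom tau0 rho0 hrho).
  rewrite /pexp big_mkcond /=; apply: le_of_eq.
  apply: eq_bigr => c _; rewrite -/(x c) -/(bad c).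
  by case: (bad c); rewrite ?mulr1 ?mulr0.
have PB2 : (P Bad2 <= (n%:R * (2 * 8^-1 ^+ N))%:E)%E.
  apply: le_trans (le_measure_bigU _ _ mfar) _.
  apply: (@le_trans _ _ (\sum_(i < n) (2 * 8^-1 ^+ N)%:E)%E).
    by apply: lee_sum => i _; exact: tail.
  by rewrite sumEFin lee_fin sumr_const card_ord -[leLHS]mulr_natl.
split.
- exact: measurableU.
- apply: (@le_trans _ _ (P Bad1 + P Bad2)%E); first exact: measureU2.
  by rewrite EFinD; exact: leeD.
move=> w nBad.
have near i : gam (Y i w) <= N%:R.
  rewrite leNgt; apply/negP => h; apply: nBad; right.
  by rewrite /Bad2 (bigD1_seq i) ?mem_index_enum ?index_enum_uniq//=; left.
split=> // th Dth.
pose c : {ffun 'I_n -> A} := [ffun i => idx (Y i w)].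
have nbad : ~~ bad c.
  apply/negP => h; apply: nBad; left.
  rewrite /Bad1 (bigD1_seq c) ?filter_uniq ?index_enum_uniq//=; last first.
    by rewrite mem_filter h mem_index_enum.
  by left => i _ /=; rewrite /c ffunE.
have lin : dotp (g th) (x c) <= y.
  rewrite leNgt; apply/negP => h; move/negP: nbad; apply; apply/asboolP.
  by exists th.
have V0 : 0 <= V.
  rewrite -lee_fin; apply: le_trans (EY2 (Ordinal n0)).
  by apply: integral_ge0 => ? _; rewrite lee_fin sqr_ge0.
have bias i : `|m i| <= (V + 2) * k.
  have [iX mE] := integral_cell (Y i) val mS.
  have -> : m i = fine (\int[P]_w (val (idx (Y i w)))%:E)%E by rewrite mE.
  apply: le_trans (approx_mean (B := far i) iX _ (ltW k0) k0 (EY0 i) (EY2 i) _ _) _ => //.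
  - by move=> w' /= /negP; rewrite -leNgt => h; exact: vnear.
  - by move=> w' /= h; exact: vfar.
  have : fine (P (far i)) <= 2 * 8^-1 ^+ N.
    by rewrite -lee_fin fineK ?fin_num_measure//; exact: tail.
  have e8 : (8 : R)^-1 ^+ N <= k ^+ 2.
    by rewrite k2 exprVn lef_pV2 ?posrE ?exprn_gt0 ?ltr0n.
  move=> h; have kk : (2 * k)^-1 * fine (P (far i)) <= k.
    rewrite ler_pdivrMl ?mulr_gt0//; apply: le_trans h _.
    have -> : 2 * k * k = 2 * k ^+ 2 by ring.
    by rewrite ler_pM2l.
  nra.
have -> : dotp (g th) (fun i => Y i w) =
    dotp (g th) (x c) + \sum_i g th i * (Y i w - val (idx (Y i w)) + m i).
  rewrite -big_split; apply: eq_bigr => i _ /=.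
  by rewrite /x /c ffunE; ring.
have L0 : 0 < 8 * rho by rewrite mulr_gt0.
have gL := rademacher_norm hrho Dth.
have rem : \sum_i g th i * (Y i w - val (idx (Y i w)) + m i) <= 8 * (V + 4) * rho.
  have pt i : g th i * (Y i w - val (idx (Y i w)) + m i) <=
     (V + 3) / 2 * (g th i ^+ 2 / (8 * rho) + 8 * rho * k ^+ 2).
    have z : `|Y i w - val (idx (Y i w)) + m i| <= (V + 3) * k.
      apply: le_trans (ler_normD _ _) _; have := vnear _ (near i); have := bias i; lra.
    apply: (@le_trans _ _ (`|g th i| * ((V + 3) * k))).
      by apply: le_trans (ler_norm _) _; rewrite normrM ler_wpM2l.
    have : 0 <= (V + 3) / 2 * ((`|g th i| - 8 * rho * k) ^+ 2 / (8 * rho)).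
      by rewrite mulr_ge0 ?divr_ge0 ?sqr_ge0 ?(ltW L0)//; lra.
    have -> : g th i ^+ 2 = `|g th i| ^+ 2 by rewrite real_normK ?num_real.
    rewrite -subr_ge0 => h; rewrite -subr_ge0.
    have -> : (V + 3) / 2 * (`|g th i| ^+ 2 / (8 * rho) + 8 * rho * k ^+ 2) - `|g th i| * ((V + 3) * k)
      = (V + 3) / 2 * ((`|g th i| - 8 * rho * k) ^+ 2 / (8 * rho)) - 0.
      by field; rewrite gt_eqF.
    by [].
  apply: le_trans (ler_sum _ (fun i _ => pt i)) _.
  rewrite -mulr_sumr big_split /= -mulr_suml sumr_const card_ord.
  have -> : (8 * rho * k ^+ 2) *+ n = 8 * rho.
    by rewrite k2 -mulr_natr -mulrA mulVf ?mulr1// pnatr_eq0 -lt0n.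
  have : (\sum_i g th i ^+ 2) / (8 * rho) <= 8 * rho.
    by rewrite ler_pdivrMr// -expr2.
  nra.
rewrite mulrDl; apply: lerD => //.
Qed.

(** A class with Rademacher average 0 vanishes on the sample, by
    [rademacher_norm]. *)
Lemma noise_tail_ge0 (rho : R) (Th : Type) (D : set Th) (g : Th -> 'I_n -> R) :
  0 <= rho -> rademacher_le D g rho ->
  exists Bad : set Om, [/\ measurable Bad,
    (P Bad <= (expR (- N%:R) + n%:R * (2 * 8^-1 ^+ N))%:E)%E &
    forall w, ~ Bad w -> (forall i, gam (Y i w) <= N%:R) /\
      forall th, D th ->
      dotp (g th) (fun i => Y i w) <= (48 * N%:R * tau + 8 * (V + 4)) * rho].
Proof.
rewrite le_eqVlt => /predU1P[<-|rho0]; last exact: noise_tail.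
move=> hrho.
have r1 : rademacher_le (set0 : set unit) (fun _ (_ : 'I_n) => 0 : R) 1.
  move=> T t _; rewrite [leLHS](_ : _ = 0) ?ler01//.
  rewrite -[RHS](cexp_cst 'I_n 0); apply: eq_pexp => e; apply/eqP.
  rewrite eq_le smax_ge0 andbT; apply: smax_le => // j.
  by rewrite /dotp big1// => i _; exact: mul0r.
have [Bad [mB PB hB]] := noise_tail ltr01 r1.
exists Bad; split=> // w nB; have [hg _] := hB w nB; split=> // th Dth.
have := rademacher_norm hrho Dth; rewrite mulr0 expr0n /= => g0.
rewrite mulr0 /dotp big1// => i _.
have : g th i ^+ 2 <= 0.
  apply: le_trans g0; rewrite (bigD1 i)//= lerDl; apply: sumr_ge0 => j _.
  exact: sqr_ge0.
move=> h; have : g th i ^+ 2 == 0 by rewrite eq_le h sqr_ge0.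
by rewrite sqrf_eq0 => /eqP ->; rewrite mul0r.
Qed.

End NoiseTail.

(** * The standard normal law and sign patterns *)

(** The supremum in a Gaussian complexity ranges over an arbitrary class, so
    that its integral is accessible through the simple functions below it only. *)
Lemma ge0_le_integralT d (Om : measurableType d) (R : realType)
    (mu : {measure set Om -> \bar R}) (f g : Om -> \bar R) :
  (forall x, 0 <= f x)%E -> (forall x, f x <= g x)%E ->
  (\int[mu]_x f x <= \int[mu]_x g x)%E.
Proof.
move=> f0 fg; rewrite !ge0_integralTE//; last first.
  by move=> x; apply: le_trans (fg x).
apply: le_ereal_sup => _ [h /= hf <-]; exists h => // x.
exact: le_trans (hf x) (fg x).
Qed.

Import HBNNSimple.

(** The variable [f (z)] restricted to [B] is [f] of the product of [z] with the
    indicator of [B], since [f 0 = 0]; so independence of [z] and [B] factors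
    the integral through a single image measure. *)
Lemma integral_indep_restrict d (Om : measurableType d) (R : realType)
    (P : probability Om R) (z : {RV P >-> R}) (B : set Om)
    (nu : {measure set R -> \bar R}) (p : R) (f : R -> R) :
  measurable B -> 0 <= p -> measurable_fun setT f ->
  (forall x, 0 <= f x) -> f 0 = 0 ->
  (forall A : set R, measurable A -> (P (B `&` z @^-1` A) = p%:E * nu A)%E) ->
  (\int[P]_w (f (z w) * \1_B w)%:E = p%:E * \int[nu]_x (f x)%:E)%E.
Proof.
move=> mB p0 mf f0 f00 ind.
pose z' w := z w * \1_B w.
have mz' : measurable_fun setT z' by apply: measurable_funM => //; exact: measurable_indic.
pose D : set R := [set~ 0].
have mD : measurable D by exact: measurableC.
have red (mu : {measure set R -> \bar R}) :
    (\int[mu]_x (f x)%:E = \int[mu]_(x in D) (f x)%:E)%E.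
  rewrite [RHS]integral_mkcond; apply: eq_integral => x _.
  rewrite patchE; case: ifPn => // /negP xD.
  have -> : x = 0; last by rewrite f00.
  by apply: contrapT => x0; apply: xD; rewrite inE.
have -> : (\int[P]_w (f (z w) * \1_B w)%:E = \int[P]_w (f (z' w))%:E)%E.
  apply: eq_integral => w _; rewrite /z' indicE.
  by case: (w \in B); rewrite ?mulr1// !mulr0 f00.
pose z'm : {mfun Om >-> R} := mfun_Sub (mem_set mz').
have mfE : measurable_fun setT (fun x : R => (f x)%:E).
  exact/measurable_EFinP.
have -> : (\int[P]_w (f (z' w))%:E = \int[pushforward P z'm]_x (f x)%:E)%E.
  rewrite ge0_integral_pushforward//=.
  by move=> x _; rewrite lee_fin.
have r1 := red (pushforward P z'm); have r2 := red nu; rewrite r1 r2.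
have -> : (p%:E * \int[nu]_(x in D) (f x)%:E = \int[mscale (NngNum p0) nu]_(x in D) (f x)%:E)%E.
  rewrite ge0_integral_mscale//; last by move=> x _; rewrite lee_fin.
  exact: measurable_funTS.
apply: eq_measure_integral => A mA AD.
transitivity (p%:E * nu A)%E => //; rewrite -ind// /pushforward; congr (P _).
apply/seteqP; split => w /=.
  rewrite /z' indicE; have [wB|wB] := boolP (w \in B).
    by rewrite mulr1 => ?; split => //; exact: set_mem.
  by rewrite mulr0 => /AD h; exfalso; exact: h.
by move=> [Bw zA]; rewrite /z' indicE mem_set// mulr1.
Qed.

Definition std_normal_law (R : realType) (nu : {measure set R -> \bar R}) : Prop :=
  forall A : set R, measurable A -> nu A = normal_prob 0 1 A.

Lemma normal_prob_opp (R : realType) (A : set R) : measurable A ->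
  normal_prob 0 1 (-%R @^-1` A) = normal_prob 0 1 A :> \bar R.
Proof.
move=> mA; rewrite /normal_prob.
have mp : measurable_fun A (fun x : R => (normal_pdf 0 1 x)%:E).
  by apply: measurable_funTS; apply/measurable_EFinP; exact: measurable_normal_pdf.
transitivity (\int[pushforward lebesgue_measure (-%R : R -> measurableTypeR R)]_(x in A)
   (normal_pdf 0 1 x)%:E)%E.
  rewrite ge0_integral_pushforward//=; last first.
    by move=> x _; rewrite lee_fin normal_pdf_ge0.
  apply: eq_integral => x _; rewrite /= /normal_pdf !oner_eq0 /normal_fun.
  by rewrite !subr0 sqrrN.
by apply: eq_measure_integral => B mB _; exact: lebesgue_measureN.
Qed.

(** The integral on the left is a supremum over simple functions, for which the
    density formula holds level set by level set. *)
Lemma std_normal_integral_le (R : realType) (nu : {measure set R -> \bar R})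
    (f : R -> R) :
  std_normal_law nu -> (forall x, 0 <= f x) ->
  (\int[nu]_x (f x)%:E <=
   \int[lebesgue_measure]_x (f x * normal_pdf 0 1 x)%:E)%E.
Proof.
move=> hnu f0; rewrite ge0_integralTE; last by move=> x; rewrite lee_fin.
apply: ge_ereal_sup => _ [h /= hf <-].
have mp : measurable_fun setT (fun x : R => (normal_pdf 0 1 x)%:E).
  by apply/measurable_EFinP; exact: measurable_normal_pdf.
have -> : sintegral nu h =
    (\int[lebesgue_measure]_x (h x * normal_pdf 0 1 x)%:E)%E; last first.
  apply: ge0_le_integralT => x; rewrite lee_fin ?mulr_ge0 ?normal_pdf_ge0//.
  by rewrite ler_wpM2r ?normal_pdf_ge0// -lee_fin.
rewrite sintegralE.
transitivity (\sum_(y \in range h) \int[lebesgue_measure]_x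
    (y * \1_(h @^-1` [set y]) x * normal_pdf 0 1 x)%:E)%E.
  apply: eq_fsbigr => y /set_mem [x0 _ hy].
  have y0 : 0 <= y by rewrite -hy.
  have mh : measurable (h @^-1` [set y]) by [].
  rewrite hnu// /normal_prob integral_mkcond -ge0_integralZl//; last first.
  - by move=> x _; rewrite erestrict_ge0// => z _; rewrite lee_fin normal_pdf_ge0.
  - by apply/(measurable_restrictT _ _).1 => //; apply: measurable_funTS.
  apply: eq_integral => x _; rewrite patchE indicE.
  by case: (x \in _); rewrite ?mulr1 ?mulr0 ?mul0r ?mule0 ?EFinM.
have mI (y : R) : measurable (h @^-1` [set y]) by [].
rewrite -ge0_integral_fsum//; last 2 first.
- move=> y; apply/measurable_EFinP; apply: measurable_funM; last exact: measurable_normal_pdf.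
  apply: measurable_funM; [exact: measurable_cst|apply: measurable_indic].
  exact: mI.
- move=> y x _; rewrite lee_fin mulr_ge0 ?normal_pdf_ge0// indicE.
  have [/set_mem /= <-|_] := boolP (x \in _); last by rewrite mulr0.
  by rewrite mulr1.
apply: eq_integral => x _.
rewrite (fsbigD1 (h x))//=; last by exists x.
rewrite fsbig1 => [|y /= [_ yh]]; last first.
  by rewrite indicE memNset ?mulr0 ?mul0r// => /= /esym.
by rewrite adde0 indicE mem_set ?mulr1.
Qed.

(** By symmetry, since the point 0 has measure zero. *)
Lemma std_normal_half (R : realType) (nu : {measure set R -> \bar R}) :
  std_normal_law nu ->
  nu [set x | 0 <= x] = (2^-1)%:E /\ nu [set x | x < 0] = (2^-1)%:E.
Proof.
move=> hnu.
have m1 : measurable [set x : R | 0 <= x] by rewrite -set_itvcy.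
have m2 : measurable [set x : R | x < 0] by rewrite -set_itvNyo.
have m3 : measurable [set x : R | x <= 0] by rewrite -set_itvNyc.
have nT : (nu setT = 1)%E by rewrite hnu// /normal_prob integral_normal_pdf.
have n0 : (nu [set 0%R] = 0)%E.
  rewrite hnu// /normal_prob; apply: null_set_integral => //=; last first.
    by rewrite lebesgue_measure_set1.
  by apply: measurable_funTS; apply/measurable_EFinP; exact: measurable_normal_pdf.
have e1 : nu [set x | 0 <= x] = nu [set x | x < 0].
  rewrite hnu// -normal_prob_opp// -hnu//; last first.
    by rewrite (_ : _ @^-1` _ = [set x | x <= 0])//; apply/seteqP; split => x /=; rewrite oppr_ge0.
  have -> : -%R @^-1` [set x | 0 <= x] = [set x | x < 0] `|` [set 0 : R].
    apply/seteqP; split => x /=; rewrite oppr_ge0.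
      by rewrite le_eqVlt => /predU1P[->|]; [right|left].
    by case=> [/ltW|->].
  rewrite measureU//; last first.
    by apply/seteqP; split => x //= [] /[swap] ->; rewrite ltxx.
  by rewrite -[RHS]adde0; congr (_ + _)%E; exact: n0.
have e2 : (nu [set x | 0 <= x]%R + nu [set x | x < 0]%R = 1)%E.
  rewrite -nT -measureU//.
    by congr (nu _); apply/seteqP; split => x //= _; case: (leP 0 x); [left|right].
  by apply/seteqP; split => x //= []; rewrite leNgt => /negP.
have : nu [set x | x < 0] \is a fin_num.
  rewrite ge0_fin_numE//; apply: (@le_lt_trans _ _ 1%E); last by rewrite ltry.
  by rewrite -e2 leeDr.
move: e2; rewrite e1; case: (nu _) => [r| |] //; rewrite -EFinD => -[h] _.
by have -> : r = 2^-1 by lra.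
Qed.

Lemma std_normal_opp_integral (R : realType) (nu : {measure set R -> \bar R}) :
  std_normal_law nu ->
  (\int[nu]_x (Num.max (- x) 0)%:E = \int[nu]_x (Num.max x 0)%:E)%E.
Proof.
move=> hnu.
have mm : measurable_fun setT (fun x : R => (Num.max x 0)%:E).
  by apply/measurable_EFinP; exact: measurable_maxr.
transitivity (\int[pushforward nu (-%R : R -> R)]_x (Num.max x 0)%:E)%E.
  rewrite [RHS]ge0_integral_pushforward//=.
  by move=> x _; rewrite lee_fin le_max lexx orbT.
apply: eq_measure_integral => A mA _; rewrite /pushforward.
have mA' : measurable (-%R @^-1` A) by rewrite -[X in measurable X]setTI; exact: oppr_measurable.
by transitivity (normal_prob 0 1 (-%R @^-1` A) : \bar R); [exact: hnu|rewrite normal_prob_opp// hnu].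
Qed.

(** The tail factor [|x| * expR (- x ^ 2 / 4)] is bounded by 1, which leaves the
    density of a centered normal law of variance 2. *)
Lemma std_normal_abs_fin (R : realType) (nu : {measure set R -> \bar R}) :
  std_normal_law nu -> (\int[nu]_x `|x|%:E < +oo)%E.
Proof.
move=> hnu; apply: le_lt_trans (std_normal_integral_le hnu (fun x => normr_ge0 x)) _.
have s2 : Num.sqrt 2 != 0 :> R by rewrite sqrtr_eq0 -ltNge.
have p2 : 0 < normal_peak (Num.sqrt 2 : R) by exact: normal_peak_gt0.
pose k : R := normal_peak 1 / normal_peak (Num.sqrt 2).
have k0 : 0 <= k by rewrite divr_ge0 ?normal_peak_ge0.
have mp : measurable_fun setT (fun x : R => (normal_pdf 0 (Num.sqrt 2) x)%:E).
  by apply/measurable_EFinP; exact: measurable_normal_pdf.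
apply: (@le_lt_trans _ _ (\int[lebesgue_measure]_x (k%:E * (normal_pdf 0 (Num.sqrt 2) x)%:E))%E).
  apply: ge0_le_integralT => x; rewrite ?lee_fin ?mulr_ge0 ?normal_pdf_ge0//.
  rewrite /normal_pdf (negbTE s2) oner_eq0 /normal_fun !subr0 expr1n sqr_sqrtr//.
  have -> : k * (normal_peak (Num.sqrt 2) * expR (- x ^+ 2 / (2 *+ 2))) =
     normal_peak 1 * expR (- x ^+ 2 / (2 *+ 2)).
    by rewrite /k mulrA divfK// gt_eqF.
  rewrite mulrCA ler_wpM2l ?normal_peak_ge0//.
  have -> : expR (- x ^+ 2 / (1 *+ 2)) = expR (- x ^+ 2 / (2 *+ 2)) * expR (- x ^+ 2 / (2 *+ 2)) :> R.
    by rewrite -expRD; congr expR; rewrite !mulr2n; field.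
  rewrite mulrA ger_pMl ?expR_gt0//.
  have -> : - x ^+ 2 / (2 *+ 2) = - (x ^+ 2 / 4) by rewrite mulr2n; field.
  rewrite expRN ler_pdivrMr ?expR_gt0// mul1r; apply: le_trans (expR_ge1Dx _).
  have := sqr_ge0 (`|x| / 2 - 1); have : x ^+ 2 = `|x| ^+ 2 by rewrite real_normK ?num_real.
  move=> ->; have -> : (`|x| / 2 - 1) ^+ 2 = `|x| ^+ 2 / 4 - `|x| + 1 by field.
  by lra.
rewrite ge0_integralZl//; last by move=> x _; rewrite lee_fin normal_pdf_ge0.
by rewrite integral_normal_pdf mule1 ltry.
Qed.

(** On [1, 2] the integrand is at least 1 and the density at least its value at
    2. *)
Lemma std_normal_pos_ge (R : realType) (nu : {measure set R -> \bar R}) :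
  std_normal_law nu -> ((normal_pdf 0 1 2 : R)%:E <= \int[nu]_x (Num.max x 0)%:E)%E.
Proof.
move=> hnu.
pose A : set R := `[1, 2]%classic.
have mA : measurable A by exact: measurable_itv.
apply: (@le_trans _ _ (nu A)); last first.
  have -> : nu A = (\int[nu]_x (\1_A x)%:E)%E by rewrite integral_indic// setIT.
  apply: ge0_le_integralT => x; rewrite lee_fin// indicE.
  case: (boolP (x \in A)) => [|_]; last by rewrite le_max lexx orbT.
  by rewrite inE /A /= in_itv /= => /andP[x1 _]; rewrite le_max x1.
rewrite hnu// /normal_prob.
apply: (@le_trans _ _ (\int[lebesgue_measure]_(x in A) (normal_pdf 0 1 2)%:E)%E).
  have l1 : (lebesgue_measure A = 1)%E.
    by rewrite /A lebesgue_measure_itv /= lte_fin ltr1n -EFinD; congr EFin; lra.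
  by rewrite integral_cst// [X in (_ * X)%E]l1 mule1.
apply: ge0_le_integral => //.
- by move=> x _; rewrite lee_fin normal_pdf_ge0.
- by apply: measurable_funTS; apply/measurable_EFinP; exact: measurable_normal_pdf.
move=> x; rewrite /A /= in_itv /= => /andP[x1 x2].
rewrite lee_fin /normal_pdf oner_eq0 ler_wpM2l ?normal_peak_ge0// /normal_fun.
rewrite ler_expR !subr0 ler_wpM2r ?invr_ge0 ?mulrn_wge0// lerN2 ler_sqr ?nnegrE//; lra.
Qed.

Definition half_line (R : realType) (b : bool) : set R :=
  [set x | (0 <= x) = b].
Arguments half_line R b : clear implicits.

Lemma half_lineE (R : realType) (b : bool) :
  half_line R b = if b then [set x | 0 <= x] else [set x | x < 0].
Proof.
apply/seteqP; split => x; case: b; rewrite /half_line /=; case: (leP 0 x) => //.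
Qed.

Lemma measurable_half_line (R : realType) b : measurable (half_line R b).
Proof.
rewrite half_lineE; case: b.
  by rewrite -set_itvcy; exact: measurable_itv.
by rewrite -set_itvNyo; exact: measurable_itv.
Qed.

Definition sign_pattern (R : realType) (n : nat) (Om : Type)
    (z : 'I_n -> Om -> R) (w : Om) : {ffun 'I_n -> bool} :=
  [ffun i => 0 <= z i w].

Lemma iid_distribution (R : realType) d (Om : measurableType d)
    (P : probability Om R) (n : nat) (z : 'I_n -> {RV P >-> R}) i :
  iid_std_normal z -> std_normal_law (distribution P (z i)).
Proof. by move=> [_ hz] A mA; exact: hz. Qed.

(** By independence the other coordinates contribute the probability [2^-(n-1)]
    of their signs, and by symmetry the two half-line integrals agree: given the
    pattern, the mean of each coordinate is its sign times one constant. *)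
Lemma integral_sign_pattern (R : realType) d (Om : measurableType d)
    (P : probability Om R) (n : nat) (z : 'I_n -> {RV P >-> R})
    (nu : {measure set R -> \bar R}) (e : {ffun 'I_n -> bool}) i (k0 : R) :
  iid_std_normal z -> std_normal_law nu ->
  (\int[nu]_x (Num.max x 0)%:E = k0%:E)%E ->
  let u := fun w => z i w * \1_[set w | sign_pattern z w = e] w in
  P.-integrable setT (fun w => (u w)%:E) /\
  (\int[P]_w (u w)%:E = (sgn R (e i) * (2^-1 ^+ n.-1 * k0))%:E)%E.
Proof.
move=> iz hnu hk u.
have law j := iid_distribution j iz.
pose C j := z j @^-1` half_line R (e j).
have mC j : measurable (C j).
  by rewrite -[C j]setTI; apply: measurable_funP => //; exact: measurable_half_line.
pose B : set Om := \bigcap_(j in [set` [set~ i]%SET]) C j.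
have mB : measurable B by apply: fin_bigcap_measurable => // j _; exact: mC.
have PC j : (P (C j) = (2^-1)%:E)%E.
  have [h1 h2] := std_normal_half (law j).
  by rewrite /C half_lineE; case: (e j).
have SE w : sign_pattern z w = e <-> B w /\ C i w.
  split=> [h|[hB hC]].
    have hj j : C j w by rewrite /C /half_line /= -h ffunE.
    by split => // j _.
  apply/ffunP => j; rewrite ffunE; have [->|ji] := eqVneq j i; first exact: hC.
  by apply: (hB j); rewrite /= finset.in_setC1.
have p0 : (0 : R) <= 2^-1 ^+ n.-1 by rewrite exprn_ge0.
have ind (A : set R) : measurable A ->
    (P (B `&` z i @^-1` A) = (2^-1 ^+ n.-1)%:E * nu A)%E.
  move=> mA; have [hind _] := iz.
  pose D j := if j == i then A else half_line R (e j).
  have mD j : measurable (D j) by rewrite /D; case: ifP => // _; exact: measurable_half_line.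
  have -> : B `&` z i @^-1` A = \bigcap_(j in [set` [set: 'I_n]%SET]) (z j @^-1` D j).
    apply/seteqP; split => w /=.
      move=> [hB hA] j _; rewrite /D /=; case: eqVneq => [->|ji] //.
      by apply: (hB j); rewrite /= finset.in_setC1.
    move=> h; split=> [j|].
      rewrite /= finset.in_setC1 => ji; have := h j; rewrite /D (negbTE ji); apply.
      by rewrite /= finset.in_setT.
    by have := h i; rewrite /D eqxx; apply; rewrite /= finset.in_setT.
  rewrite hind// (bigD1 i) ?finset.in_setT//= {1}/D eqxx muleC.
  congr (_ * _)%E; last by rewrite hnu// -(law i A mA).
  rewrite (eq_bigr (fun=> (2^-1 : R)%:E)) => [|j /andP[_ /negbTE ji]]; last first.
    by rewrite /D ji; exact: PC.
  rewrite prodEFin (eq_bigl (fun j => j != i)) => [|j]; last by rewrite finset.in_setT.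
  by rewrite prodr_const cardC1 card_ord.
have mmax : measurable_fun setT (fun x : R => Num.max x 0) by exact: measurable_maxr.
have mmaxN : measurable_fun setT (fun x : R => Num.max (- x) 0).
  by apply: measurable_maxr => //; exact: oppr_measurable.
have max0 x : 0 <= Num.max x 0 :> R by rewrite le_max lexx orbT.
have m00 : Num.max 0 0 = 0 :> R by rewrite maxxx.
have m00' : Num.max (- 0) 0 = 0 :> R by rewrite oppr0 maxxx.
have I1 := integral_indep_restrict mB p0 mmax max0 m00 ind.
have I2 := integral_indep_restrict mB p0 mmaxN (fun x => max0 (- x)) m00' ind.
rewrite std_normal_opp_integral// in I2; rewrite hk in I1 I2.
have fin_int (v : Om -> R) c : measurable_fun setT v -> (forall w, 0 <= v w) ->
    (\int[P]_w (v w)%:E = c%:E)%E -> P.-integrable setT (fun w => (v w)%:E).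
  move=> mv v0 hv; apply/integrableP; split; first exact/measurable_EFinP.
  by under eq_integral => w _ do rewrite gee0_abs ?lee_fin//; rewrite hv ltry.
have mi : measurable_fun setT (\1_B : Om -> R) by exact: measurable_indic.
have ind0 w : 0 <= \1_B w :> R by [].
have mz : measurable_fun setT (z i) by [].
have mzp : measurable_fun setT (fun w => Num.max (z i w) 0).
  exact: (measurableT_comp mmax mz).
have mzn : measurable_fun setT (fun w => Num.max (- z i w) 0).
  exact: (measurableT_comp mmaxN mz).
case ei : (e i); rewrite /sgn /=.
  have -> : u = fun w => Num.max (z i w) 0 * \1_B w.
    apply/funext => w; rewrite /u !indicE.
    have [Bw|Bw] := pselect (B w); last first.
      by rewrite [w \in B]memNset// memNset ?mulr0// => /SE [].
    rewrite [w \in B]mem_set//.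
    have [zw|zw] := leP 0 (z i w).
      by rewrite mem_set ?mulr1//; apply/SE; split => //; rewrite /C /half_line /= ei zw.
    rewrite memNset ?mulr0 ?mul0r// => /SE [_]; rewrite /C /half_line /= ei.
    by rewrite leNgt zw.
  rewrite mul1r I1; split; last by rewrite EFinM.
  apply: (fin_int _ (2^-1 ^+ n.-1 * k0)); last by rewrite I1 EFinM.
    exact: measurable_funM.
  by move=> w; rewrite mulr_ge0.
have -> : u = fun w => - (Num.max (- z i w) 0 * \1_B w).
  apply/funext => w; rewrite /u !indicE.
  have [Bw|Bw] := pselect (B w); last first.
    by rewrite [w \in B]memNset// memNset ?mulr0 ?oppr0// => /SE [].
  rewrite [w \in B]mem_set//.
  have [zw|zw] := leP 0 (z i w).
    rewrite (max_idPr _) ?oppr_le0// mul0r oppr0 memNset ?mulr0// => /SE [_].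
    by rewrite /C /half_line /= ei zw.
  rewrite mem_set; last by apply/SE; split => //; rewrite /C /half_line /= ei leNgt zw.
  by rewrite (max_idPl _) ?oppr_ge0 ?(ltW zw)// !mulr1 opprK.
have int2 : P.-integrable setT (fun w => (Num.max (- z i w) 0 * \1_B w)%:E).
  apply: (fin_int _ (2^-1 ^+ n.-1 * k0)); last by rewrite I2 EFinM.
    exact: measurable_funM.
  by move=> w; rewrite mulr_ge0.
under eq_integral do rewrite EFinN.
split; first by under eq_fun do rewrite EFinN; exact: integrableN.
by rewrite integralN ?I2 ?EFinN -?EFinM ?mulN1r//; exact: integrable_add_def.
Qed.

(** * Gaussian complexity and Rademacher averages *)

Definition ball2 (R : realType) (XX : Type) (n : nat) (X : 'I_n -> XX)
    (H : set (XX -> R)) (t : R) : set (XX -> R) :=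
  [set h | H h /\ avg (fun i => h (X i) ^+ 2) <= t ^+ 2].

Definition gauss_sup (R : realType) (Om : Type) (XX : Type) (n : nat)
    (X : 'I_n -> XX) (z : 'I_n -> Om -> R) (H : set (XX -> R)) (t : R)
    (w : Om) : \bar R :=
  ereal_sup [set (avg (fun i => h (X i) * z i w))%:E | h in ball2 X H t].

Lemma avg0 (R : realType) n : avg (fun _ : 'I_n => 0 : R) = 0.
Proof. by rewrite /avg big1 ?mulr0. Qed.

Lemma ball2_0 (R : realType) (XX : Type) (n : nat) (X : 'I_n -> XX)
    (H : set (XX -> R)) (t : R) : H (fun=> 0) -> ball2 X H t (fun=> 0).
Proof.
move=> H0; split => //=; rewrite (_ : (fun=> _) = (fun=> 0)); last first.
  by apply/funext => i; rewrite expr0n.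
by rewrite avg0 sqr_ge0.
Qed.

Lemma gauss_sup_ge0 (R : realType) (Om : Type) (XX : Type) (n : nat)
    (X : 'I_n -> XX) (z : 'I_n -> Om -> R) (H : set (XX -> R)) (t : R) (w : Om) :
  H (fun=> 0) -> (0 <= gauss_sup X z H t w)%E.
Proof.
move=> H0; apply: ereal_sup_ubound; exists (fun=> 0); first exact: ball2_0.
congr EFin; rewrite (_ : (fun=> _) = (fun=> 0)) ?avg0//.
by apply/funext => i; rewrite mul0r.
Qed.

Section GaussComplexity.
Context (R : realType) (d : measure_display) (Om : measurableType d)
  (P : probability Om R) (n : nat) (z : 'I_n -> {RV P >-> R}) (XX : Type)
  (X : 'I_n -> XX) (H : set (XX -> R)).

Lemma gauss_complexityE (t : R) :
  gauss_complexity z X H t = (\int[P]_w gauss_sup X (fun i => z i) H t w)%E.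
Proof. by []. Qed.

Lemma gauss_complexity_le (s t : R) :
  H (fun=> 0) -> 0 <= s <= t ->
  (gauss_complexity z X H s <= gauss_complexity z X H t)%E.
Proof.
move=> H0 /andP[s0 st]; rewrite !gauss_complexityE; apply: ge0_le_integralT => w.
  exact: gauss_sup_ge0.
apply: le_ereal_sup => _ [h [Hh hs] <-]; exists h => //; split => //.
by apply: le_trans hs _; rewrite ler_sqr ?nnegrE// (le_trans s0).
Qed.

Lemma gauss_complexity_ge0 (t : R) :
  H (fun=> 0) -> (0 <= gauss_complexity z X H t)%E.
Proof.
move=> H0; rewrite gauss_complexityE; apply: integral_ge0 => w _.
exact: gauss_sup_ge0.
Qed.

(** A function of norm [t] is at most [n * t] at every point of the sample, so
    that the sum of the absolute moments is a possible constant. *)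
Lemma gauss_complexity_linear :
  (0 < n)%N -> H (fun=> 0) -> iid_std_normal z ->
  exists K : R, 0 <= K /\
    forall t, 0 <= t -> (gauss_complexity z X H t <= (t * K)%:E)%E.
Proof.
move=> n0 H0 iz; pose k i := (\int[P]_w `|z i w|%:E)%E.
have ki i : k i \is a fin_num.
  rewrite ge0_fin_numE; last by apply: integral_ge0 => w _; rewrite lee_fin.
  have -> : k i = (\int[distribution P (z i)]_x `|x|%:E)%E.
    by rewrite ge0_integral_distribution//; apply/measurable_EFinP; exact: normr_measurable.
  exact: std_normal_abs_fin (iid_distribution i iz).
exists (\sum_i fine (k i)); split.
  by apply: sumr_ge0 => i _; apply: fine_ge0; apply: integral_ge0 => w _; rewrite lee_fin.
move=> t t0; rewrite gauss_complexityE.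
have mz i : measurable_fun setT (fun w => `|z i w|%:E).
  by apply/measurable_EFinP; exact: measurableT_comp.
apply: (@le_trans _ _ (\int[P]_w (t%:E * \sum_i `|z i w|%:E))%E); last first.
  rewrite ge0_integralZl//; last 2 first.
  - by apply: emeasurable_sum => i; exact: mz.
  - by move=> w _; apply: sume_ge0 => i _; rewrite lee_fin.
  rewrite ge0_integral_sum//.
  rewrite EFinM -sumEFin; apply: lee_wpmul2l; first by rewrite lee_fin.
  by apply: lee_sum => i _; rewrite fineK//; exact: ki.
apply: ge0_le_integralT => w; first exact: gauss_sup_ge0.
apply: ge_ereal_sup => _ [h [_ hs] <-].
rewrite sumEFin -EFinM lee_fin /avg ler_pdivrMl ?ltr0n// mulrA mulr_sumr.
apply: ler_sum => i _; apply: le_trans (ler_norm _) _; rewrite normrM ler_wpM2r//.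
have nt0 : 0 <= n%:R * t by rewrite mulr_ge0.
rewrite -(@ler_pXn2r _ 2)// ?nnegrE// real_normK ?num_real//.
have n1 : 1 <= n%:R :> R by rewrite ler1n.
move: hs; rewrite /avg ler_pdivrMl ?ltr0n// => hs.
apply: (@le_trans _ _ (\sum_(j < n) h (X j) ^+ 2)).
  by rewrite (bigD1 i)//= lerDl; apply: sumr_ge0 => j _; exact: sqr_ge0.
apply: le_trans hs _; rewrite exprMn ler_wpM2r ?sqr_ge0//.
by rewrite expr2 ler_peMl.
Qed.

(** On each sign pattern the supremum is at least the value of the form that is
    optimal for the signs. Integrating over the pattern replaces each coordinate
    by its sign times a constant, and summing over the patterns gives back the
    Rademacher average. *)
Lemma gauss_complexity_rademacher (t : R) (T : finType)
    (h : T -> XX -> R) :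
  (0 < n)%N -> H (fun=> 0) -> iid_std_normal z ->
  (forall j, ball2 X H t (h j)) ->
  ((normal_pdf 0 1 2 / n%:R *
     cexp (fun e => smax (fun j i => h j (X i)) (signs R e)))%:E <=
   gauss_complexity z X H t)%E.
Proof.
move=> n0 H0 iz hb.
pose i0 := Ordinal n0.
pose nu : {measure set R -> \bar R} := distribution P (z i0).
have lnu : std_normal_law nu := iid_distribution i0 iz.
have [k0 hk pk] : exists2 k0, (\int[nu]_x (Num.max x 0)%:E = k0%:E)%E & normal_pdf 0 1 2 <= k0.
  have a := std_normal_pos_ge lnu.
  have b : (\int[nu]_x (Num.max x 0)%:E < +oo)%E.
    apply: le_lt_trans (std_normal_abs_fin lnu).
    apply: ge0_le_integralT => x; rewrite lee_fin ?le_max ?lexx ?orbT//.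
    by rewrite ge_max ler_norm normr_ge0.
  move: a b; case: (integral _ _ _) => [r| |] //; rewrite lee_fin => a _.
  by exists r.
pose sm e := smax (fun j i => h j (X i)) (signs R e).
have best (e : {ffun 'I_n -> bool}) : exists g : XX -> R,
    ball2 X H t g /\ dotp (fun i => g (X i)) (signs R e) = sm e.
  have [s0|[j sj]] := smax_attained (fun j i => h j (X i)) (signs R e).
    exists (fun=> 0); split; first exact: ball2_0.
    by rewrite /sm s0 /dotp big1// => i _; rewrite mul0r.
  by exists (h j); split; [exact: hb|rewrite /sm sj].
have [hs hsP] := choice best.
pose u i e w := z i w * \1_[set w | sign_pattern z w = e] w.
have hu i e := integral_sign_pattern e i iz lnu hk.
(* A measurable minorant of the supremum, linear on each sign pattern. *)
pose f w := avg (fun i => hs (sign_pattern z w) (X i) * z i w).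
have fE w : (f w)%:E = (\sum_e \sum_i (n%:R^-1 * hs e (X i))%:E * (u i e w)%:E)%E.
  rewrite (bigD1 (sign_pattern z w))//= [X in (_ + X)%E]big1 ?adde0 => [|e ne].
    rewrite /f /avg mulr_sumr -sumEFin; apply: eq_bigr => i _.
    by rewrite -EFinM /u indicE mem_set// mulr1 mulrA.
  rewrite big1// => i _; rewrite -EFinM /u indicE memNset ?mulr0//= => h'.
  by move: ne; rewrite h' eqxx.
have iu i e : P.-integrable setT (fun w => ((n%:R^-1 * hs e (X i))%:E * (u i e w)%:E)%E).
  by apply: integrableZl => //; have [] := hu i e.
have isum e : P.-integrable setT (fun w => (\sum_i (n%:R^-1 * hs e (X i))%:E * (u i e w)%:E)%E).
  exact: integrable_sum.
have intf : P.-integrable setT (fun w => (f w)%:E).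
  under eq_fun do rewrite fE; exact: integrable_sum.
have If : (\int[P]_w (f w)%:E = (2 * k0 / n%:R * cexp sm)%:E)%E.
  under eq_integral do rewrite fE.
  rewrite integral_sum//.
  rewrite (eq_bigr (fun e : {ffun 'I_n -> bool} => (2 * k0 / n%:R * (2^-1 ^+ n * sm e))%:E)) => [|e _].
    rewrite sumEFin -mulr_sumr; congr (_ * _)%:E; rewrite /cexp /pexp.
    by apply: eq_bigr => e _; rewrite prodr_const card_ord.
  rewrite integral_sum//; have [_ <-] := hsP e.
  rewrite /dotp !mulr_sumr -sumEFin; apply: eq_bigr => i _.
  have [hi he] := hu i e.
  rewrite integralZl// he -EFinM /signs; congr EFin.
  have -> : (2^-1 : R) ^+ n = 2^-1 * 2^-1 ^+ n.-1 by rewrite -exprS prednK.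
  by field; rewrite pnatr_eq0 -lt0n.
have c0 : 0 <= cexp sm by apply: cexp_ge0 => e; exact: smax_ge0.
apply: (@le_trans _ _ (\int[P]_w (f w)%:E)%E).
  rewrite If lee_fin ler_wpM2r// ler_wpM2r ?invr_ge0//.
  by have := normal_pdf_ge0 0 1 (2 : R); lra.
rewrite gauss_complexityE integralE.
apply: (@le_trans _ _ (\int[P]_x (fun w => (f w)%:E)^\+ x)%E).
  by rewrite geeDl// oppe_le0; apply: integral_ge0 => w _; exact: funeneg_ge0.
apply: ge0_le_integralT => w; first exact: funepos_ge0.
rewrite funeposE ge_max gauss_sup_ge0// andbT.
apply: ereal_sup_ubound; exists (hs (sign_pattern z w)) => //.
by have [] := hsP (sign_pattern z w).
Qed.

End GaussComplexity.

(** * Sub-Gaussian noise and its centered square *)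

Lemma square_gauge (R : realType) (th : R) : 0 < th ->
  gauge (fun y => th * y ^+ 2).
Proof.
move=> th0; split.
- by apply: measurable_funM => //; exact: exprn_measurable.
- by rewrite expr0n mulr0.
- move=> x y xy; rewrite ler_pM2l// -[x ^+ 2]real_normK ?num_real//.
  by rewrite -[y ^+ 2]real_normK ?num_real// ler_sqr ?nnegrE.
move=> c; exists (1 + c / th) => y; rewrite -ler_pdivlMl// mulrC => h.
have := sqr_ge0 (`|y| - 1); have : y ^+ 2 = `|y| ^+ 2 by rewrite real_normK ?num_real.
by nra.
Qed.

Lemma abs_gauge (R : realType) (th : R) : 0 < th -> gauge (fun y => th * `|y|).
Proof.
move=> th0; split.
- by apply: measurable_funM => //; exact: normr_measurable.
- by rewrite normr0 mulr0.
- by move=> x y xy; rewrite ler_pM2l.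
by move=> c; exists (c / th) => y; rewrite mulrC ler_pdivlMr.
Qed.

(** [68 ^ 2] exceeds [128 * 6 ^ 2], the constant required by [walk_reach_near]
    at distance [6 * y]. *)
Lemma square_walk_reaches (R : realType) (th c : R) (N : nat) :
  0 < th -> 0 < c -> (0 < N)%N -> 68 ^+ 2 <= th * c ^+ 2 ->
  walk_reaches (fun y => th * y ^+ 2) N (c / Num.sqrt N%:R).
Proof.
move=> th0 c0 N0 hc G y r cG rN yr.
have sN : 0 < Num.sqrt N%:R :> R by rewrite sqrtr_gt0 ltr0n.
apply: walk_reach_near => //; first by rewrite divr_ge0 ?ltW.
have -> : r%:R * N%:R * (c / Num.sqrt N%:R) ^+ 2 = r%:R * c ^+ 2.
  rewrite expr_div_n sqr_sqrtr//; field; by rewrite pnatr_eq0 -lt0n.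
apply: (@le_trans _ _ (th * y ^+ 2 * c ^+ 2)); last first.
  by rewrite ler_wpM2r ?sqr_ge0.
have -> : th * y ^+ 2 * c ^+ 2 = (th * c ^+ 2) * y ^+ 2 by ring.
have := ler_wpM2r (sqr_ge0 y) hc; have := sqr_ge0 y.
have -> : (6 * y) ^+ 2 = 36 * y ^+ 2 by ring.
have -> : 68 ^+ 2 = 4624 :> R by ring.
lra.
Qed.

Lemma abs_walk_reaches (R : realType) (th : R) (N : nat) :
  0 < th -> walk_reaches (fun y => th * `|y|) N (6 / th).
Proof.
move=> th0 G y r cG rN yr; apply: walk_reach_far => //.
  by rewrite divr_ge0// ltW.
rewrite normrM ger0_norm// mulrA ler_pdivlMr//.
have -> : 6 * `|y| * th = (th * `|y|) * 6 by ring.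
by rewrite ler_wpM2r.
Qed.

Lemma subgaussian_exp (R : realType) d (Om : measurableType d)
    (P : probability Om R) (xi : {RV P >-> R}) (s t : R) :
  subgaussian xi s ->
  (\int[P]_w (expR (t * xi w) + expR (- t * xi w))%:E <=
   (2 * expR (s ^+ 2 * t ^+ 2 / 2))%:E)%E.
Proof.
move=> sub; have m u : measurable_fun setT (fun w => (expR (u * xi w))%:E).
  apply/measurable_EFinP; apply: measurableT_comp => //.
  exact: measurable_funM.
under eq_integral do rewrite EFinD.
rewrite ge0_integralD//; try by move=> w _; rewrite lee_fin expR_ge0.
have := sub t; have := sub (- t); rewrite unlock sqrrN => h1 h2.
by rewrite mulr_natl mulr2n EFinD; exact: leeD.
Qed.

(** Chernoff bound with both signs at once; [t = x / s ^ 2] is the optimal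
    exponent. *)
Lemma subgaussian_tail (R : realType) d (Om : measurableType d)
    (P : probability Om R) (xi : {RV P >-> R}) (s x : R) :
  0 < s -> 0 <= x -> subgaussian xi s ->
  (P [set w | (x < `|xi w|)%R] <= (2 * expR (- (x ^+ 2 / (2 * s ^+ 2))))%:E)%E.
Proof.
move=> s0 x0 sub; pose t := x / s ^+ 2.
have t0 : 0 <= t by rewrite divr_ge0 ?sqr_ge0.
have mA : measurable [set w | x < `|xi w|].
  by apply: measurable_gt_level; exact: measurableT_comp.
have mi : measurable_fun setT (fun w => (expR (t * xi w) + expR (- t * xi w))%:E).
  apply/measurable_EFinP; apply: measurable_funD; apply: measurableT_comp => //;
  exact: measurable_funM.
apply: (@le_trans _ _ ((expR (- (t * x)))%:E * \int[P]_w (expR (t * xi w) + expR (- t * xi w))%:E)%E).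
  rewrite -ge0_integralZl//.
  have -> : P [set w | x < `|xi w|] = (\int[P]_w (\1_[set w | x < `|xi w|] w)%:E)%E.
    by rewrite integral_indic// setIT.
  apply: ge0_le_integralT => w; first by rewrite lee_fin.
  rewrite indicE -EFinM lee_fin.
  have [/set_mem /= xw|_] := boolP (w \in _); last by rewrite mulr_ge0 ?addr_ge0 ?expR_ge0.
  have e0 u : 0 < expR u :> R by exact: expR_gt0.
  have big : expR (t * `|xi w|) <= expR (t * xi w) + expR (- t * xi w).
    case: (ger0P (xi w)) => _; first by have := e0 (- t * xi w); lra.
    by rewrite mulrN mulNr; have := e0 (t * xi w); lra.
  apply: le_trans (ler_wpM2l (ltW (e0 _)) big).
  by rewrite -expRD -[leLHS]expR0 ler_expR addrC -mulrBr mulr_ge0// subr_ge0 ltW.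
apply: le_trans (lee_wpmul2l _ (subgaussian_exp t sub)) _; first by rewrite lee_fin expR_ge0.
rewrite -EFinM lee_fin mulrCA -expRD ler_wpM2l// ler_expR /t.
by apply: le_of_eq; field; rewrite gt_eqF.
Qed.

Lemma centered_second_moment (R : realType) d (Om : measurableType d)
    (P : probability Om R) (xi : {RV P >-> R}) (v : R) :
  ('E_P[xi] = 0)%E -> ('V_P[xi] = v%:E)%E ->
  (\int[P]_w (xi w ^+ 2)%:E = v%:E)%E.
Proof.
move=> E0 <-; rewrite /variance covariance.unlock E0 expectation.unlock.
by apply: eq_integral => w _; rewrite !fctE /= subr0 expr2.
Qed.

(** The factor 14 gives tails [expR (- 7 * j) <= 8^-j] to [noise_scale * xi ^
    2]; the summand 1 makes [noise_scale * sigma ^ 2 <= 1], so that the tails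
    survive the subtraction of the variance. *)
Definition noise_scale (R : realType) (K smax : R) : R :=
  (smax ^+ 2 * (14 * K ^+ 2 + 1))^-1.

(** A common bound on the second moments of the noise and of its centered
    square; 512 is twice the constant of [x ^ 4 <= 256 * (expR x + expR (- x))]. *)
Definition noise_moment (R : realType) (K smax : R) : R :=
  smax ^+ 2 + smax ^+ 4 + 512 * expR (K ^+ 2 * smax ^+ 2 / 2).

Section NoiseConditions.
Context (R : realType) (d : measure_display) (Om : measurableType d)
  (P : probability Om R) (xi : {RV P >-> R}) (K smax s : R)
  (K0 : 0 < K) (s0 : 0 < s) (ss : s <= smax)
  (E0 : ('E_P[xi] = 0)%E) (V0 : ('V_P[xi] = (s ^+ 2)%:E)%E)
  (sub : subgaussian xi (K * s)).

Let th := noise_scale K smax.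

Let smax0 : 0 < smax. Proof. exact: lt_le_trans ss. Qed.

Let s2 : s ^+ 2 <= smax ^+ 2.
Proof. by rewrite ler_sqr ?nnegrE// ltW. Qed.

Lemma noise_scale_gt0 : 0 < noise_scale K smax.
Proof.
by rewrite invr_gt0 mulr_gt0 ?exprn_gt0// addr_gt0// mulr_gt0// exprn_gt0.
Qed.

Lemma gauge_tail_square (j : nat) :
  (P [set w | (j%:R < th * xi w ^+ 2)%R] <= (2 * 8^-1 ^+ j)%:E)%E.
Proof.
have th0 : 0 < th := noise_scale_gt0.
have sub' : [set w | j%:R < th * xi w ^+ 2] `<=`
    [set w | Num.sqrt (j%:R / th) < `|xi w|].
  move=> w /= h; rewrite -sqrtr_sqr ltr_sqrt; last first.
    rewrite lt_neqAle sqr_ge0 andbT eq_sym sqrf_eq0; apply/eqP => x0.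
    by move: h; rewrite x0 expr0n mulr0 ltNge ler0n.
  by rewrite ltr_pdivrMr// mulrC.
have m1 : measurable [set w | j%:R < th * xi w ^+ 2].
  apply: measurable_gt_level; apply: measurable_funM => //.
  exact: measurable_funX.
have m2 : measurable [set w | Num.sqrt (j%:R / th) < `|xi w|].
  by apply: measurable_gt_level; exact: measurableT_comp.
apply: (@le_trans _ _ (P [set w | (Num.sqrt (j%:R / th) < `|xi w|)%R])).
  by apply: le_measure => //; rewrite inE.
have Ks0 : 0 < K * s by exact: mulr_gt0.
apply: le_trans (subgaussian_tail Ks0 (sqrtr_ge0 _) sub) _.
rewrite lee_fin ler_wpM2l// sqr_sqrtr ?divr_ge0 ?(ltW th0)//.
have e7 : expR (- 7) <= 8^-1 :> R.
  rewrite expRN lef_pV2 ?posrE ?expR_gt0//.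
  by apply: le_trans (expR_ge1Dx _); lra.
apply: le_trans (_ : expR (- 7) ^+ j <= _); last first.
  by apply: lerXn2r; rewrite ?nnegrE ?expR_ge0// invr_ge0.
rewrite -expRM_natl ler_expR mulrN lerN2.
have -> : j%:R / th / (2 * (K * s) ^+ 2) =
    j%:R * (smax ^+ 2 * (14 * K ^+ 2 + 1) / (2 * (K * s) ^+ 2)).
  by rewrite /th /noise_scale invrK mulrA.
rewrite ler_wpM2l// ler_pdivlMr ?mulr_gt0 ?exprn_gt0// exprMn.
have := sqr_ge0 smax; have := ler_wpM2l (sqr_ge0 K) s2.
by set a := K ^+ 2 * s ^+ 2; nra.
Qed.

(** Since [th * s ^ 2 <= 1 <= j], the left-hand event forces [xi ^ 2] itself
    beyond the level. *)
Lemma gauge_tail_centered_square (j : nat) : (0 < j)%N ->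
  (P [set w | (j%:R < th * `|xi w ^+ 2 - s ^+ 2|)%R] <= (2 * 8^-1 ^+ j)%:E)%E.
Proof.
move=> j0; have th0 : 0 < th := noise_scale_gt0.
apply: le_trans (gauge_tail_square j).
have m1 : measurable [set w | j%:R < th * xi w ^+ 2].
  apply: measurable_gt_level; apply: measurable_funM => //.
  exact: measurable_funX.
have m2 : measurable [set w | j%:R < th * `|xi w ^+ 2 - s ^+ 2|].
  apply: measurable_gt_level; apply: measurable_funM => //.
  apply: measurableT_comp => //; apply: measurable_funB => //.
  exact: measurable_funX.
apply: le_measure; rewrite ?inE// => w /=.
have ts : th * s ^+ 2 <= 1.
  rewrite /th /noise_scale ler_pdivrMl ?mulr1 ?mulr_gt0 ?exprn_gt0//; last first.
    by have := sqr_ge0 K; lra.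
  by have := mulr_ge0 (sqr_ge0 smax) (sqr_ge0 K); have := s2; rewrite mulrDr mulrCA; lra.
have j1 : 1 <= j%:R :> R by rewrite ler1n.
have p1 := mulr_ge0 (ltW th0) (sqr_ge0 s).
have p2 := mulr_ge0 (ltW th0) (sqr_ge0 (xi w)).
by case: (ger0P (xi w ^+ 2 - s ^+ 2)) => _; rewrite ?mulrN mulrBr; lra.
Qed.

Lemma noise_second_moment :
  (\int[P]_w (xi w ^+ 2)%:E <= (noise_moment K smax)%:E)%E.
Proof.
rewrite (centered_second_moment E0 V0) lee_fin /noise_moment.
have := expR_ge0 (K ^+ 2 * smax ^+ 2 / 2).
have : 0 <= smax ^+ 4 by rewrite exprn_ge0// ltW.
by have := s2; lra.
Qed.

Lemma centered_square_mean :
  ('E_P[fun w => (xi w ^+ 2 - s ^+ 2)%R] = 0)%E.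
Proof.
rewrite expectation.unlock.
have h := centered_second_moment E0 V0.
have mx : measurable_fun setT (fun w => (xi w ^+ 2)%:E).
  by apply/measurable_EFinP; exact: measurable_funX.
have ix : P.-integrable setT (fun w => (xi w ^+ 2)%:E).
  apply/integrableP; split => //.
  under eq_integral => w _ do rewrite gee0_abs ?lee_fin ?sqr_ge0//.
  by rewrite h ltry.
under eq_integral do rewrite EFinB.
rewrite integralB//; last exact: finite_measure_integrable_cst.
by rewrite h integral_prob_cst subee.
Qed.

Lemma centered_square_second_moment :
  (\int[P]_w ((xi w ^+ 2 - s ^+ 2) ^+ 2)%:E <= (noise_moment K smax)%:E)%E.
Proof.
have h := subgaussian_exp 1 sub.
have m u : measurable_fun setT (fun w => (expR (u * xi w))%:E).
  apply/measurable_EFinP; apply: measurableT_comp => //.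
  exact: measurable_funM.
have s4 : s ^+ 4 <= smax ^+ 4 by apply: lerXn2r; rewrite ?nnegrE// ltW.
apply: (@le_trans _ _ (\int[P]_w ((smax ^+ 4)%:E + 256%:E * (expR (1 * xi w) + expR (- 1 * xi w))%:E))%E).
  apply: ge0_le_integralT => w; first by rewrite lee_fin sqr_ge0.
  rewrite -EFinM -EFinD lee_fin.
  have x4 : xi w ^+ 4 <= 256 * (expR (1 * xi w) + expR (- 1 * xi w)).
    pose y := `|xi w| / 4.
    have y0 : 0 <= y by rewrite divr_ge0.
    have -> : xi w ^+ 4 = 256 * y ^+ 4.
      have -> : xi w ^+ 4 = `|xi w| ^+ 4.
        by rewrite -[4%N]/(2 * 2)%N !exprM real_normK ?num_real.
      by rewrite /y; field.
    rewrite ler_wpM2l//; apply: (@le_trans _ _ (expR `|xi w|)).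
      have -> : `|xi w| = 4%:R * y by rewrite /y; field.
      rewrite expRM_natl; apply: lerXn2r; rewrite ?nnegrE ?expR_ge0//.
      by apply: le_trans (expR_ge1Dx _); lra.
    rewrite mul1r mulN1r; have := expR_ge0 (xi w); have := expR_ge0 (- xi w).
    by case: (ger0P (xi w)); lra.
  have -> : (xi w ^+ 2 - s ^+ 2) ^+ 2 = xi w ^+ 4 + s ^+ 4 - 2 * (xi w ^+ 2 * s ^+ 2) by ring.
  have : 0 <= xi w ^+ 2 * s ^+ 2 by rewrite mulr_ge0 ?sqr_ge0.
  by lra.
have mi : measurable_fun setT (fun w => (expR (1 * xi w) + expR (- 1 * xi w))%:E).
  by under eq_fun do rewrite EFinD; apply: emeasurable_funD; exact: m.
rewrite ge0_integralD//; last 2 first.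
- by move=> w _; rewrite lee_fin exprn_ge0// ltW.
- exact: measurable_funeM.
rewrite integral_prob_cst ge0_integralZl//.
apply: le_trans (leeD2l _ (lee_wpmul2l _ h)) _ => //.
rewrite -EFinM -EFinD lee_fin /noise_moment expr1n mulr1.
have : expR ((K * s) ^+ 2 / 2) <= expR (K ^+ 2 * smax ^+ 2 / 2).
  by rewrite ler_expR ler_wpM2r// exprMn ler_wpM2l ?sqr_ge0.
have := sqr_ge0 smax; lra.
Qed.

End NoiseConditions.

(** * First-order conditions *)

Lemma avgD (R : realType) n (u v : 'I_n -> R) :
  avg (fun i => u i + v i) = avg u + avg v.
Proof. by rewrite /avg big_split mulrDr. Qed.

Lemma avgZ (R : realType) n c (u : 'I_n -> R) :
  avg (fun i => c * u i) = c * avg u.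
Proof. by rewrite /avg -mulr_sumr mulrCA. Qed.

Lemma avgN (R : realType) n (u : 'I_n -> R) : avg (fun i => - u i) = - avg u.
Proof. by rewrite /avg sumrN mulrN. Qed.

Lemma ler_avg (R : realType) n (u v : 'I_n -> R) :
  (forall i, u i <= v i) -> avg u <= avg v.
Proof. by move=> uv; rewrite /avg ler_wpM2l ?invr_ge0//; exact: ler_sum. Qed.

Lemma eq_avg (R : realType) n (u v : 'I_n -> R) : u =1 v -> avg u = avg v.
Proof. by move=> uv; congr avg; exact/funext. Qed.

Lemma avg_ge0 (R : realType) n (u : 'I_n -> R) :
  (forall i, 0 <= u i) -> 0 <= avg u.
Proof. by move=> u0; rewrite -(avg0 R n); exact: ler_avg. Qed.

Lemma avg_sqr_le0 (R : realType) n (u : 'I_n -> R) i :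
  (0 < n)%N -> avg (fun i => u i ^+ 2) <= 0 -> u i = 0.
Proof.
move=> n0; rewrite /avg pmulr_rle0 ?invr_gt0 ?ltr0n// => h.
apply/eqP; rewrite -sqrf_eq0 eq_le sqr_ge0 andbT; apply: le_trans h.
by rewrite (bigD1 i)//= lerDl; apply: sumr_ge0 => j _; exact: sqr_ge0.
Qed.

(** Weighted form of [(u + v) ^ 2 <= (1 + r) * u ^ 2 + (1 + 1 / r) * v ^ 2] with
    the optimal ratio of the two norms. *)
Lemma avg_minkowski (R : realType) n (u v : 'I_n -> R) (tau : R) :
  (0 < n)%N -> 0 <= tau -> avg (fun i => v i ^+ 2) <= tau ^+ 2 ->
  Num.sqrt (avg (fun i => (u i + v i) ^+ 2)) <=
  Num.sqrt (avg (fun i => u i ^+ 2)) + tau.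
Proof.
move=> n0 tau0 hv.
have u20 : 0 <= avg (fun i => u i ^+ 2) by apply: avg_ge0 => i; exact: sqr_ge0.
set al := Num.sqrt (avg (fun i => u i ^+ 2)).
have al0 : 0 <= al by exact: sqrtr_ge0.
have al2 : avg (fun i => u i ^+ 2) = al ^+ 2 by rewrite sqr_sqrtr.
have at0 : 0 <= al + tau by exact: addr_ge0.
rewrite -(ger0_norm at0) -sqrtr_sqr ler_sqrt ?sqr_ge0//.
move: tau0; rewrite le_eqVlt => /predU1P[tau0|tau0].
  have v0 i : v i = 0 by apply: (avg_sqr_le0 i n0); rewrite (le_trans hv)// -tau0 expr0n.
  rewrite -tau0 addr0 -al2; apply: le_of_eq.
  by apply: eq_avg => i; rewrite v0 addr0.
move: al0; rewrite le_eqVlt => /predU1P[al0|al0].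
  have v0 i : u i = 0 by apply: (avg_sqr_le0 i n0); rewrite al2 -al0 expr0n.
  rewrite -al0 add0r; apply: le_trans hv; apply: le_of_eq.
  by apply: eq_avg => i; rewrite v0 add0r.
apply: (@le_trans _ _ (avg (fun i => (1 + tau / al) * u i ^+ 2 + (1 + al / tau) * v i ^+ 2))).
  apply: ler_avg => i; rewrite -subr_ge0.
  have -> : (1 + tau / al) * u i ^+ 2 + (1 + al / tau) * v i ^+ 2 - (u i + v i) ^+ 2 =
    (tau * u i - al * v i) ^+ 2 / (al * tau) by field; rewrite !gt_eqF.
  by rewrite divr_ge0 ?sqr_ge0// mulr_ge0// ltW.
rewrite avgD !avgZ al2.
have k0 : 0 <= 1 + al / tau by rewrite addr_ge0// divr_ge0// ltW.
have := ler_wpM2l k0 hv.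
have -> : (al + tau) ^+ 2 = (1 + tau / al) * al ^+ 2 + (1 + al / tau) * tau ^+ 2.
  by field; rewrite !gt_eqF.
lra.
Qed.

Lemma first_order (R : realType) (A B : R) :
  (forall eta, 0 < eta <= 1 -> 0 <= eta * A + eta ^+ 2 * B) -> 0 <= A.
Proof.
move=> h; rewrite leNgt; apply/negP => A0.
pose eta := Num.min 1 (- A / (2 * (1 + `|B|))).
have B0 : 0 < 2 * (1 + `|B|) by rewrite mulr_gt0// ltr_pwDl.
have e0 : 0 < eta by rewrite lt_min ltr01 divr_gt0// oppr_gt0.
have e1 : eta <= 1 by rewrite ge_min lexx.
have e2 : eta * (2 * (1 + `|B|)) <= - A.
  by rewrite -ler_pdivlMr// ge_min lexx orbT.
have := h eta; rewrite e0 e1 => /(_ isT).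
rewrite expr2 -mulrA -mulrDr pmulr_rge0// => h2.
have : eta * B <= eta * `|B| by rewrite ler_pM2l// ler_norm.
lra.
Qed.

(** SURE is quadratic along the segment from the minimizer to the oracle pair,
    which star-shapedness keeps inside the class. Its slope at the minimizer is
    nonnegative, and differs from the slope at the oracle pair by twice the
    squared residual. *)
Lemma sure_first_order (R : realType) (XX : Type) (n : nat) (X : 'I_n -> XX)
    (sigma z : 'I_n -> R) (L B : set (XX -> R)) (lo bo lam b : XX -> R) :
  star_shaped L lo -> star_shaped B bo ->
  argmin_on (L `*` B) (fun p => SURE X sigma z p.1 p.2) (lam, b) ->
  avg (fun i => ((lam (X i) - lo (X i)) * z i - (b (X i) - bo (X i))) ^+ 2) <=
  - avg (fun i => (lo (X i) * z i - bo (X i)) *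
       ((lam (X i) - lo (X i)) * z i - (b (X i) - bo (X i)))
     - sigma i ^+ 2 * (lam (X i) - lo (X i))).
Proof.
move=> sL sB [[/= Ll Bb] hmin].
pose dd i := (lam (X i) - lo (X i)) * z i - (b (X i) - bo (X i)).
pose ro i := lo (X i) * z i - bo (X i).
pose A := 2 * avg (fun i => sigma i ^+ 2 * (lam (X i) - lo (X i))) +
  - 2 * avg (fun i => (ro i + dd i) * dd i).
suff : 0 <= A.
  have e : avg (fun i => ro i * dd i - sigma i ^+ 2 * (lam (X i) - lo (X i))) =
    avg (fun i => ro i * dd i) - avg (fun i => sigma i ^+ 2 * (lam (X i) - lo (X i))).
    by rewrite avgD avgN.
  rewrite e /A.
  have -> : avg (fun i => (ro i + dd i) * dd i) =
     avg (fun i => ro i * dd i) + avg (fun i => dd i ^+ 2).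
    by rewrite -avgD; apply: eq_avg => i; ring.
  lra.
apply: (@first_order _ A (avg (fun i => dd i ^+ 2))) => eta /andP[e0 e1].
have t01 : 0 <= 1 - eta <= 1 by apply/andP; split; lra.
have := hmin (fun x => (1 - eta) * lam x + (1 - (1 - eta)) * lo x,
              fun x => (1 - eta) * b x + (1 - (1 - eta)) * bo x).
move=> /(_ (conj (sL _ Ll _ t01) (sB _ Bb _ t01))) /=.
rewrite -subr_ge0; congr (0 <= _); rewrite /SURE /A.
set S := avg (fun i => sigma i ^+ 2).
have -> : avg (fun i => (((1 - eta) * lam (X i) + (1 - (1 - eta)) * lo (X i)) * z i -
     ((1 - eta) * b (X i) + (1 - (1 - eta)) * bo (X i))) ^+ 2) =
   avg (fun i => (lam (X i) * z i - b (X i)) ^+ 2) +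
   (- (2 * eta) * avg (fun i => (ro i + dd i) * dd i) + eta ^+ 2 * avg (fun i => dd i ^+ 2)).
  by rewrite -!avgZ -!avgD; apply: eq_avg => i; rewrite /ro /dd; ring.
have -> : avg (fun i => sigma i ^+ 2 * ((1 - eta) * lam (X i) + (1 - (1 - eta)) * lo (X i))) =
   avg (fun i => sigma i ^+ 2 * lam (X i)) - eta * avg (fun i => sigma i ^+ 2 * (lam (X i) - lo (X i))).
  by rewrite -!avgZ -avgN -!avgD; apply: eq_avg => i; ring.
ring.
Qed.

Section OracleRisk.
Context (R : realType) (d : measure_display) (Om : measurableType d)
  (P : probability Om R) (XX : Type) (n : nat) (X : 'I_n -> XX)
  (mu sigma : 'I_n -> R) (xi : 'I_n -> {RV P >-> R}).
Hypotheses (E0 : forall i, ('E_P[xi i] = 0)%E)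
  (V0 : forall i, ('V_P[xi i] = (sigma i ^+ 2)%:E)%E).

(** Bias-variance decomposition. *)
Lemma riskE (lam b : XX -> R) :
  risk P X mu (fun i w => mu i + xi i w) lam b =
  (avg (fun i => (lam (X i) * mu i - b (X i)) ^+ 2 +
                 (1 - lam (X i)) ^+ 2 * sigma i ^+ 2))%:E.
Proof.
rewrite /risk /avg [RHS]EFinM; congr (_ * _)%E.
rewrite -sumEFin; apply: eq_bigr => i _; rewrite expectation.unlock.
set p := lam (X i) * mu i - b (X i); set q := 1 - lam (X i).
have h2 := centered_second_moment (E0 i) (V0 i).
have h1 : (\int[P]_w (xi i w)%:E = 0)%E by rewrite -(E0 i) expectation.unlock.
have mx : measurable_fun setT (fun w => (xi i w ^+ 2)%:E).
  by apply/measurable_EFinP; exact: measurable_funX.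
have i2 : P.-integrable setT (fun w => (xi i w ^+ 2)%:E).
  apply/integrableP; split => //.
  under eq_integral => w _ do rewrite gee0_abs ?lee_fin ?sqr_ge0//.
  by rewrite h2 ltry.
have ic c : P.-integrable setT (fun _ : Om => c%:E) by exact: finite_measure_integrable_cst.
have i1 : P.-integrable setT (fun w => (xi i w)%:E).
  apply: (le_integrable _ _ _ (integrableD _ (ic 1) i2)) => //.
    exact/measurable_EFinP.
  move=> w _ /=; rewrite lee_fin [leRHS]ger0_norm ?addr_ge0 ?sqr_ge0//.
  have := sqr_ge0 (`|xi i w| - 2^-1).
  have -> : (xi i w) ^+ 2 = `|xi i w| ^+ 2 by rewrite real_normK ?num_real.
  by rewrite sqrrB; lra.
transitivity (\int[P]_w ((p ^+ 2)%:E + ((- (2 * p * q))%:E * (xi i w)%:E +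
    (q ^+ 2)%:E * (xi i w ^+ 2)%:E)))%E.
  apply: eq_integral => w _; rewrite -!EFinM -!EFinD; congr EFin.
  by rewrite /p /q; ring.
have i1' := integrableZl measurableT (- (2 * p * q)) i1.
have i2' := integrableZl measurableT (q ^+ 2) i2.
rewrite integralD//; last exact: integrableD.
rewrite integralD// !integralZl// h1 h2 mule0 add0e integral_prob_cst.
by rewrite -EFinM -EFinD.
Qed.

(** The same variation at the oracle pair, in the direction of the estimator. *)
Lemma risk_first_order (L B : set (XX -> R)) (lo bo lam b : XX -> R) :
  star_shaped L lo -> star_shaped B bo -> L lam -> B b ->
  argmin_on (L `*` B)
    (fun p => risk P X mu (fun i w => mu i + xi i w) p.1 p.2) (lo, bo) ->
  0 <= avg (fun i => (lo (X i) * mu i - bo (X i)) *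
       ((lam (X i) - lo (X i)) * mu i - (b (X i) - bo (X i)))
     - (1 - lo (X i)) * (lam (X i) - lo (X i)) * sigma i ^+ 2).
Proof.
move=> sL sB Ll Bb [_ hmin].
pose a i := lam (X i) - lo (X i).
pose Q i := a i * mu i - (b (X i) - bo (X i)).
set A := avg _; suff : 0 <= 2 * A by lra.
apply: (@first_order _ _ (avg (fun i => Q i ^+ 2 + a i ^+ 2 * sigma i ^+ 2))) => eta /andP[e0 e1].
have t01 : 0 <= eta <= 1 by rewrite (ltW e0).
have := hmin (fun x => eta * lam x + (1 - eta) * lo x,
              fun x => eta * b x + (1 - eta) * bo x).
move=> /(_ (conj (sL _ Ll _ t01) (sB _ Bb _ t01))) /=.
rewrite !riskE lee_fin -subr_ge0; congr (0 <= _).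
rewrite /A -!avgZ -avgN -!avgD; apply: eq_avg => i.
by rewrite /Q /a; ring.
Qed.

(** The two first-order conditions cancel everything except terms that are
    linear in the centered noises. *)
Lemma basic_inequality (L B : set (XX -> R)) (lo bo lam b : XX -> R) (w : Om) :
  star_shaped L lo -> star_shaped B bo ->
  argmin_on (L `*` B)
    (fun p => risk P X mu (fun i w => mu i + xi i w) p.1 p.2) (lo, bo) ->
  argmin_on (L `*` B)
    (fun p => SURE X sigma (fun i => mu i + xi i w) p.1 p.2) (lam, b) ->
  avg (fun i => ((lam (X i) - lo (X i)) * (mu i + xi i w) -
                 (b (X i) - bo (X i))) ^+ 2) <=
  avg (fun i => lo (X i) * (b (X i) - bo (X i)) * xi i w -
     (lam (X i) - lo (X i)) * ((2 * lo (X i) * mu i - bo (X i)) * xi i w +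
        lo (X i) * (xi i w ^+ 2 - sigma i ^+ 2))).
Proof.
move=> sL sB orc emp; have [[/= Ll Bb] _] := emp.
have h1 := sure_first_order sL sB emp.
have h2 := risk_first_order sL sB Ll Bb orc.
apply: le_trans h1 _; rewrite -avgN -[leLHS]addr0.
apply: le_trans (lerD (lexx _) h2) _; rewrite -avgD; apply: le_of_eq.
by apply: eq_avg => i; ring.
Qed.

End OracleRisk.

(** * Lower isometry and localization *)

Definition clip (R : realType) (A m : R) : R := Num.max (- A) (Num.min m A).

Lemma clip_cases (R : realType) (A m : R) : 0 <= A ->
  [\/ clip A m = m /\ `|m| <= A, clip A m = A /\ A <= m | clip A m = - A /\ m <= - A].
Proof.
move=> A0; rewrite /clip /Num.max /Num.min; case: (ltP m A) => mA.
  case: ltP => h; first by constructor 1; split=> //; rewrite ler_norml !ltW.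
  by constructor 3.
have -> : (- A < A) = (A != 0) by rewrite -subr_gt0 opprK lt_neqAle eq_sym addr_ge0// andbT -mulr2n mulrn_eq0.
by case: eqVneq => [A00|_] /=; constructor 2; rewrite ?A00 ?oppr0 -?A00.
Qed.

Lemma clip_lipschitz (R : realType) (A m m' : R) : 0 <= A ->
  `|clip A m - clip A m'| <= `|m - m'|.
Proof.
move=> A0; have [] := clip_cases m A0; have [] := clip_cases m' A0;
  move=> [-> h1] [-> h2]; move: h1 h2; rewrite ?ler_norml => h1 h2;
  case: (ger0P (m - m')) => h3; move: h1 h2 h3; do ?move=> /andP[? ?]; move=> *;
  rewrite ?ler_norml; apply/andP; split; lra.
Qed.

Lemma clip_le (R : realType) (A m : R) : 0 <= A -> `|clip A m| <= A.
Proof.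
move=> A0; have [[-> //]|[-> _]|[-> _]] := clip_cases m A0; rewrite ?normrN ger0_norm//.
Qed.

(** The excess of [m] over its clipped value has the sign of the clipped value
    plus [a * xi], since [a * xi] is at most [A] in size; their product is the
    only term of indefinite sign in the difference of the two sides. *)
Lemma square_lower_bound (R : realType) (A a m xi s2 : R) :
  0 <= A -> `|xi| <= A -> `|a| <= 1 -> 2 <= s2 ->
  m ^+ 2 / 2 + 2 * a ^+ 2 + 2 * (clip A m * a * xi) + a ^+ 2 * (xi ^+ 2 - s2) <=
  (m + a * xi) ^+ 2.
Proof.
move=> A0 xiA a1 hs.
have ax : `|a * xi| <= A by rewrite normrM -[A]mul1r ler_pM.
have [ax1 ax2] : - A <= a * xi /\ a * xi <= A by apply/andP; rewrite -ler_norml.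
set u := clip A m.
have ur : 0 <= (m - u) * (u + a * xi).
  have [[e _]|[e h]|[e h]] := clip_cases m A0; rewrite /u e.
  - by rewrite subrr mul0r.
  - by apply: mulr_ge0; lra.
  - by apply: mulr_le0; lra.
have sa : 0 <= a ^+ 2 * (s2 - 2) by rewrite mulr_ge0 ?sqr_ge0//; lra.
have h := sqr_ge0 (m - 2 * u).
rewrite -subr_ge0.
have -> : (m + a * xi) ^+ 2 - (m ^+ 2 / 2 + 2 * a ^+ 2 + 2 * (u * a * xi) + a ^+ 2 * (xi ^+ 2 - s2))
  = 2 * ((m - u) * (u + a * xi)) + (m - 2 * u) ^+ 2 / 2 + a ^+ 2 * (s2 - 2) by field.
lra.
Qed.

(** From [b = a * mu - (a * mu - b)]: for bounded [mu], the pair of [a * mu - b]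
    and [a] controls [b]. *)
Lemma norm_compare (R : realType) (M mu a b : R) :
  `|mu| <= M ->
  a ^+ 2 <= (M ^+ 2 + 4) * ((a * mu - b) ^+ 2 / 2 + 2 * a ^+ 2) /\
  b ^+ 2 <= (M ^+ 2 + 4) * ((a * mu - b) ^+ 2 / 2 + 2 * a ^+ 2).
Proof.
move=> hM; set m := a * mu - b.
have mu2 : mu ^+ 2 <= M ^+ 2.
  by rewrite -[mu ^+ 2]real_normK ?num_real// ler_sqr ?nnegrE// (le_trans _ hM).
have p1 := mulr_ge0 (sqr_ge0 M) (sqr_ge0 m).
have p2 := mulr_ge0 (sqr_ge0 M) (sqr_ge0 a).
have p3 := ler_wpM2l (sqr_ge0 a) mu2.
have p4 := sqr_ge0 a; have p5 := sqr_ge0 m.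
split; rewrite -subr_ge0.
  have -> : (M ^+ 2 + 4) * (m ^+ 2 / 2 + 2 * a ^+ 2) - a ^+ 2 =
    (M ^+ 2 * m ^+ 2) / 2 + 2 * (M ^+ 2 * a ^+ 2) + 2 * m ^+ 2 + 7 * a ^+ 2 by field.
  lra.
have -> : (M ^+ 2 + 4) * (m ^+ 2 / 2 + 2 * a ^+ 2) - b ^+ 2 =
    (M ^+ 2 * m ^+ 2) / 2 + 2 * (M ^+ 2 * a ^+ 2 - a ^+ 2 * mu ^+ 2) + 8 * a ^+ 2 +
    (a * mu + m) ^+ 2.
  by rewrite /m; field.
by have := sqr_ge0 (a * mu + m); lra.
Qed.

Definition ray_closed (R : realType) (XX : Type) (H : set (XX -> R)) : Prop :=
  forall h, H h -> forall eta : R, 0 <= eta <= 1 -> H (fun x => eta * h x).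

Lemma class_shift_ray (R : realType) (XX : Type) (H : set (XX -> R)) h0 :
  star_shaped H h0 -> ray_closed (class_shift H h0).
Proof.
move=> sH _ [h Hh <-] eta e01; exists (fun x => eta * h x + (1 - eta) * h0 x).
  exact: sH.
by apply/funext => x; ring.
Qed.

Lemma class_shift0 (R : realType) (XX : Type) (H : set (XX -> R)) h0 :
  H h0 -> class_shift H h0 (fun=> 0).
Proof. by move=> Hh; exists h0 => //; apply/funext => x; rewrite subrr. Qed.

(** Peeling argument. Along the ray to the oracle the left-hand side of the
    basic inequality is quadratic while the noise [W] is linear, so that both
    need to be compared at the single radius [r] only: a point with residual
    larger than [t] is shrunk to residual [t], or to radius [r] if it is
    still outside the ball, where the lower isometry is contradicted. *)
Lemma localization (R : realType) (XX : Type) (n : nat) (X : 'I_n -> XX)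
    (HA HB : set (XX -> R)) (z : 'I_n -> R) (W : (XX -> R) -> (XX -> R) -> R)
    (r t Q k : R) :
  ray_closed HA -> ray_closed HB -> 0 < t -> 0 < r -> 0 < k ->
  Q <= t ^+ 2 / 2 -> r ^+ 2 = 2 * k * t ^+ 2 ->
  (forall eta a b, W (fun x => eta * a x) (fun x => eta * b x) = eta * W a b) ->
  (forall a b, ball2 X HA r a -> ball2 X HB r b -> W a b <= Q) ->
  (forall a b, ball2 X HA r a -> ball2 X HB r b ->
     avg (fun i => a (X i) ^+ 2) <= k * (avg (fun i => (a (X i) * z i - b (X i)) ^+ 2) + Q) /\
     avg (fun i => b (X i) ^+ 2) <= k * (avg (fun i => (a (X i) * z i - b (X i)) ^+ 2) + Q)) ->
  forall a b, HA a -> HB b ->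
    avg (fun i => (a (X i) * z i - b (X i)) ^+ 2) <= W a b ->
    avg (fun i => (a (X i) * z i - b (X i)) ^+ 2) <= t ^+ 2.
Proof.
move=> rA rB t0 r0 k0 hQ hr WZ Wb iso a b Ha Hb basic.
rewrite leNgt; apply/negP => big.
set D2 := avg _ in basic big.
have D20 : 0 < D2 by apply: lt_trans big; rewrite exprn_gt0.
pose Dn := Num.sqrt D2.
have Dn2 : Dn ^+ 2 = D2 by rewrite sqr_sqrtr// ltW.
have Dn0 : 0 < Dn by rewrite sqrtr_gt0.
have sq_lt (x y : R) : 0 < x -> 0 < y -> x ^+ 2 < y ^+ 2 -> x < y.
  by move=> x0 y0; rewrite ltr_pXn2r ?nnegrE ?ltW.
have tD : t < Dn by apply: sq_lt => //; rewrite Dn2.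
have scale eta (h : XX -> R) : avg (fun i => (eta * h (X i)) ^+ 2) = eta ^+ 2 * avg (fun i => h (X i) ^+ 2).
  by rewrite -avgZ; apply: eq_avg => i; rewrite exprMn.
have scaleD eta : avg (fun i => (eta * a (X i) * z i - eta * b (X i)) ^+ 2) = eta ^+ 2 * D2.
  by rewrite /D2 -avgZ; apply: eq_avg => i; ring.
set NA := avg (fun i => a (X i) ^+ 2); set NB := avg (fun i => b (X i) ^+ 2).
have NA0 : 0 <= NA by apply: avg_ge0 => i; exact: sqr_ge0.
have NB0 : 0 <= NB by apply: avg_ge0 => i; exact: sqr_ge0.
pose eta := t / Dn.
have e0 : 0 < eta by rewrite divr_gt0.
have e1 : eta < 1 by rewrite ltr_pdivrMr// mul1r.
have eD : eta * Dn = t by rewrite /eta divfK// gt_eqF.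
have inball (c : R) : 0 <= c <= 1 -> c ^+ 2 * NA <= r ^+ 2 -> c ^+ 2 * NB <= r ^+ 2 ->
    ball2 X HA r (fun x => c * a x) /\ ball2 X HB r (fun x => c * b x).
  by move=> c01 h1 h2; split; (split; [exact: rA || exact: rB|rewrite scale]).
pose NM := Num.max NA NB.
have NM0 : 0 <= NM by rewrite le_max NA0.
have NAM : NA <= NM by rewrite le_max lexx.
have NBM : NB <= NM by rewrite le_max lexx orbT.
have ball c : 0 <= c <= 1 -> c ^+ 2 * NM <= r ^+ 2 ->
    ball2 X HA r (fun x => c * a x) /\ ball2 X HB r (fun x => c * b x).
  move=> c01 h; apply: inball => //; apply: le_trans h;
  by rewrite ler_wpM2l ?sqr_ge0.
have [small|large] := leP (eta ^+ 2 * NM) (r ^+ 2).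
  have e01 : 0 <= eta <= 1 by rewrite !ltW.
  have [bA bB] := ball eta e01 small.
  have := Wb _ _ bA bB; rewrite WZ.
  have : eta * D2 <= eta * W a b by rewrite ler_pM2l.
  have -> : eta * D2 = t * Dn by rewrite -Dn2 -eD; ring.
  have : t ^+ 2 < t * Dn by rewrite expr2 ltr_pM2l.
  have := exprn_gt0 2 t0; lra.
have NM1 : 0 < NM.
  rewrite lt_neqAle NM0 andbT eq_sym; apply/eqP => h.
  by move: large; rewrite h mulr0 ltNge sqr_ge0.
pose e2 := r / Num.sqrt NM.
have sNM : 0 < Num.sqrt NM by rewrite sqrtr_gt0.
have e20 : 0 < e2 by rewrite divr_gt0.
have e2N : e2 ^+ 2 * NM = r ^+ 2.
  rewrite /e2 expr_div_n sqr_sqrtr// divfK// gt_eqF//.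
have e2e : e2 ^+ 2 < eta ^+ 2 by rewrite -(ltr_pM2r NM1) e2N.
have e2lt : e2 < eta by exact: sq_lt.
have e201 : 0 <= e2 <= 1 by rewrite (ltW e20) ltW// (lt_trans e2lt).
have [|bA bB] := ball e2 e201; first by rewrite e2N.
have [] := iso _ _ bA bB; rewrite !scale scaleD -/NA -/NB => hA hB.
have : e2 ^+ 2 * NM <= k * (e2 ^+ 2 * D2 + Q).
  by rewrite /NM /Num.max; case: ifP => _.
rewrite e2N hr.
have : e2 ^+ 2 * D2 < t ^+ 2.
  have -> : t ^+ 2 = eta ^+ 2 * D2 by rewrite -Dn2 -exprMn eD.
  by rewrite ltr_pM2r.
move=> h1; have -> : 2 * k * t ^+ 2 = k * (2 * t ^+ 2) by ring.
rewrite ler_pM2l//; have := exprn_gt0 2 t0; lra.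
Qed.

(** * The critical radius *)

Lemma ln2_ge_half (R : realType) : 2^-1 <= ln 2 :> R.
Proof.
rewrite -ler_expR lnK ?posrE//.
have h := expR_ge1Dx (- 2^-1 : R).
have : expR 2^-1 * expR (- 2^-1) = 1 :> R by rewrite -expRD subrr expR0.
have := expR_gt0 (2^-1 : R); nra.
Qed.

Lemma ln_ratio_ge (R : realType) (n : nat) (delta : R) :
  (0 < n)%N -> 0 < delta <= 1 / 2 -> 2^-1 <= ln (n%:R / delta).
Proof.
move=> n0 /andP[d0 d1]; apply: le_trans (ln2_ge_half R) _.
rewrite ler_ln ?posrE ?divr_gt0 ?ltr0n// ler_pdivlMr//.
have : 1 <= n%:R :> R by rewrite ler1n.
lra.
Qed.

(** A positive infimum is attained: were the inequality to fail there,
    monotonicity of the complexities would propagate the failure to slightly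
    larger radii, where the quadratic has not caught up yet. Radii close to a
    zero infimum are admissible by definition. The linear bound on the
    complexities provides an admissible radius in the first place. *)
Lemma t_star_spec (R : realType) (n : nat) (GB GL : R -> \bar R)
    (C c delta K : R) :
  (0 < n)%N -> 0 < C -> 0 < c -> 0 < delta <= 1 / 2 -> 0 <= K ->
  (forall s t, 0 <= s <= t -> (GB s <= GB t)%E) ->
  (forall s t, 0 <= s <= t -> (GL s <= GL t)%E) ->
  (forall t, 0 <= t -> (0 <= GB t <= (t * K)%:E)%E) ->
  (forall t, 0 <= t -> (0 <= GL t <= (t * K)%:E)%E) ->
  let tst := t_star n GB GL C c delta in
  let adm t := Num.sqrt (ln (n%:R / delta)) * fine (GB (c * t)) +
     ln (n%:R / delta) * fine (GL (c * t)) <= t ^+ 2 / C in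
  [/\ 0 <= tst, 0 < tst -> adm tst &
   tst = 0 -> forall e, 0 < e -> exists t, [/\ 0 < t, t < e & adm t]].
Proof.
move=> n0 C0 c0 d01 K0 mB mL bB bL tst adm.
set l := ln (n%:R / delta) in adm *.
have l0 : 0 <= l by have := ln_ratio_ge n0 d01; rewrite -/l; lra.
pose p := `|ln delta| * Num.sqrt (ln n%:R / n%:R).
pose q := `|ln delta| ^+ 2 * (ln n%:R / n%:R).
have lnn0 : 0 <= ln n%:R :> R by rewrite ln_ge0// ler1n.
have p0 : 0 <= p by rewrite mulr_ge0// sqrtr_ge0.
have q0 : 0 <= q by rewrite mulr_ge0 ?sqr_ge0// divr_ge0.
pose rr t := Num.sqrt l * fine (GB (c * t)) + l * fine (GL (c * t)) + t * p + q.
have finB t : 0 <= t -> GB t \is a fin_num.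
  by move=> t0; have /andP[h1 h2] := bB t t0; rewrite ge0_fin_numE// (le_lt_trans h2)// ltry.
have finL t : 0 <= t -> GL t \is a fin_num.
  by move=> t0; have /andP[h1 h2] := bL t t0; rewrite ge0_fin_numE// (le_lt_trans h2)// ltry.
have ct0 t : 0 <= t -> 0 <= c * t by move=> t0; rewrite mulr_ge0// ltW.
pose S : set R := [set t | 0 < t /\ rr t <= t ^+ 2 / C].
have -> : tst = inf S.
  rewrite /tst /t_star; congr inf; apply/seteqP.
  have E t : 0 < t -> ((Num.sqrt l)%:E * GB (c * t)%R + l%:E * GL (c * t)%R +
    (t * `|ln delta| * Num.sqrt (ln n%:R / n%:R))%:E +
    (`|ln delta| ^+ 2 * (ln n%:R / n%:R))%:E = (rr t)%:E)%E.
    move=> t0; have ct := ct0 t (ltW t0).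
    rewrite -[GB _](fineK (finB _ ct)) -[GL _](fineK (finL _ ct)) -!EFinM -!EFinD.
    by congr EFin; rewrite /rr /p; congr (_ + _ + _); rewrite mulrA.
  by split=> t [t0 h]; split=> //; move: h; rewrite -/l E// lee_fin.
have rr_adm t : rr t <= t ^+ 2 / C -> 0 <= t -> adm t.
  move=> h t0; apply: le_trans h; rewrite /rr -addrA lerDl addr_ge0//.
  by rewrite mulr_ge0.
have [t1 St1] : S !=set0.
  pose a := Num.sqrt l * (c * K) + l * (c * K) + p.
  have cK0 : 0 <= c * K by rewrite mulr_ge0// ltW.
  have a0 : 0 <= a.
    by apply: addr_ge0 => //; apply: addr_ge0; apply: mulr_ge0; rewrite ?sqrtr_ge0.
  pose t := 1 + C * (a + q).
  have t1 : 1 <= t by rewrite /t lerDl mulr_ge0 ?(ltW C0)// addr_ge0.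
  have t0 : 0 < t by lra.
  exists t; split=> //; have ct := ct0 t (ltW t0).
  have hB : fine (GB (c * t)) <= c * t * K.
    by have /andP[_] := bB _ ct; rewrite -lee_fin fineK ?finB.
  have hL : fine (GL (c * t)) <= c * t * K.
    by have /andP[_] := bL _ ct; rewrite -lee_fin fineK ?finL.
  have h1 := ler_wpM2l (sqrtr_ge0 l) hB; have h2 := ler_wpM2l l0 hL.
  apply: (@le_trans _ _ (t * (a + q))).
    have : t * (a + q) = Num.sqrt l * (c * t * K) + l * (c * t * K) + t * p + t * q.
      by rewrite /a; ring.
    have : q <= t * q by rewrite ler_peMl.
    by rewrite /rr; lra.
  rewrite ler_pdivlMr// expr2 -mulrA ler_wpM2l ?(ltW t0)// mulrC /t; lra.
have lbS : lbound S 0 by move=> t [/ltW].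
have S0 : 0 <= inf S by apply: lb_le_inf => //; exists t1.
have hasS : has_inf S by split; [exists t1|exists 0].
split=> //.
  move=> i0; apply: rr_adm => //; rewrite leNgt; apply/negP => big.
  have v0 : 0 < rr (inf S) * C.
    by rewrite pmulr_lgt0//; apply: lt_trans big; rewrite divr_gt0// exprn_gt0.
  have sq : inf S < Num.sqrt (rr (inf S) * C).
    rewrite -[ltLHS]ger0_norm// -sqrtr_sqr ltr_sqrt//.
    by rewrite -ltr_pdivrMr.
  have gap : 0 < Num.sqrt (rr (inf S) * C) - inf S by rewrite subr_gt0.
  have [t St ht] := inf_adherent gap hasS.
  rewrite addrC subrK in ht.
  have [t0 h] := St.
  have it : inf S <= t by apply: ge_inf => //; exists 0.
  have mono : rr (inf S) <= rr t.
    have cc : 0 <= c * inf S <= c * t by rewrite ct0//= ler_pM2l.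
    have ctt := ct0 t (ltW t0).
    rewrite /rr lerD2r; apply: lerD; last by rewrite ler_wpM2r.
    apply: lerD; apply: ler_wpM2l; rewrite ?sqrtr_ge0//.
      by apply: fine_le; [exact: finB (ct0 _ S0)|exact: finB ctt|exact: mB].
    by apply: fine_le; [exact: finL (ct0 _ S0)|exact: finL ctt|exact: mL].
  have : t ^+ 2 < rr (inf S) * C.
    rewrite -[ltRHS](sqr_sqrtr (ltW v0)) ltr_pXn2r ?nnegrE ?sqrtr_ge0//.
    exact: ltW.
  by rewrite ltNge -ler_pdivlMr// (le_trans mono).
move=> i0 e e0; have [t St ht] := inf_adherent e0 hasS.
have [t0 h] := St; exists t; split=> //; first by rewrite i0 add0r in ht.
by apply: rr_adm => //; exact: ltW.
Qed.

(** [N] is the number of walk steps: large enough for all failure probabilities,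
    of the order of [ln (n / delta)]. *)
Lemma steps_exist (R : realType) (n : nat) (delta : R) :
  (0 < n)%N -> 0 < delta <= 1 / 2 ->
  exists N : nat, [/\ (0 < N)%N, N%:R <= 16 * ln (n%:R / delta),
    n%:R <= 8 ^+ N :> R &
    expR (- N%:R) + n%:R * (2 * 8^-1 ^+ N) <= delta / 4].
Proof.
move=> n0 d01; have /andP[d0 d1] := d01.
have l0 := ln_ratio_ge n0 d01; set l := ln _ in l0 *.
have nR : 1 <= n%:R :> R by rewrite ler1n.
have el : expR l = n%:R / delta by rewrite lnK// posrE divr_gt0// ltr0n.
(* [expR 4 >= 2 ^ 4] leaves room for the constants in the failure
   probability. *)
pose x := l + 4.
have ex : 16 * (n%:R / delta) <= expR x.
  rewrite /x expRD el [16 * _]mulrC ler_wpM2l ?divr_ge0 ?(ltW d0)//.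
  have -> : expR 4 = expR (1 : R) ^+ 4 by rewrite -expRM_natl mulr1.
  have -> : 16 = 2 ^+ 4 :> R by ring.
  by apply: lerXn2r; rewrite ?nnegrE ?expR_ge0//; have := expR_ge1Dx (1 : R); lra.
pose N := (Num.truncn x).+1.
have x0 : 0 <= x by rewrite /x; lra.
have xN : x <= N%:R by rewrite ltW// truncnS_gt.
have Nx : N%:R <= x + 1 by rewrite /N -natr1 lerD2r truncn_le.
have eN : expR (- N%:R) <= delta / (16 * n%:R).
  rewrite expRN -[leRHS]invrK lef_pV2 ?posrE ?expR_gt0 ?invr_gt0 ?divr_gt0//; last first.
    by rewrite mulr_gt0// ltr0n.
  rewrite invf_div -mulrA; apply: le_trans ex _.
  by rewrite ler_expR.
have e8 : 8^-1 <= expR (- 1) :> R.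
  have h := expR_ge1Dx (- 2^-1 : R).
  have -> : expR (- 1) = expR (- 2^-1) * expR (- 2^-1) :> R.
    by rewrite -expRD; congr expR; field.
  nra.
have e8N : 8^-1 ^+ N <= expR (- N%:R) :> R.
  rewrite -mulrN1 expRM_natl; apply: lerXn2r; rewrite ?nnegrE ?invr_ge0 ?expR_ge0//.
have nn : n%:R * expR (- N%:R) <= delta / 16.
  apply: le_trans (ler_wpM2l _ eN) _ => //.
  by apply: le_of_eq; field; rewrite gt_eqF// ltr0n.
have N0 : (0 < N)%N by [].
move: N xN Nx eN e8N nn N0 => N xN Nx eN e8N nn N0.
exists N; split=> //.
- by rewrite /x in Nx; lra.
- have h : n%:R * expR (- N%:R) <= 1 :> R by apply: le_trans nn _; lra.
  have : n%:R * 8^-1 ^+ N <= 1 :> R by apply: le_trans h; rewrite ler_wpM2l.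
  by rewrite exprVn ler_pdivrMr ?mul1r ?exprn_gt0.
have h1 : expR (- N%:R) <= n%:R * expR (- N%:R) :> R by rewrite ler_peMl ?expR_ge0.
have h2 : n%:R * (2 * 8^-1 ^+ N) <= 2 * (n%:R * expR (- N%:R)) :> R.
  by rewrite mulrCA ler_wpM2l// ler_wpM2l.
move: nn h1 h2; set y := n%:R * expR _; lra.
Qed.

Lemma std_normal_pdf_gt0 (R : realType) (x : R) : 0 < normal_pdf 0 1 x.
Proof.
rewrite /normal_pdf oner_eq0 mulr_gt0 ?expR_gt0//.
by rewrite normal_peak_gt0 ?oner_eq0.
Qed.

Lemma rademacher_gauss (R : realType) d (Om : measurableType d)
    (P : probability Om R) (n : nat) (z : 'I_n -> {RV P >-> R}) (XX : Type)
    (X : 'I_n -> XX) (H : set (XX -> R)) (s : R) :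
  (0 < n)%N -> H (fun=> 0) -> iid_std_normal z ->
  gauss_complexity z X H s \is a fin_num ->
  rademacher_le (ball2 X H s) (fun h i => h (X i))
    (n%:R * fine (gauss_complexity z X H s) / normal_pdf 0 1 2).
Proof.
move=> n0 H0 iz fG T h hb.
have k0 : 0 < normal_pdf 0 1 2 :> R by exact: std_normal_pdf_gt0.
have := gauss_complexity_rademacher n0 H0 iz hb.
rewrite -[X in (_ <= X)%E]fineK// lee_fin => hG.
rewrite ler_pdivlMr// mulrC -ler_pdivrMl ?ltr0n// mulrA [_ * normal_pdf _ _ _]mulrC.
exact: hG.
Qed.

Lemma rademacher_pair (R : realType) (I : finType) (TA TB : Type)
    (DA : set TA) (DB : set TB) (ga : TA -> I -> R) (gb : TB -> I -> R)
    (f : TA * TB -> I -> R) (al be ra rb : R) :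
  rademacher_le DA ga ra -> rademacher_le DB gb rb -> 0 <= al -> 0 <= be ->
  (forall p i, (DA `*` DB) p -> `|f p i| <= al * `|ga p.1 i| + be * `|gb p.2 i|) ->
  (forall p q i, (DA `*` DB) p -> (DA `*` DB) q ->
     `|f p i - f q i| <= al * `|ga p.1 i - ga q.1 i| + be * `|gb p.2 i - gb q.2 i|) ->
  rademacher_le (DA `*` DB) f (2 * al * ra + 2 * be * rb).
Proof.
move=> hA hB al0 be0 f0 flip T t Dt.
apply: le_trans (cexp_contraction (f := fun j => f (t j))
  (a := fun j => ga (t j).1) (b := fun j => gb (t j).2) al0 be0 _ _) _.
- by move=> i j; exact: f0.
- by move=> i j j'; exact: flip.
apply: lerD; apply: ler_wpM2l; rewrite ?mulr_ge0//.
  by apply: (hA T (fun j => (t j).1)) => j; case: (Dt j).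
by apply: (hB T (fun j => (t j).2)) => j; case: (Dt j).
Qed.

(** The function of norm [s] on the ray through [h] has, by Khintchine, a
    Rademacher average of at least the order of [s]. *)
Lemma gauss_complexity_ge_linear (R : realType) d (Om : measurableType d)
    (P : probability Om R) (n : nat) (z : 'I_n -> {RV P >-> R}) (XX : Type)
    (X : 'I_n -> XX) (H : set (XX -> R)) (h : XX -> R) (i : 'I_n) :
  (0 < n)%N -> ray_closed H -> H (fun=> 0) -> iid_std_normal z ->
  H h -> h (X i) != 0 ->
  exists k q : R, [/\ 0 < k, 0 < q & forall s : R, 0 < s <= q ->
    gauss_complexity z X H s \is a fin_num ->
    k * s <= fine (gauss_complexity z X H s)].
Proof.
move=> n0 rH H0 iz Hh hi.
have nR : 0 < n%:R :> R by rewrite ltr0n.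
set A := avg (fun i => h (X i) ^+ 2).
have A0 : 0 < A.
  rewrite /A /avg mulr_gt0 ?invr_gt0// (bigD1 i)//= ltr_pwDl//.
    by rewrite lt_neqAle sqr_ge0 andbT eq_sym sqrf_eq0.
  by apply: sumr_ge0 => j _; exact: sqr_ge0.
have k0 : 0 < normal_pdf 0 1 2 :> R by exact: std_normal_pdf_gt0.
exists (normal_pdf 0 1 2 / (8 * Num.sqrt n%:R)), (Num.sqrt A); split.
- by rewrite divr_gt0// mulr_gt0// sqrtr_gt0.
- by rewrite sqrtr_gt0.
move=> s /andP[s0 sA] fG.
have sA0 : 0 < Num.sqrt A by rewrite sqrtr_gt0.
pose eta := s / Num.sqrt A.
have e01 : 0 <= eta <= 1 by rewrite /eta ler_pdivrMr// mul1r sA andbT divr_ge0// ltW.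
have avgE : avg (fun i => (eta * h (X i)) ^+ 2) = s ^+ 2.
  under eq_avg => j do rewrite exprMn.
  by rewrite avgZ -/A /eta expr_div_n sqr_sqrtr ?divfK ?gt_eqF// ltW.
have rad := rademacher_gauss n0 H0 iz fG.
have bh : ball2 X H s (fun x => eta * h x) by split; [exact: rH|rewrite avgE].
have := rademacher_norm rad bh.
have -> : \sum_j (eta * h (X j)) ^+ 2 = n%:R * s ^+ 2.
  by rewrite -avgE /avg mulVKf// gt_eqF.
set G := fine _; set sn := Num.sqrt n%:R.
have sn0 : 0 < sn by rewrite sqrtr_gt0.
have -> : n%:R = sn ^+ 2 :> R by rewrite sqr_sqrtr// ltW.
have G0 : 0 <= G by rewrite fine_ge0// gauss_complexity_ge0.
rewrite -exprMn ler_sqr ?nnegrE ?mulr_ge0 ?invr_ge0 ?normal_pdf_ge0 ?(ltW s0) ?(ltW sn0)//.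
move=> hs; rewrite mulrAC ler_pdivrMr ?mulr_gt0//.
have := ler_wpM2r (ltW k0) hs.
have -> : 8 * (sn ^+ 2 * G / normal_pdf 0 1 2) * normal_pdf 0 1 2 =
  sn * (G * (8 * sn)) by field; rewrite gt_eqF.
by rewrite -mulrA ler_pM2l// mulrC.
Qed.

(** * Uniform control of the noise *)

Lemma mutually_independent_comp (R : realType) d (Om : measurableType d)
    (P : probability Om R) (n : nat) (xi v : 'I_n -> {RV P >-> R})
    (f : 'I_n -> R -> R) :
  (forall i, measurable_fun setT (f i)) ->
  (forall i w, v i w = f i (xi i w)) ->
  mutually_independent xi -> mutually_independent v.
Proof.
move=> mf vE ind J A mA.
have e i : v i @^-1` A i = xi i @^-1` (f i @^-1` A i).
  by apply/seteqP; split=> w /=; rewrite vE.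
under eq_bigcapr => i _ do rewrite e.
under [in RHS]eq_bigr => i _ do rewrite e.
apply: ind => i; rewrite -[_ @^-1` _]setTI; exact: mf.
Qed.

(** With steps of length [68 / sqrt (N * noise_scale)], the factor in
    [noise_tail] is at most [sqrt N] times this. *)
Definition linear_factor (R : realType) (K smax : R) : R :=
  48 * (68 / Num.sqrt (noise_scale K smax)) + 8 * (noise_moment K smax + 4).

(** With steps of length [6 / noise_scale], the factor in [noise_tail] is at
    most [N] times this. *)
Definition quadratic_factor (R : realType) (K smax : R) : R :=
  48 * (6 / noise_scale K smax) + 8 * (noise_moment K smax + 4).

Lemma noise_scale_ge0 (R : realType) (K smax : R) : 0 <= noise_scale K smax.
Proof. by rewrite invr_ge0 mulr_ge0 ?sqr_ge0// addr_ge0// mulr_ge0// sqr_ge0. Qed.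

Lemma noise_moment_ge0 (R : realType) (K smax : R) : 0 <= noise_moment K smax.
Proof.
rewrite /noise_moment -[4%N]/(2 * 2)%N exprM.
by rewrite !addr_ge0 ?sqr_ge0 ?mulr_ge0 ?expR_ge0.
Qed.

Lemma linear_factor_ge0 (R : realType) (K smax : R) : 0 <= linear_factor K smax.
Proof.
have := noise_moment_ge0 K smax.
rewrite /linear_factor => m; apply: addr_ge0; apply: mulr_ge0 => //.
exact: addr_ge0.
Qed.

Lemma quadratic_factor_ge0 (R : realType) (K smax : R) :
  0 <= quadratic_factor K smax.
Proof.
have := noise_moment_ge0 K smax; have := noise_scale_ge0 K smax.
rewrite /quadratic_factor => m m'; apply: addr_ge0; apply: mulr_ge0 => //.
  by rewrite divr_ge0.
exact: addr_ge0.
Qed.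

Lemma event_of_four (R : realType) d (Om : measurableType d)
    (P : probability Om R) (delta : R) (B1 B2 B3 B4 : set Om) :
  measurable B1 -> measurable B2 -> measurable B3 -> measurable B4 ->
  (P B1 <= (delta / 4)%:E)%E -> (P B2 <= (delta / 4)%:E)%E ->
  (P B3 <= (delta / 4)%:E)%E -> (P B4 <= (delta / 4)%:E)%E ->
  exists E : set Om, [/\ measurable E, ((1 - delta)%:E <= P E)%E &
    forall w, E w -> [/\ ~ B1 w, ~ B2 w, ~ B3 w & ~ B4 w]].
Proof.
move=> m1 m2 m3 m4 p1 p2 p3 p4.
have m12 : measurable (B1 `|` B2) by exact: measurableU.
have m34 : measurable (B3 `|` B4) by exact: measurableU.
have m : measurable ((B1 `|` B2) `|` (B3 `|` B4)) by exact: measurableU.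
exists (~` ((B1 `|` B2) `|` (B3 `|` B4))); split.
- exact: measurableC.
- rewrite probability_setC// EFinB leeB// ; last first.
  have h : (delta%:E = (delta / 4)%:E + (delta / 4)%:E + ((delta / 4)%:E + (delta / 4)%:E))%E.
    by rewrite -!EFinD; congr EFin; field.
  rewrite h; apply: le_trans (measureU2 _ m12 m34) _; apply: leeD.
    by apply: le_trans (measureU2 _ m1 m2) _; exact: leeD.
  by apply: le_trans (measureU2 _ m3 m4) _; exact: leeD.
by move=> w nB; split=> h; apply: nB; [left; left|left; right|right; left|right; right].
Qed.

Section NoiseEvent.
Context (R : realType) (d : measure_display) (Om : measurableType d)
  (P : probability Om R) (n : nat) (xi : 'I_n -> {RV P >-> R})
  (sigma : 'I_n -> R) (K smax delta : R) (N : nat).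
Hypotheses (n0 : (0 < n)%N) (N0 : (0 < N)%N) (K0 : 0 < K)
  (s0 : forall i, 0 < sigma i) (ss : forall i, sigma i <= smax)
  (E0 : forall i, ('E_P[xi i] = 0)%E)
  (V0 : forall i, ('V_P[xi i] = (sigma i ^+ 2)%:E)%E)
  (ind : mutually_independent xi)
  (sub : forall i, subgaussian (xi i) (K * sigma i))
  (nN : n%:R <= 8 ^+ N :> R)
  (eN : expR (- N%:R) + n%:R * (2 * 8^-1 ^+ N) <= delta / 4).

Let th := noise_scale K smax.
Let i0 : 'I_n := Ordinal n0.
Let th0 : 0 < th. Proof. exact: noise_scale_gt0 K0 (s0 i0) (ss i0). Qed.
Let smax0 : 0 < smax. Proof. exact: lt_le_trans (s0 i0) (ss i0). Qed.
Let V4 : 0 <= 8 * (noise_moment K smax + 4).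
Proof. by rewrite mulr_ge0// addr_ge0// noise_moment_ge0. Qed.
Let N1 : 1 <= N%:R :> R. Proof. by rewrite ler1n. Qed.

Lemma linear_noise (Th : Type) (D : set Th) (g : Th -> 'I_n -> R) (rho : R) :
  0 <= rho -> rademacher_le D g rho ->
  exists Bad : set Om, [/\ measurable Bad, (P Bad <= (delta / 4)%:E)%E &
    forall w, ~ Bad w ->
      (forall i, `|xi i w| <= Num.sqrt (N%:R / noise_scale K smax)) /\
      forall p, D p -> dotp (g p) (fun i => xi i w) <=
        linear_factor K smax * Num.sqrt N%:R * rho].
Proof.
move=> rho0 hr; pose c := 68 / Num.sqrt th.
have sth : 0 < Num.sqrt th by rewrite sqrtr_gt0.
have c0 : 0 < c by rewrite divr_gt0.
have sN : 0 < Num.sqrt N%:R :> R by rewrite sqrtr_gt0 ltr0n.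
have [||||Bad [mB PB hB]] := noise_tail_ge0 (V := noise_moment K smax) n0 N0
  (square_gauge th0) (square_walk_reaches th0 c0 N0 _) ind _ E0 _ nN _ rho0 hr.
- by rewrite /c expr_div_n sqr_sqrtr ?(ltW th0)// mulrC divfK ?gt_eqF.
- by move=> i j _; exact: gauge_tail_square K0 (s0 i) (ss i) (sub i) j.
- by move=> i; exact: noise_second_moment (s0 i) (ss i) (E0 i) (V0 i).
- by rewrite divr_gt0.
exists Bad; split=> //; first by apply: le_trans PB _; rewrite lee_fin.
move=> w nB; have [h1 h2] := hB w nB; split=> [i|p Dp].
  rewrite -sqrtr_sqr ler_sqrt ?divr_ge0 ?ler0n ?(ltW th0)//.
  by rewrite ler_pdivlMr// mulrC.
apply: le_trans (h2 p Dp) _; apply: ler_wpM2r => //.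
rewrite /linear_factor [leRHS]mulrDl -/th -/c.
have N1' : 1 <= Num.sqrt N%:R :> R by rewrite -[leLHS]sqrtr1 ler_sqrt.
have -> : 48 * N%:R * (c / Num.sqrt N%:R) = 48 * c * Num.sqrt N%:R.
  by rewrite -{1}[N%:R](@sqr_sqrtr _ N%:R) ?ler0n//; field; rewrite gt_eqF.
by rewrite lerD2l ler_peMr ?V4.
Qed.

Lemma quadratic_noise (Th : Type) (D : set Th) (g : Th -> 'I_n -> R) (rho : R) :
  0 <= rho -> rademacher_le D g rho ->
  exists Bad : set Om, [/\ measurable Bad, (P Bad <= (delta / 4)%:E)%E &
    forall w, ~ Bad w -> forall p, D p ->
      dotp (g p) (fun i => xi i w ^+ 2 - sigma i ^+ 2) <=
        quadratic_factor K smax * N%:R * rho].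
Proof.
move=> rho0 hr.
pose f i (y : R) := y ^+ 2 - sigma i ^+ 2.
have mf i : measurable_fun setT (f i).
  by apply: measurable_funB => //; exact: exprn_measurable.
have mv i : (fun w => f i (xi i w)) \in mfun.
  by apply: mem_set; exact: measurableT_comp.
pose v i : {RV P >-> R} := mfun_Sub (mv i).
have vE i w : v i w = f i (xi i w) by [].
have [||||Bad [mB PB hB]] := noise_tail_ge0 (Y := v) (V := noise_moment K smax) n0 N0
  (abs_gauge th0) (@abs_walk_reaches _ _ N th0) (mutually_independent_comp mf vE ind)
  _ _ _ nN _ rho0 hr.
- by move=> i j j0; exact: (gauge_tail_centered_square K0 (s0 i) (ss i) (sub i) j0).
- by move=> i; exact: centered_square_mean (E0 i) (V0 i).
- by move=> i; exact: centered_square_second_moment (s0 i) (ss i) (sub i).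
- by rewrite divr_gt0.
exists Bad; split=> //; first by apply: le_trans PB _; rewrite lee_fin.
move=> w nB p Dp; have [_ h2] := hB w nB.
apply: le_trans (h2 p Dp) _; apply: ler_wpM2r => //.
rewrite /quadratic_factor [leRHS]mulrDl -/th.
have -> : 48 * N%:R * (6 / th) = 48 * (6 / th) * N%:R by ring.
by rewrite lerD2l ler_peMr ?V4.
Qed.

Context (TA TB : Type) (DA : set TA) (DB : set TB)
  (ga : TA -> 'I_n -> R) (gb : TB -> 'I_n -> R) (lo h mu : 'I_n -> R)
  (M ra rb : R).
Hypotheses (M0 : 0 <= M) (ra0 : 0 <= ra) (rb0 : 0 <= rb)
  (hra : rademacher_le DA ga ra) (hrb : rademacher_le DB gb rb)
  (loM : forall i, `|lo i| <= M) (hM : forall i, `|h i| <= M)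
  (muM : forall i, `|mu i| <= M)
  (ga1 : forall a i, DA a -> `|ga a i| <= 1).

Let A0 := Num.sqrt (N%:R / noise_scale K smax).
Let A00 : 0 <= A0. Proof. exact: sqrtr_ge0. Qed.

(** Sum of the deviation bounds of four processes: [lo * b - h * a] and [- 2 *
    clip (a * mu - b) * a] against the noise, [- lo * a] and [- a ^ 2] against
    its centered square. *)
Definition noise_level : R := n%:R^-1 *
  (linear_factor K smax * Num.sqrt N%:R * (2 * M * ra + 2 * M * rb) +
   quadratic_factor K smax * N%:R * (2 * M * ra + 2 * 0 * rb) +
   (linear_factor K smax * Num.sqrt N%:R *
      (2 * (2 * (M + Num.sqrt (N%:R / noise_scale K smax))) * ra + 2 * 2 * rb) +
    quadratic_factor K smax * N%:R * (2 * 2 * ra + 2 * 0 * rb))).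

Let rad1 : rademacher_le (DA `*` DB)
  (fun p i => lo i * gb p.2 i - h i * ga p.1 i) (2 * M * ra + 2 * M * rb).
Proof.
apply: rademacher_pair hra hrb M0 M0 _ _.
  move=> p i _; rewrite addrC (le_trans (ler_normD _ _))// normrN !normrM.
  by apply: lerD; exact: ler_wpM2r.
move=> p q i _ _.
have -> : lo i * gb p.2 i - h i * ga p.1 i - (lo i * gb q.2 i - h i * ga q.1 i) =
   lo i * (gb p.2 i - gb q.2 i) - h i * (ga p.1 i - ga q.1 i) by ring.
rewrite addrC (le_trans (ler_normD _ _))// normrN !normrM.
by apply: lerD; exact: ler_wpM2r.
Qed.

Let rad2 : rademacher_le (DA `*` DB)
  (fun p i => - (lo i * ga p.1 i)) (2 * M * ra + 2 * 0 * rb).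
Proof.
apply: rademacher_pair hra hrb M0 (lexx 0) _ _.
  by move=> p i _; rewrite normrN normrM mul0r addr0 ler_wpM2r.
move=> p q i _ _; rewrite mul0r addr0.
have -> : - (lo i * ga p.1 i) - - (lo i * ga q.1 i) = - (lo i * (ga p.1 i - ga q.1 i)).
  by ring.
by rewrite normrN normrM ler_wpM2r.
Qed.

Let rad3 : rademacher_le (DA `*` DB)
  (fun p i => - (2 * (clip A0 (ga p.1 i * mu i - gb p.2 i) * ga p.1 i)))
  (2 * (2 * (M + A0)) * ra + 2 * 2 * rb).
Proof.
have MA0 : 0 <= 2 * (M + A0) by rewrite mulr_ge0// addr_ge0.
apply: rademacher_pair hra hrb MA0 (ler0n _ 2) _ _.
  move=> p i _; rewrite normrN !normrM ger0_norm//.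
  have := clip_le (ga p.1 i * mu i - gb p.2 i) A00.
  set c := clip _ _ => hc.
  have := ler_wpM2r (normr_ge0 (ga p.1 i)) hc.
  have := normr_ge0 (gb p.2 i); have := mulr_ge0 M0 (normr_ge0 (ga p.1 i)); lra.
move=> p q i [Dp _] [Dq _].
set c := clip _ (ga p.1 i * mu i - _); set c' := clip _ (ga q.1 i * mu i - _).
have hc' : `|c'| <= A0 by exact: clip_le.
have hc : `|c - c'| <= M * `|ga p.1 i - ga q.1 i| + `|gb p.2 i - gb q.2 i|.
  apply: le_trans (clip_lipschitz _ _ A00) _.
  have -> : ga p.1 i * mu i - gb p.2 i - (ga q.1 i * mu i - gb q.2 i) =
    mu i * (ga p.1 i - ga q.1 i) - (gb p.2 i - gb q.2 i) by ring.
  apply: le_trans (ler_normD _ _) _; rewrite normrN normrM lerD2r.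
  exact: ler_wpM2r.
have -> : - (2 * (c * ga p.1 i)) - - (2 * (c' * ga q.1 i)) =
   - (2 * ((c - c') * ga p.1 i + c' * (ga p.1 i - ga q.1 i))) by ring.
rewrite normrN normrM ger0_norm//.
have h1 : `|(c - c') * ga p.1 i| <= `|c - c'|.
  by rewrite normrM ler_piMr// ga1.
have h2 : `|c' * (ga p.1 i - ga q.1 i)| <= A0 * `|ga p.1 i - ga q.1 i|.
  by rewrite normrM ler_wpM2r.
have h3 := ler_normD ((c - c') * ga p.1 i) (c' * (ga p.1 i - ga q.1 i)).
lra.
Qed.

Let rad4 : rademacher_le (DA `*` DB)
  (fun p i => - (ga p.1 i ^+ 2)) (2 * 2 * ra + 2 * 0 * rb).
Proof.
apply: rademacher_pair hra hrb (ler0n _ 2) (lexx 0) _ _.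
  move=> p i [Dp _]; rewrite normrN normrX mul0r addr0 expr2.
  by have := ga1 i Dp; have := normr_ge0 (ga p.1 i); nra.
move=> p q i [Dp _] [Dq _]; rewrite mul0r addr0.
have -> : - (ga p.1 i ^+ 2) - - (ga q.1 i ^+ 2) =
  - ((ga p.1 i + ga q.1 i) * (ga p.1 i - ga q.1 i)) by ring.
rewrite normrN normrM ler_wpM2r// (le_trans (ler_normD _ _))//.
by rewrite (_ : 2 = 1 + 1 :> R) ?lerD ?ga1// -natr1.
Qed.

(** The first average is the right-hand side of the basic inequality and the
    second one the error of the lower isometry. Both are linear in the noise and
    in its centered square, with coefficients that are Lipschitz in the pair
    [(a, b)], so that contraction reduces them to the two classes. Clipping [a *
    mu - b] is what makes its product with [a] Lipschitz. *)
Lemma noise_event : exists E : set Om,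
  [/\ measurable E, ((1 - delta)%:E <= P E)%E & forall w, E w ->
    (forall i, `|xi i w| <= Num.sqrt (N%:R / noise_scale K smax)) /\
    forall a b, DA a -> DB b ->
      avg (fun i => lo i * gb b i * xi i w -
         ga a i * (h i * xi i w + lo i * (xi i w ^+ 2 - sigma i ^+ 2)))
        <= noise_level /\
      avg (fun i => - (2 * (clip (Num.sqrt (N%:R / noise_scale K smax))
             (ga a i * mu i - gb b i) * ga a i * xi i w) +
         ga a i ^+ 2 * (xi i w ^+ 2 - sigma i ^+ 2))) <= noise_level].
Proof.
have r10 : 0 <= 2 * M * ra + 2 * M * rb by rewrite addr_ge0// !mulr_ge0.
have r20 : 0 <= 2 * M * ra + 2 * 0 * rb by rewrite addr_ge0// !mulr_ge0.
have r30 : 0 <= 2 * (2 * (M + A0)) * ra + 2 * 2 * rb.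
  by rewrite addr_ge0// !mulr_ge0// addr_ge0.
have r40 : 0 <= 2 * 2 * ra + 2 * 0 * rb by rewrite addr_ge0// !mulr_ge0.
have [B1 [m1 p1 h1]] := linear_noise r10 rad1.
have [B2 [m2 p2 h2]] := quadratic_noise r20 rad2.
have [B3 [m3 p3 h3]] := linear_noise r30 rad3.
have [B4 [m4 p4 h4]] := quadratic_noise r40 rad4.
have [E [mE PE hE]] := event_of_four m1 m2 m3 m4 p1 p2 p3 p4.
exists E; split=> // w /hE[nB1 nB2 nB3 nB4].
have [xiA k1] := h1 w nB1; have [_ k3] := h3 w nB3.
have k2 := h2 w nB2; have k4 := h4 w nB4.
split=> // a b Da Db; have Dab : (DA `*` DB) (a, b) by [].
have := k1 _ Dab; have := k2 _ Dab; have := k3 _ Dab; have := k4 _ Dab.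
have sN := sqrtr_ge0 (N%:R : R).
have u0 := linear_factor_ge0 K smax; have v0 := quadratic_factor_ge0 K smax.
have l1 := mulr_ge0 (mulr_ge0 u0 sN) r10.
have l2 := mulr_ge0 (mulr_ge0 v0 (ler0n R N)) r20.
have l3 := mulr_ge0 (mulr_ge0 u0 sN) r30.
have l4 := mulr_ge0 (mulr_ge0 v0 (ler0n R N)) r40.
rewrite /= => q4 q3 q2 q1; rewrite /avg /noise_level !ler_pM2l ?invr_gt0 ?ltr0n//.
split.
  apply: (@le_trans _ _ (dotp (fun i => lo i * gb b i - h i * ga a i) (fun i => xi i w) +
    dotp (fun i => - (lo i * ga a i)) (fun i => xi i w ^+ 2 - sigma i ^+ 2))).
    rewrite /dotp -big_split /=; apply: le_of_eq.
    by apply: eq_bigr => i _; ring.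
  by rewrite -/A0; lra.
apply: (@le_trans _ _ (dotp (fun i => - (2 * (clip A0 (ga a i * mu i - gb b i) * ga a i))) (fun i => xi i w) +
    dotp (fun i => - (ga a i ^+ 2)) (fun i => xi i w ^+ 2 - sigma i ^+ 2))).
  rewrite /dotp -big_split /=; apply: le_of_eq.
  by apply: eq_bigr => i _; rewrite /A0; ring.
by rewrite -/A0; lra.
Qed.

End NoiseEvent.

(** * The oracle inequality *)

Definition noise_constant (R : realType) (K smax M : R) : R :=
  16 / normal_pdf 0 1 2 *
  (linear_factor K smax * (2 * M + 4) +
   linear_factor K smax * (6 * M + 4 / Num.sqrt (noise_scale K smax)) +
   quadratic_factor K smax * (2 * M + 4)).

Lemma noise_constant_ge0 (R : realType) (K smax M : R) :
  0 <= M -> 0 <= noise_constant K smax M.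
Proof.
move=> M0; have u0 := linear_factor_ge0 K smax.
have v0 := quadratic_factor_ge0 K smax.
have p0 : 0 <= 16 / normal_pdf 0 1 2 :> R by rewrite divr_ge0// normal_pdf_ge0.
have s0 : 0 <= 4 / Num.sqrt (noise_scale K smax) by rewrite divr_ge0// sqrtr_ge0.
apply: mulr_ge0 => //; have m2 : 0 <= 2 * M + 4 by lra.
have m6 : 0 <= 6 * M + 4 / Num.sqrt (noise_scale K smax) by lra.
by apply: addr_ge0; [apply: addr_ge0|]; exact: mulr_ge0.
Qed.

(** The number [N] of steps is of order [l] and the clipping level of order
    [sqrt N]: the process with the clipped factor and those in the centered
    square cost [l] on the first class, while the second class is only met by
    the noise itself and costs [sqrt l]. *)
Lemma noise_level_le (R : realType) (n N : nat) (K smax M l gL gB : R) :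
  (0 < n)%N -> (0 < N)%N -> 0 <= M -> 0 <= l -> N%:R <= 16 * l ->
  0 <= gL -> 0 <= gB ->
  noise_level n K smax N M (n%:R * gL / normal_pdf 0 1 2)
    (n%:R * gB / normal_pdf 0 1 2) <=
  noise_constant K smax M * (Num.sqrt l * gB + l * gL).
Proof.
move=> n0 N0 M0 l0 Nl gL0 gB0.
have k0 : 0 < normal_pdf 0 1 2 :> R by exact: std_normal_pdf_gt0.
have nR : 0 < n%:R :> R by rewrite ltr0n.
have N1 : 1 <= N%:R :> R by rewrite ler1n.
rewrite /noise_level /noise_constant sqrtrM ?ler0n// sqrtrV ?noise_scale_ge0//.
have u0 := linear_factor_ge0 K smax; have v0 := quadratic_factor_ge0 K smax.
set u := linear_factor K smax in u0 *; set v := quadratic_factor K smax in v0 *.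
set q := (Num.sqrt (noise_scale K smax))^-1.
have q0 : 0 <= q by rewrite invr_ge0 sqrtr_ge0.
have sN0 := sqrtr_ge0 (N%:R : R); have NE : N%:R = Num.sqrt N%:R ^+ 2 :> R.
  by rewrite sqr_sqrtr.
set sN := Num.sqrt N%:R in sN0 NE *; set sl := Num.sqrt l.
have sl0 : 0 <= sl by exact: sqrtr_ge0.
have sN1 : 1 <= sN by rewrite -[leLHS]sqrtr1 ler_sqrt.
have sNl : sN <= 16 * sl.
  have -> : 16 = Num.sqrt (16 ^+ 2) :> R by rewrite sqrtr_sqr ger0_norm.
  rewrite -sqrtrM ?ler0n ?exprn_ge0//; apply: ler_wsqrtr.
  by apply: le_trans Nl _; rewrite ler_wpM2r//; lra.
have sNN : sN <= N%:R by rewrite NE expr2 ler_peMr.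
set p := normal_pdf 0 1 2 in k0 *.
have -> : n%:R^-1 *
  (u * sN * (2 * M * (n%:R * gL / p) + 2 * M * (n%:R * gB / p)) +
   v * N%:R * (2 * M * (n%:R * gL / p) + 2 * 0 * (n%:R * gB / p)) +
   (u * sN * (2 * (2 * (M + sN * q)) * (n%:R * gL / p) + 2 * 2 * (n%:R * gB / p)) +
    v * N%:R * (2 * 2 * (n%:R * gL / p) + 2 * 0 * (n%:R * gB / p)))) =
  p^-1 * (u * (2 * M + 4) * gB * sN + (u * gL * (6 * M * sN + 4 * q * N%:R) +
     v * (2 * M + 4) * gL * N%:R)).
  by rewrite NE; field; rewrite !gt_eqF.
have -> : 16 / p * (u * (2 * M + 4) + u * (6 * M + 4 * q) + v * (2 * M + 4)) *
  (sl * gB + l * gL) = p^-1 * (16 * (u * (2 * M + 4) + u * (6 * M + 4 * q) + v * (2 * M + 4)) *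
  (sl * gB + l * gL)) by field; rewrite gt_eqF.
rewrite ler_wpM2l ?invr_ge0 ?(ltW k0)//.
have m2 : 0 <= 2 * M + 4 by lra.
have m6 : 0 <= 6 * M + 4 * q by lra.
have a1 := mulr_ge0 u0 m2; have a2 := mulr_ge0 u0 m6; have a3 := mulr_ge0 v0 m2.
have t1 := ler_wpM2l (mulr_ge0 a1 gB0) sNl.
have ugL := mulr_ge0 u0 gL0.
have t2 : u * gL * (6 * M * sN + 4 * q * N%:R) <= u * gL * ((6 * M + 4 * q) * (16 * l)).
  apply: ler_wpM2l => //; apply: (@le_trans _ _ ((6 * M + 4 * q) * N%:R)).
    by rewrite [leRHS]mulrDl lerD2r ler_wpM2l// mulr_ge0.
  exact: ler_wpM2l.
have t3 := ler_wpM2l (mulr_ge0 a3 gL0) Nl.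
have b1 := mulr_ge0 (mulr_ge0 a2 sl0) gB0.
have b2 := mulr_ge0 (mulr_ge0 a3 sl0) gB0.
have b3 := mulr_ge0 (mulr_ge0 a1 l0) gL0.
lra.
Qed.

(** A variance of at least 2 makes the mean squared residual see [a] separately
    from [a * mu - b], and [norm_compare] recovers [b]. *)
Lemma lower_isometry (R : realType) (n : nat) (mu sigma xi a b : 'I_n -> R)
    (A M Q : R) :
  0 <= A -> (forall i, `|xi i| <= A) -> (forall i, `|a i| <= 1) ->
  (forall i, 2 <= sigma i ^+ 2) -> (forall i, `|mu i| <= M) ->
  avg (fun i => - (2 * (clip A (a i * mu i - b i) * a i * xi i) +
     a i ^+ 2 * (xi i ^+ 2 - sigma i ^+ 2))) <= Q ->
  avg (fun i => a i ^+ 2) <=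
    (M ^+ 2 + 4) * (avg (fun i => (a i * (mu i + xi i) - b i) ^+ 2) + Q) /\
  avg (fun i => b i ^+ 2) <=
    (M ^+ 2 + 4) * (avg (fun i => (a i * (mu i + xi i) - b i) ^+ 2) + Q).
Proof.
move=> A0 xiA a1 s2 muM hQ.
have k0 : 0 <= M ^+ 2 + 4 by rewrite addr_ge0// sqr_ge0.
have key (f : 'I_n -> R) : (forall i, f i <= (M ^+ 2 + 4) *
     ((a i * mu i - b i) ^+ 2 / 2 + 2 * a i ^+ 2)) ->
   avg f <= (M ^+ 2 + 4) * (avg (fun i => (a i * (mu i + xi i) - b i) ^+ 2) + Q).
  move=> hf; apply: (@le_trans _ _ ((M ^+ 2 + 4) *
     (avg (fun i => (a i * (mu i + xi i) - b i) ^+ 2) +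
      avg (fun i => - (2 * (clip A (a i * mu i - b i) * a i * xi i) +
     a i ^+ 2 * (xi i ^+ 2 - sigma i ^+ 2)))))); last by rewrite ler_wpM2l// lerD2l.
  rewrite -avgD -avgZ; apply: ler_avg => i; apply: le_trans (hf i) _.
  rewrite ler_wpM2l//.
  have := square_lower_bound (a i * mu i - b i) A0 (xiA i) (a1 i) (s2 i).
  have -> : a i * mu i - b i + a i * xi i = a i * (mu i + xi i) - b i by ring.
  lra.
by split; apply: key => i; have [] := norm_compare (a i) (b i) (muM i).
Qed.

(** As soon as one function of the class is nonzero on the sample the complexity
    grows at least linearly in the radius, whereas small admissible radii force
    it below a quadratic. *)
Lemma vanishing_class (R : realType) d (Om : measurableType d)
    (P : probability Om R) (n : nat) (z : 'I_n -> {RV P >-> R}) (XX : Type)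
    (X : 'I_n -> XX) (H : set (XX -> R)) (h : XX -> R) (i : 'I_n) (c C g : R) :
  (0 < n)%N -> ray_closed H -> H (fun=> 0) -> iid_std_normal z -> H h ->
  0 < c -> 0 < C -> 0 < g ->
  (forall e, 0 < e -> exists t, [/\ 0 < t, t < e &
     g * fine (gauss_complexity z X H (c * t)) <= t ^+ 2 / C]) ->
  h (X i) = 0.
Proof.
move=> n0 rH H0 iz Hh c0 C0 g0 small; apply/eqP/negPn/negP => hi.
have [k [q [k0 q0 lin]]] := gauss_complexity_ge_linear n0 rH H0 iz Hh hi.
have [U [U0 hU]] := gauss_complexity_linear X n0 H0 iz.
have gkcC : 0 < g * k * c * C by rewrite !mulr_gt0.
have e0 : 0 < Num.min (q / c) (g * k * c * C) by rewrite lt_min divr_gt0.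
have [t [t0 te ht]] := small _ e0.
have [t1 t2] : t < q / c /\ t < g * k * c * C by apply/andP; rewrite -lt_min.
have ct0 : 0 < c * t by rewrite mulr_gt0.
have fG : gauss_complexity z X H (c * t) \is a fin_num.
  by rewrite ge0_fin_numE ?gauss_complexity_ge0// (le_lt_trans (hU _ (ltW ct0)))// ltry.
have ctq : 0 < c * t <= q by rewrite ct0/= mulrC -ler_pdivlMr// ltW.
have h1 := le_trans (ler_wpM2l (ltW g0) (lin _ ctq fG)) ht.
move: h1; rewrite ler_pdivlMr// expr2.
have -> : g * (k * (c * t)) * C = t * (g * k * c * C) by ring.
by rewrite ler_pM2l// leNgt t2.
Qed.

Theorem theorem4 (R : realType) (K sigma_max M : R) (K_gt0 : 0 < K)
    (M_gt0 : 0 < M) :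
  exists C c : R, [/\ 0 < C, 0 < c &
  forall (n : nat) (XX : Type) (X : 'I_n -> XX) (mu sigma : 'I_n -> R)
    (d : measure_display) (Omega : measurableType d) (P : probability Omega R)
    (xi : 'I_n -> {RV P >-> R})
    (L B : set (XX -> R)) (lam_or b_or : XX -> R)
    (lam_hat b_hat : Omega -> XX -> R)
    (d' : measure_display) (Omega' : measurableType d')
    (P' : probability Omega' R) (zeta : 'I_n -> {RV P' >-> R}) (delta : R),
  let Z := fun (i : 'I_n) (w : Omega) => mu i + xi i w in
  let tst := t_star n
    (gauss_complexity zeta X (class_shift B b_or))
    (gauss_complexity zeta X (class_shift L lam_or)) C c delta in
  (0 < n)%N ->
  (forall i, 'E_P[xi i] = 0)%E ->
  (forall i, 'V_P[xi i] = (sigma i ^+ 2)%:E)%E ->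
  mutually_independent xi ->
  (forall i, subgaussian (xi i) (K * sigma i)) ->
  (forall i, Num.sqrt 2 <= sigma i <= sigma_max) ->
  (forall lam, L lam -> forall x, 0 <= lam x <= 1) ->
  argmin_on (L `*` B) (fun p => risk P X mu Z p.1 p.2) (lam_or, b_or) ->
  (forall w, argmin_on (L `*` B)
     (fun p => SURE X sigma (Z ^~ w) p.1 p.2) (lam_hat w, b_hat w)) ->
  star_shaped L lam_or ->
  star_shaped B b_or ->
  (forall i, `|mu i| <= M) ->
  (forall i, `|2 * lam_or (X i) * mu i - b_or (X i)| <= M) ->
  (forall i, `|lam_or (X i)| <= M) ->
  iid_std_normal zeta ->
  0 < delta <= 1 / 2 ->
  exists E : set Omega, [/\ measurable E, ((1 - delta)%:E <= P E)%E &
    forall w, E w ->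
      avg (fun i => ((lam_hat w (X i) - lam_or (X i)) * Z i w
                     - (b_hat w (X i) - b_or (X i))) ^+ 2) <= tst ^+ 2 /\
      Num.sqrt (avg (fun i =>
        (mu i - (b_hat w (X i) + (1 - lam_hat w (X i)) * Z i w)) ^+ 2))
      <= Num.sqrt (avg (fun i =>
        (mu i - (b_or (X i) + (1 - lam_or (X i)) * Z i w)) ^+ 2)) + tst]].
Proof.
have M0 := ltW M_gt0.
pose k : R := M ^+ 2 + 4; have k0 : 0 < k by rewrite ltr_wpDl ?sqr_ge0.
(* [k] is the constant of [norm_compare], and [localization] works at radius
   [sqrt (2 * k)] times [t]. *)
pose c := Num.sqrt (2 * k); have c0 : 0 < c by rewrite sqrtr_gt0 mulr_gt0.
have c2 : c ^+ 2 = 2 * k by rewrite sqr_sqrtr// mulr_ge0// ltW.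
pose C1 := noise_constant K sigma_max M.
have C10 : 0 <= C1 by exact: noise_constant_ge0.
pose C := 2 * C1 + 1; have C0 : 0 < C by rewrite /C; lra.
exists C, c; split=> // n XX X mu sigma d Omega P xi L B lam_or b_or lam_hat b_hat
  d' Omega' P' zeta delta Z tst n0 E0 V0 ind sub hsig L01 orc emp sL sB muM hM loM iz d01.
have sig2 i : 2 <= sigma i ^+ 2.
  have /andP[h _] := hsig i; rewrite -[leLHS](@sqr_sqrtr _ 2)//.
  by rewrite ler_sqr ?nnegrE ?sqrtr_ge0// (le_trans _ h)// sqrtr_ge0.
have s0 i : 0 < sigma i.
  by have /andP[h _] := hsig i; apply: lt_le_trans h; rewrite sqrtr_gt0.
have ss i : sigma i <= sigma_max by have /andP[] := hsig i.
have [[/= Llo Bbo] _] := orc.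
set HL := class_shift L lam_or in tst *; set HB := class_shift B b_or in tst *.
have rL : ray_closed HL by exact: class_shift_ray.
have rB : ray_closed HB by exact: class_shift_ray.
have HL0 : HL (fun=> 0) by exact: class_shift0.
have HB0 : HB (fun=> 0) by exact: class_shift0.
pose GB := gauss_complexity zeta X HB; pose GL := gauss_complexity zeta X HL.
have [U1 [U10 hU1]] := gauss_complexity_linear X n0 HB0 iz.
have [U2 [U20 hU2]] := gauss_complexity_linear X n0 HL0 iz.
have bB t : 0 <= t -> (0 <= GB t <= (t * (U1 + U2))%:E)%E.
  move=> t0; rewrite gauss_complexity_ge0//= (le_trans (hU1 t t0))// lee_fin.
  by rewrite ler_wpM2l// lerDl.
have bL t : 0 <= t -> (0 <= GL t <= (t * (U1 + U2))%:E)%E.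
  move=> t0; rewrite gauss_complexity_ge0//= (le_trans (hU2 t t0))// lee_fin.
  by rewrite ler_wpM2l// lerDr.
have [tst0 tpos tzero] := t_star_spec n0 C0 c0 d01 (addr_ge0 U10 U20)
  (fun s t => @gauss_complexity_le _ _ _ _ _ zeta _ X HB s t HB0)
  (fun s t => @gauss_complexity_le _ _ _ _ _ zeta _ X HL s t HL0) bB bL.
rewrite -/tst in tst0 tpos tzero.
set l := ln (n%:R / delta) in tpos tzero.
have l2 : 2^-1 <= l by exact: ln_ratio_ge.
have l0 : 0 < l by lra.
have sl0 : 0 < Num.sqrt l by rewrite sqrtr_gt0.
pose D2 w := avg (fun i => ((lam_hat w (X i) - lam_or (X i)) * Z i w
                     - (b_hat w (X i) - b_or (X i))) ^+ 2).
suff [E [mE PE hE]] : exists E : set Omega, [/\ measurable E,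
    ((1 - delta)%:E <= P E)%E & forall w, E w -> D2 w <= tst ^+ 2].
  exists E; split=> // w /hE h; split=> //.
  have := avg_minkowski (fun i => mu i - (b_or (X i) + (1 - lam_or (X i)) * Z i w))
    n0 tst0 h.
  by congr (Num.sqrt _ <= _); apply: eq_avg => i; ring.
have HLh w : HL (fun x => lam_hat w x - lam_or x).
  by have [[/= h _] _] := emp w; exists (lam_hat w).
have HBh w : HB (fun x => b_hat w x - b_or x).
  by have [[/= _ h] _] := emp w; exists (b_hat w).
have fin0 H t : H (fun=> 0) -> 0 <= fine (gauss_complexity zeta X H t).
  by move=> H0; rewrite fine_ge0// gauss_complexity_ge0.
(* A zero critical radius forces both classes to vanish on the sample. *)
have [t0|t0] := eqVneq tst 0.
  exists setT; split=> //.
    have /andP[dp _] := d01.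
    by rewrite probability_setT lee_fin gerBl// ltW.
  move=> w _; rewrite t0 expr0n /=.
  have a0 i : lam_hat w (X i) - lam_or (X i) = 0.
    apply: (vanishing_class i n0 rL HL0 iz (HLh w) c0 C0 l0) => e e0.
    have [t [tp te ht]] := tzero t0 e e0; exists t; split=> //.
    apply: le_trans ht; rewrite lerDr mulr_ge0 ?(ltW sl0)//; exact: fin0.
  have b0 i : b_hat w (X i) - b_or (X i) = 0.
    apply: (vanishing_class i n0 rB HB0 iz (HBh w) c0 C0 sl0) => e e0.
    have [t [tp te ht]] := tzero t0 e e0; exists t; split=> //.
    apply: le_trans ht; rewrite lerDl mulr_ge0 ?(ltW l0)//; exact: fin0.
  rewrite /D2 (eq_avg (v := fun=> 0)) ?avg0// => i.
  by rewrite a0 b0 mul0r subrr expr0n.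
have {t0}tst1 : 0 < tst by rewrite lt_neqAle eq_sym t0.
have adm := tpos tst1.
have ct0 : 0 <= c * tst by rewrite mulr_ge0// ltW.
have fB : GB (c * tst) \is a fin_num.
  by have /andP[h1 h2] := bB _ ct0; rewrite ge0_fin_numE// (le_lt_trans h2)// ltry.
have fL : GL (c * tst) \is a fin_num.
  by have /andP[h1 h2] := bL _ ct0; rewrite ge0_fin_numE// (le_lt_trans h2)// ltry.
set gB := fine _ in adm; set gL := fine _ in adm.
have gB0 : 0 <= gB by exact: fin0.
have gL0 : 0 <= gL by exact: fin0.
have hra := rademacher_gauss n0 HL0 iz fL.
have hrb := rademacher_gauss n0 HB0 iz fB.
have p0 : 0 < normal_pdf 0 1 2 :> R by exact: std_normal_pdf_gt0.
have ra0 : 0 <= n%:R * gL / normal_pdf 0 1 2 by rewrite divr_ge0 ?mulr_ge0// ltW.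
have rb0 : 0 <= n%:R * gB / normal_pdf 0 1 2 by rewrite divr_ge0 ?mulr_ge0// ltW.
have a1 a i : HL a -> `|a (X i)| <= 1.
  case=> lam Llam <-; have := L01 _ Llam (X i); have := L01 _ Llo (X i).
  by move=> /andP[? ?] /andP[? ?]; rewrite ler_norml; apply/andP; split; lra.
have [N [N0 Nl nN eN]] := steps_exist n0 d01; rewrite -/l in Nl.
have [E [mE PE hE]] := noise_event n0 N0 K_gt0 s0 ss E0 V0 ind sub nN eN M0
  ra0 rb0 hra hrb loM hM muM (fun a i => fun h : ball2 X HL (c * tst) a => a1 a i h.1).
exists E; split=> // w /hE[xiA ev].
set Q := noise_level _ _ _ _ _ _ _ in ev.
have hQ : Q <= tst ^+ 2 / 2.
  have nl := noise_level_le K sigma_max n0 N0 M0 (ltW l0) Nl gL0 gB0.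
  apply: le_trans nl _.
  rewrite -/C1; apply: le_trans (ler_wpM2l C10 adm) _.
  rewrite mulrCA ler_wpM2l ?sqr_ge0// ler_pdivrMr// /C; lra.
pose W (a b : XX -> R) := avg (fun i => lam_or (X i) * b (X i) * xi i w -
  a (X i) * ((2 * lam_or (X i) * mu i - b_or (X i)) * xi i w +
     lam_or (X i) * (xi i w ^+ 2 - sigma i ^+ 2))).
apply: (@localization R XX n X HL HB (Z ^~ w) W (c * tst) tst Q k rL rB tst1
  _ k0 hQ _ _ _ _ _ _ (HLh w) (HBh w)).
- by rewrite mulr_gt0.
- by rewrite exprMn c2.
- by move=> eta a b; rewrite -avgZ; apply: eq_avg => i; ring.
- by move=> a b ba bb; have [] := ev a b ba bb.
- move=> a b ba bb; have [_ h] := ev a b ba bb.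
  apply: (lower_isometry _ xiA _ sig2 muM h); first exact: sqrtr_ge0.
  by move=> i; exact: a1 ba.1.
exact: (basic_inequality E0 V0 (w := w) sL sB orc (emp w)).
Qed.
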